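(* Let $H$ be a graded (contractive, finite rank) Hilbert $A$-module for which the spectrum of the gauge group is bounded below. Then $K(H)=\chi(H)$, and in particular $K(H)$ is an integer.
   Context: Let $d\ge1$, $A=\mathbb C[z_1,\dots,z_d]$, $B_d$ the open unit ball of $\mathbb C^d$, $\sigma$ the normalized surface measure on the unit sphere $\partial B_d$. A (contractive) Hilbert $A$-module is a complex Hilbert space $H$ with commuting bounded operators $T_1,\dots,T_d$ (its canonical operators) satisfying $\|T_1\xi_1+\dots+T_d\xi_d\|^2\le\|\xi_1\|^2+\dots+\|\xi_d\|^2$ for all $\xi_k\in H$, made into an $A$-module by $f\cdot\xi=f(T_1,\dots,T_d)\xi$. Put $\Delta=(\mathbf 1-T_1T_1^*-\dots-T_dT_d^* )^{1/2}$; $\mathrm{rank}(H)$ is the dimension of the closure of $\Delta H$. Graded: $H$ is (separable and) equipped with a strongly continuous unitary representation $\Gamma$ of the circle group $\mathbb T$ on $H$ (the gauge group) such that $\Gamma(\lambda)T_k\Gamma(\lambda)^{-1}=\lambda T_k$ for all $\lambda\in\mathbb T$, $k=1,\dots,d$. The spectrum of $\Gamma$ is the set of $n\in\mathbb Z$ for which $\{\xi\in H:\Gamma(\lambda)\xi=\lambda^n\xi\ \forall\lambda\in\mathbb T\}\ne\{0\}$. Curvature invariant (for $\mathrm{rank}(H)<\infty$): for $z\in\mathbb C^d$ let $T(z)=\bar z_1T_1+\dots+\bar z_dT_d$; for $z\in B_d$ let $F(z)$ be the operator on $\Delta H$ given by $F(z)\xi=\Delta(\mathbf 1-T(z)^*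 )^{-1}(\mathbf 1-T(z))^{-1}\Delta\xi$. The limit $K_0(\zeta)=\lim_{r\uparrow1}(1-r^2)\,\mathrm{trace}\,F(r\zeta)$ exists for $\sigma$-a.e. $\zeta\in\partial B_d$ and lies in $[0,\mathrm{rank}(H)]$; $K(H)=\int_{\partial B_d}K_0\,d\sigma$. Euler characteristic (for $\mathrm{rank}(H)<\infty$): $M_H=\mathrm{span}\{f\cdot\Delta\xi:f\in A,\ \xi\in H\}$ (no closure taken) is a finitely generated $A$-module, so it has a finite free resolution $0\to F_n\to\dots\to F_1\to M_H\to0$ with $F_k$ a free $A$-module of finite rank $\beta_k$; $\chi(H)=\sum_{k=1}^n(-1)^{k+1}\beta_k$, which is independent of the resolution. *)

(* Defs.v *)
From HB Require Import structures.
From mathcomp Require Import all_boot all_order all_algebra.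
From mathcomp Require Import all_classical all_reals all_analysis.
From mathcomp Require Import measurable_realfun complex.
From mathcomp Require mpoly.
(* The notations of mpoly clash with those of analysis. *)
Import (canonicals, coercions) mpoly.

Set Implicit Arguments.
Unset Strict Implicit.
Unset Printing Implicit Defensive.

Import Order.TTheory GRing.Theory Num.Theory numFieldNormedType.Exports.

Local Open Scope classical_set_scope.
Local Open Scope ring_scope.
Local Open Scope complex_scope.

Section tuple_measure.
Context {disp : measure_display} {T : measurableType disp} {R : realType}.
Variable mu : {sigma_finite_measure set T -> \bar R}.

Definition tuple_cons n (p : T * n.-tuple T) : n.+1.-tuple T :=
  [the n.+1.-tuple T of p.1 :: p.2].

Definition tuple_uncons n (t : n.+1.-tuple T) : T * n.-tuple T :=
  (thead t, [tuple of behead t]).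

Lemma measurable_tuple_cons n :
  measurable_fun [set: T * n.-tuple T] (@tuple_cons n).
Proof. exact: measurable_cons. Qed.

Lemma measurable_tuple_uncons n :
  measurable_fun [set: n.+1.-tuple T] (@tuple_uncons n).
Proof.
apply/measurable_fun_pair => /=; first exact: measurable_tnth.
exact: measurable_behead.
Qed.

Lemma tuple_consK n : cancel (@tuple_cons n) (@tuple_uncons n).
Proof.
by move=> [x t]; congr (_, _); apply: val_inj.
Qed.

Section step.
Variables (n : nat) (nu : {sigma_finite_measure set (n.-tuple T) -> \bar R}).

Definition cons_measure : set (n.+1.-tuple T) -> \bar R :=
  pushforward (mu \x nu)%E (@tuple_cons n).

HB.instance Definition _ := Measure.copy cons_measure
  (measure_function_pushforward__canonical__measure_function_Measure
     (mu \x nu)%E (@measurable_tuple_cons n)).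

Let cons_measure_sigma_finite : sigma_finite setT cons_measure.
Proof.
have /sigma_finiteP[F [TF ndF Foo]] := sigma_finiteT mu.
have /sigma_finiteP[G [TG ndG Goo]] := sigma_finiteT nu.
exists (fun i => @tuple_uncons n @^-1` (F i `*` G i)).
  rewrite -preimage_bigcup (_ : \bigcup_i _ = setT) ?preimage_setT//.
  rewrite -subTset => -[x t] _.
  have [i _ Fi] : (\bigcup_i F i) x by rewrite -TF.
  have [j _ Gj] : (\bigcup_i G i) t by rewrite -TG.
  exists (maxn i j) => //; split.
  - by move: x Fi; exact/subsetPset/ndF/leq_maxl.
  - by move: t Gj; exact/subsetPset/ndG/leq_maxr.
move=> i; have [mF Fi] := Foo i; have [mG Gi] := Goo i; split.
  rewrite -[X in measurable X]setTI; apply: measurable_tuple_uncons => //.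
  exact: measurableX.
rewrite /cons_measure /pushforward -comp_preimage.
rewrite (_ : _ \o _ = id) ?preimage_id; last first.
  by apply/funext => x /=; rewrite tuple_consK.
by rewrite product_measure1E// lte_mul_pinfty// ge0_fin_numE.
Qed.

HB.instance Definition _ := Measure_isSigmaFinite.Build _ _ _
  cons_measure cons_measure_sigma_finite.

End step.

Fixpoint tuple_measure n : {sigma_finite_measure set (n.-tuple T) -> \bar R} :=
  match n with
  | 0%N => \d_([tuple] : 0.-tuple T)
  | n'.+1 => cons_measure (tuple_measure n')
  end.

End tuple_measure.

Section sphere.
Context {R : realType}.
Variable n : nat.
Local Notation Rn := (n.-tuple (measurableTypeR R)).
Implicit Types x : Rn.

Definition lebesgue_tuple : {sigma_finite_measure set Rn -> \bar R} :=
  tuple_measure (@lebesgue_measure R) n.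

Definition enorm x : R := Num.sqrt (\sum_(i < n) (tnth x i : R) ^+ 2).

Definition eball : set Rn := [set x | enorm x < 1].
Definition esphere : set Rn := [set x | enorm x = 1].

Definition normalize x : Rn := [tuple (tnth x i : R) / enorm x | i < n].

Lemma measurable_enorm : measurable_fun [set: Rn] enorm.
Proof.
apply: measurableT_comp.
  exact: continuous_measurable_fun (@sqrt_continuous R).
apply: measurable_sum => i; apply: measurable_funX; exact: measurable_tnth.
Qed.

Lemma measurable_eball : measurable eball.
Proof.
have := measurable_fun_ltr measurable_enorm (measurable_cst (1 : R)).
move=> /(_ measurableT [set true] I); rewrite setTI.
by congr measurable; apply/seteqP; split => x.
Qed.

Lemma measurable_normalize : measurable_fun [set: Rn] normalize.
Proof.
apply/measurable_fun_tnthP => i.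
rewrite (_ : _ \o _ = (fun x => (tnth x i : R) * enorm x `^ (-1))).
  apply: measurable_funM; first exact: measurable_tnth.
  exact: measurableT_comp (@measurable_powR R (-1)) measurable_enorm.
by apply/funext => x /=; rewrite tnth_mktuple powR_inv1 // sqrtr_ge0.
Qed.

(* The cone description of surface measure in polar coordinates: for a Borel
   subset [E] of the sphere, [sigma E] is the volume of the part of the ball
   that projects radially into [E], divided by the volume of the ball.  The
   origin is a null set. *)
Definition surface_measure (E : set Rn) : \bar R :=
  (((fine (lebesgue_tuple eball))^-1)%:E *
   lebesgue_tuple (normalize @^-1` E `&` eball))%E.

Let inv_vol_ge0 : 0 <= (fine (lebesgue_tuple eball))^-1.
Proof. by rewrite invr_ge0 fine_ge0. Qed.

Let ball_image := measure_function_pushforward__canonical__measure_function_Measure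
  (mrestr lebesgue_tuple measurable_eball) measurable_normalize.

HB.instance Definition _ := Measure.copy surface_measure
  (mscale (NngNum inv_vol_ge0) ball_image).

End sphere.

Section operators.
Context {R : realType} {H : completeNormedModType R[i]}.
Variable dot : {dot H for @Num.conj R[i]}.
Implicit Types (S P F : H -> H) (V : set H).

(* [dot] is linear in its first argument; with this property it is the inner
   product of a complex Hilbert space, [H] being complete for its norm. *)
Definition inner_product_norm := forall x : H, `|x| ^+ 2 = dot x x.

(* [xget] picks the object in question, which exists and is unique whenever
   the operators below are evaluated on the data of a Hilbert module of finite
   rank. *)
Definition adjoint S : H -> H :=
  xget (fun=> 0) [set S' | forall x y, dot (S x) y = dot x (S' y)].

Definition is_positive_sqrt P S :=
  [/\ linear S, continuous S, (forall x, 0 <= dot (S x) x)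
    & forall x, S (S x) = P x].

Definition positive_sqrt P : H -> H := xget (fun=> 0) (is_positive_sqrt P).

Definition op_inv S : H -> H :=
  xget (fun=> 0) [set S' | cancel S S' /\ cancel S' S].

Definition lin_span V : set H :=
  [set x | exists n (c : 'I_n -> R[i]) (v : 'I_n -> H),
     (forall i, V (v i)) /\ x = \sum_i c i *: v i].

Definition fin_dim V := exists n (v : 'I_n -> H), V = lin_span (range v).

Definition orthonormal_basis V n (e : 'I_n -> H) :=
  (forall i j, dot (e i) (e j) = (i == j)%:R) /\ V = lin_span (range e).

(* The value does not depend on the orthonormal basis. *)
Definition trace_on V F : R[i] :=
  xget 0 [set t | exists n (e : 'I_n -> H),
    orthonormal_basis V e /\ t = \sum_i dot (F (e i)) (e i)].

End operators.

Section hilbert_module.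
Context {R : realType} {H : completeNormedModType R[i]} {d : nat}.
Variable dot : {dot H for @Num.conj R[i]}.
Variable T : 'I_d -> {linear H -> H}.

Record contractive_hilbert_module : Prop := {
  module_norm : inner_product_norm dot ;
  module_bounded : forall k, continuous (T k) ;
  module_commute : forall j k x, T j (T k x) = T k (T j x) ;
  module_contractive : forall xi : 'I_d -> H,
    `|\sum_k T k (xi k)| ^+ 2 <= \sum_k `|xi k| ^+ 2 }.

Definition defect : H -> H :=
  positive_sqrt dot (fun x => x - \sum_k T k (adjoint dot (T k) x)).

Definition finite_rank := fin_dim (closure (range defect)).

Definition T_at (z : 'I_d -> R[i]) (x : H) : H :=
  \sum_k Num.conj (z k) *: T k x.

Definition F_at (z : 'I_d -> R[i]) (x : H) : H :=
  defect (op_inv (fun y => y - adjoint dot (T_at z) y)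
    (op_inv (fun y => y - T_at z y) (defect x))).

(* The real coordinates (Re z_1, ..., Re z_d, Im z_1, ..., Im z_d) of C^d. *)
Definition complex_coords (x : (d + d).-tuple R) (k : 'I_d) : R[i] :=
  tnth x (lshift d k) +i* tnth x (rshift d k).

(* The trace is a nonnegative real number; [Re] only changes its type.  [lim]
   takes an irrelevant default value on the null set where there is no limit. *)
Definition K0 (x : (d + d).-tuple R) : R :=
  lim ((1 - r ^+ 2) * complex.Re
         (trace_on dot (range defect) (F_at (fun k => r%:C * complex_coords x k)))
       @[r --> (1 : R)^'-]).

Definition curvature : R :=
  \int[@surface_measure R (d + d)]_(x in @esphere R (d + d)) K0 x.

Local Notation A := (mpoly.mpoly d R[i]).

Definition monomial_act (m : mpoly.multinom d) (x : H) : H :=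
  foldr (fun k y => iter (m k) (T k) y) x (enum 'I_d).

Definition poly_act (f : A) (x : H) : H :=
  \sum_(m <- mpoly.msupp f) mpoly.mcoeff m f *: monomial_act m x.

Definition M_module : set H :=
  lin_span [set x | exists f xi, x = poly_act f (defect xi)].

(* A resolution 0 -> F_n -> ... -> F_1 -> M -> 0 by free modules of finite
   rank: F_k.+1 is the module of row vectors of length [b k], the maps are
   continued by zero beyond F_n, [eps : F_1 -> M] is the augmentation. *)
Record free_resolution (M : set H) (n : nat) (b : nat -> nat)
    (eps : 'rV[A]_(b 0) -> H)
    (phi : forall k, {linear 'rV[A]_(b k.+1) -> 'rV[A]_(b k)}) : Prop := {
  resolution_add : forall u v, eps (u + v) = eps u + eps v ;
  resolution_scale : forall f u, eps (f *: u) = poly_act f (eps u) ;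
  resolution_onto : range eps = M ;
  resolution_exact0 : range (phi 0) = [set u | eps u = 0] ;
  resolution_exact : forall k, range (phi k.+1) = [set u | phi k u = 0] ;
  resolution_length : forall k, (n <= k)%N -> b k = 0 }.

(* A resolution exists when the rank is finite, and the alternating sum does
   not depend on it.  The sign is (-1)^(k+1) for F_k, i.e. (-1)^k for F_k.+1. *)
Definition euler_char : int :=
  xget 0 [set c | exists n b eps phi, @free_resolution M_module n b eps phi /\
    c = \sum_(k < n) (-1) ^+ k * (b k)%:Z].

End hilbert_module.

Definition separable_space (X : topologicalType) :=
  exists D : set X, countable D /\ dense D.

Section gauge.
Context {R : realType} {H : completeNormedModType R[i]} {d : nat}.
Variable dot : {dot H for @Num.conj R[i]}.
Variable T : 'I_d -> {linear H -> H}.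
(* Only the values of [Gamma] on the unit circle matter. *)
Variable Gamma : R[i] -> H -> H.

Definition circle : set R[i]^o := [set l | `|l| = 1].

(* [Gamma l] is onto, hence unitary, with inverse [Gamma l^-1]. *)
Record gauge_group : Prop := {
  gauge_linear : forall l, circle l -> linear (Gamma l) ;
  gauge_isometry : forall l, circle l ->
    forall x y, dot (Gamma l x) (Gamma l y) = dot x y ;
  gauge1 : forall x, Gamma 1 x = x ;
  gaugeM : forall l m, circle l -> circle m ->
    forall x, Gamma (l * m) x = Gamma l (Gamma m x) ;
  gauge_continuous : forall x, {within circle, continuous (Gamma ^~ x)} ;
  gauge_covariant : forall l, circle l ->
    forall k x, Gamma l (T k (Gamma l^-1 x)) = l *: T k x }.

Definition gauge_spectrum : set int :=
  [set n | exists2 x, x != 0 & forall l, circle l -> Gamma l x = l ^ n *: x].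

End gauge.

(* Main.v *)
Require Import Defs.
From HB Require Import structures.
From mathcomp Require Import all_boot all_order all_algebra.
From mathcomp Require Import all_classical all_reals all_analysis.
From mathcomp Require Import measurable_realfun complex ring lra zify.
From mathcomp Require mpoly.
Import -(notations) mpoly.
Import Order.TTheory GRing.Theory Num.Theory numFieldNormedType.Exports.

Set Implicit Arguments.
Unset Strict Implicit.
Unset Printing Implicit Defensive.

Local Open Scope classical_set_scope.
Local Open Scope ring_scope.
Local Open Scope complex_scope.

(** * Finite generation of submodules of a free module *)

Lemma nondecreasing_subseq (f : nat -> nat) :
  exists g : nat -> nat, {homo g : i j / (i < j)%N} /\
    {homo f \o g : i j / (i <= j)%N}.
Proof.
have step n : exists m, (n <= m)%N /\ forall k, (n <= k)%N -> (f m <= f k)%N.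
  have ex : exists v, `[< exists2 m, (n <= m)%N & f m = v >].
    by exists (f n); apply/asboolP; exists n.
  have [v /asboolP[m nm <-] vmin] := ex_minnP ex.
  by exists m; split=> // k nk; apply: vmin; apply/asboolP; exists k.
pose c n := projT1 (cid (step n)).
have cP n : (n <= c n)%N /\ forall k, (n <= k)%N -> (f (c n) <= f k)%N.
  exact: projT2 (cid (step n)).
pose g := fix g n := if n is n'.+1 then c (g n').+1 else c 0%N.
have gS n : (g n < g n.+1)%N by have [] := cP (g n).+1.
have gmono : {homo g : i j / (i < j)%N} by exact: homo_ltn ltn_trans gS.
exists g; split => //; apply: homo_leq => [//|y x z|n] /=; first exact: leq_trans.
case: n => [|n]; first by have [_] := cP 0%N; apply.
have [_ le2] := cP (g n).+1; apply: le2.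
by apply: leq_trans (ltnW (gS n.+1)).
Qed.

(** Dickson's lemma.  One coordinate at a time is made nondecreasing by passing
    to a subsequence. *)
Lemma dickson d (f : nat -> 'I_d -> nat) :
  exists i j, (i < j)%N /\ forall k, (f i k <= f j k)%N.
Proof.
have [g [gmono fg]] : exists g : nat -> nat, {homo g : i j / (i < j)%N} /\
    forall k : 'I_d, forall i j, (i <= j)%N -> (f (g i) k <= f (g j) k)%N.
  suff /(_ d) [g [gm fg]] : forall n, exists g : nat -> nat,
      {homo g : i j / (i < j)%N} /\
      forall k : 'I_d, (k < n)%N ->
        forall i j, (i <= j)%N -> (f (g i) k <= f (g j) k)%N.
    by exists g; split => // k; apply: fg.
  elim=> [|n [g [gm fg]]]; first by exists id; split=> [i j|].
  have [lt_nd|] := ltnP n d; last first.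
    move=> le_dn; exists g; split=> // k kn.
    by apply: fg; apply: leq_trans le_dn.
  have [h [hm fh]] := nondecreasing_subseq (fun i => f (g i) (Ordinal lt_nd)).
  exists (g \o h); split=> [i j ij|k]; first exact/gm/hm.
  rewrite ltnS leq_eqVlt => /orP[/eqP kn|kn] i j ij /=.
    have -> : k = Ordinal lt_nd by apply: val_inj.
    exact: fh _ _ ij.
  apply: fg => //; move: ij; rewrite leq_eqVlt => /orP[/eqP->//|/hm].
  exact: ltnW.
by exists (g 0%N), (g 1%N); split=> [|k]; [exact: gmono | exact: fg].
Qed.

Definition submodule (A : nzRingType) b (N : set 'rV[A]_b) :=
  N 0 /\ forall f u v, N u -> N v -> N (f *: u + v).

Section submodule_theory.
Context {A : nzRingType} {b : nat} {N : set 'rV[A]_b}.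
Hypothesis Nsub : submodule N.

Lemma submod0 : N 0. Proof. by case: Nsub. Qed.

Lemma submodZ f u : N u -> N (f *: u).
Proof. by case: Nsub => N0 NP /(NP f u 0); rewrite addr0; apply. Qed.

Lemma submodD u v : N u -> N v -> N (u + v).
Proof. by case: Nsub => _ /(_ 1 u v); rewrite scale1r. Qed.

Lemma submodN u : N u -> N (- u).
Proof. by move=> /(submodZ (-1)); rewrite scaleN1r. Qed.

Lemma submodB u v : N u -> N v -> N (u - v).
Proof. by move=> Nu /submodN; apply: submodD. Qed.

Lemma submod_sum I (r : seq I) (P : pred I) F :
  (forall i, P i -> N (F i)) -> N (\sum_(i <- r | P i) F i).
Proof. by move=> NF; elim/big_ind : _ => //; [exact: submod0|exact: submodD]. Qed.

Lemma submod_mulmx s (f : 'rV[A]_s) (G : 'M[A]_(s, b)) :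
  (forall i, N (row i G)) -> N (f *m G).
Proof.
by move=> NG; rewrite mulmx_sum_row; apply: submod_sum => i _; exact: submodZ.
Qed.

End submodule_theory.

Definition mx_span (A : nzRingType) s b (G : 'M[A]_(s, b)) : set 'rV[A]_b :=
  [set u | exists f : 'rV[A]_s, u = f *m G].

Lemma submodule_mx_span (A : nzRingType) s b (G : 'M[A]_(s, b)) : submodule (mx_span G).
Proof.
split; first by exists 0; rewrite mul0mx.
by move=> f u v [a ->] [c ->]; exists (f *: a + c); rewrite mulmxDl scalemxAl.
Qed.

Section hilbert_basis.
Context {K : fieldType} {d : nat}.
Local Notation A := (mpoly d K).

Lemma lead_reduction (p q : A) : p != 0 -> q != 0 ->
  (forall k, (mlead p k <= mlead q k)%N) ->
  exists g, q = g * p \/ (mlead (q - g * p) < mlead q)%O.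
Proof.
move=> p0 q0 pq; set m := mnm_sub (mlead q) (mlead p).
have mE : mnm_add m (mlead p) = mlead q by apply/submK/mnm_lepP.
set c := mcoeff (mlead q) q / mcoeff (mlead p) p.
have lp0 : mcoeff (mlead p) p != 0 by rewrite mleadc_eq0.
have lq0 : mcoeff (mlead q) q != 0 by rewrite mleadc_eq0.
have c0 : c != 0 by rewrite mulf_neq0// invr_neq0.
exists (c *: mpolyX K m).
have [->|ne0] := eqVneq q ((c *: mpolyX K m) * p); first by left.
right; rewrite lt_neqAle; apply/andP; split; last first.
  apply: (le_trans (mleadB_le _ _)); rewrite leUx lexx/=.
  apply: (le_trans (mleadM_le _ _)); rewrite -mE.
  by rewrite lemc_add2l (le_trans (mleadZ_le _ _))// mleadXm.
apply/eqP => lE.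
have : mcoeff (mlead (q - c *: mpolyX K m * p)) (q - c *: mpolyX K m * p) = 0.
  rewrite lE mcoeffB -scalerAl mcoeffZ -{2}mE addmC.
  by rewrite (mulrC (mpolyX _ _)) (addmC (mlead p)) mcoeffMX /c divfK ?subrr.
by move/eqP; rewrite mleadc_eq0 subr_eq0 (negPf ne0).
Qed.

Definition ideal_span (L : seq A) : set A :=
  [set p | exists c : nat -> A, p = \sum_(i < size L) c i * L`_i].

(** Hilbert's basis theorem.  In a sequence of elements of least leading
    monomial outside of the ideal generated by their predecessors, Dickson's
    lemma finds a leading monomial that divides a later one, whose element can
    then be reduced further. *)
Lemma ideal_fg (I : set A) : I 0 ->
  (forall f p q, I p -> I q -> I (f * p + q)) ->
  exists L : seq A, (forall p, p \in L -> I p) /\ I `<=` ideal_span L.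
Proof.
move=> I0 IP; apply: contrapT => notfg.
have step (L : seq A) : (forall p, p \in L -> I p) -> exists p,
    [/\ I p, ~ ideal_span L p &
     forall q, I q -> ~ ideal_span L q -> ~ (mlead q < mlead p)%O].
  move=> LI; apply: contrapT => nex; apply: notfg; exists L; split=> // p Ip.
  apply: contrapT; move: p Ip.
  suff wf m : forall p, mlead p = m -> I p -> ~ ~ ideal_span L p.
    by move=> p Ip; exact: wf Ip.
  move: m; apply: (well_founded_ind (@ltom_wf d)) => m IH p pm Ip nLp.
  by apply: nex; exists p; split=> // q Iq nLq; rewrite pm => /IH; apply.
pose next (L : seq A) : A := if pselect (forall p, p \in L -> I p) is left LI
  then projT1 (cid (step L LI)) else 0.
pose seqn := fix s n : seq A := if n is n'.+1 then rcons (s n') (next (s n')) else [::].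
have seqI n p : p \in seqn n -> I p.
  elim: n p => [//|n IH] p /=; rewrite mem_rcons inE => /orP[/eqP->|/IH//].
  by rewrite /next; case: pselect => // LI; case: (projT2 (cid (step _ LI))).
have nextP n : [/\ I (next (seqn n)), ~ ideal_span (seqn n) (next (seqn n)) &
    forall q, I q -> ~ ideal_span (seqn n) q -> ~ (mlead q < mlead (next (seqn n)))%O].
  rewrite /next; case: pselect => [LI|]; last by move=> /(_ (seqI n)).
  exact: projT2 (cid (step _ LI)).
have size_seqn n : size (seqn n) = n by elim: n => //= n IH; rewrite size_rcons IH.
have nth_seqn n i : (i < n)%N -> (seqn n)`_i = next (seqn i).
  elim: n => // n IH; rewrite ltnS /= nth_rcons size_seqn => le_in.
  case: ltnP => [/IH//|le_ni]; have -> : i = n by apply/eqP; rewrite eqn_leq le_in.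
  by rewrite eqxx.
have span0 n : ideal_span (seqn n) 0.
  by exists (fun=> 0); rewrite big1// => i _; rewrite mul0r.
have [i [j [ij le_ij]]] := dickson (fun n k => mlead (next (seqn n)) k).
have [Ij nj minj] := nextP j; have [Ii ni _] := nextP i.
have nz n : next (seqn n) != 0.
  by have [_ nn _] := nextP n; apply/eqP => n0; apply: nn; rewrite n0.
have [g gP] := lead_reduction (nz i) (nz j) le_ij.
have gspan h : ideal_span (seqn j) (h + g * next (seqn i)) <-> ideal_span (seqn j) h.
  have E c : \sum_(k < size (seqn j)) (c k + g *+ ((k : nat) == i)) * (seqn j)`_k =
      \sum_(k < size (seqn j)) c k * (seqn j)`_k + g * next (seqn i).
    under eq_bigr do rewrite mulrDl; rewrite big_split/=; congr (_ + _).
    have iP : (i < size (seqn j))%N by rewrite size_seqn.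
    rewrite (bigD1 (Ordinal iP))//= eqxx mulr1n nth_seqn// big1 ?addr0// => k ki.
    have /negPf -> : (k : nat) != i by apply: contra ki => /eqP kE; apply/eqP/val_inj.
    by rewrite mulr0n mul0r.
  split=> -[c cE].
    exists (fun k => c k - g *+ (k == i)); apply: (addIr (g * next (seqn i))).
    by rewrite cE -E; apply: eq_bigr => k _; rewrite subrK.
  by exists (fun k => c k + g *+ (k == i)); rewrite E cE.
case: gP => [jE|]; last first.
  apply: minj.
    have -> : next (seqn j) - g * next (seqn i) = (- g) * next (seqn i) + next (seqn j).
      by rewrite mulNr addrC.
    exact: IP.
  by move=> /gspan; rewrite subrK.
apply: nj; rewrite jE -[_ * _]add0r; exact/gspan.
Qed.

Lemma submodule_fg b (N : set 'rV[A]_b) : submodule N ->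
  exists s (G : 'M[A]_(s, b)), (forall i, N (row i G)) /\
    forall u, N u -> exists f, u = f *m G.
Proof.
elim: b N => [|b IH] N Nsub.
  by exists 0%N, 0; split=> [[]//|u _]; exists 0; apply/matrixP => ? [].
pose J : set A := [set p | exists2 u, N u & u 0 ord0 = p].
have [|f p q|L [LJ Lspan]] := @ideal_fg J.
- by exists 0; [exact: submod0 Nsub|rewrite mxE].
- move=> [u Nu <-] [v Nv <-]; exists (f *: u + v); last by rewrite !mxE.
  by case: Nsub => _; apply.
pose M : set 'rV[A]_b := [set v | N (row_mx (0 : 'rV[A]_1) v)].
have [|t [G' [NG' spanG']]] := IH M.
  split; first by rewrite /M /= row_mx0; exact: submod0 Nsub.
  move=> f u v Mu Mv; rewrite /M /= -[X in row_mx X _](addr0 (0 : 'rV[A]_1)) -[X in row_mx (X + _) _](scaler0 _ f).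
  by rewrite -add_row_mx -scale_row_mx; case: Nsub => _; apply.
have lift (i : 'I_(size L)) : exists u : 'rV[A]_b.+1, N u /\ u 0 ord0 = L`_i.
  by have [|u Nu uE] := LJ L`_i; [exact: mem_nth|exists u].
pose U : 'M[A]_(size L, b.+1) := \matrix_i projT1 (cid (lift i)).
have UP i : N (row i U) /\ (row i U) 0 ord0 = L`_i.
  by rewrite rowK; exact: projT2 (cid (lift i)).
exists (size L + t)%N, (col_mx U (row_mx (0 : 'M[A]_(t, 1)) G')); split.
  move=> i; rewrite -(splitK i); case: (fintype.split i) => k /=.
    by rewrite rowKu; case: (UP k).
  by rewrite rowKd -[row k _]/(row (m := t) (n := 1 + b) k (row_mx 0 G')) row_row_mx row0; exact: NG'.
move=> u Nu; have [c cE] : ideal_span L (u 0 ord0) by apply: Lspan; exists u.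
pose a : 'rV[A]_(size L) := \row_i c i.
pose v := u - a *m U.
have Nv : N v.
  apply: (submodB Nsub) => //; apply: (submod_mulmx Nsub) => i.
  by case: (UP i).
have v0 : v 0 ord0 = 0.
  rewrite /v !mxE cE; apply/eqP; rewrite subr_eq0; apply/eqP/eq_bigr => i _.
  by rewrite mxE; have [_] := UP i; rewrite mxE => ->.
have vE : v = row_mx (0 : 'rV[A]_1) (rsubmx (v : 'rV[A]_(1 + b))).
  rewrite -[LHS](@hsubmxK _ 1 1 b v).
  suff -> : lsubmx (v : 'rV[A]_(1 + b)) = 0 by [].
  by apply/rowP => i; rewrite mxE [RHS]mxE ord1 -[RHS]v0; congr (v _ _); apply: val_inj.
have [|f fE] := spanG' (rsubmx (v : 'rV[A]_(1 + b))); first by rewrite /M /= -vE.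
exists (row_mx a f); rewrite mul_row_col.
rewrite -[f *m _]/(mulmx (p := 1 + b) f (row_mx 0 G')) mul_mx_row mulmx0 -fE -vE.
by rewrite addrC subrK.
Qed.

End hilbert_basis.

(** * Graded submodules, regular sequences and minimal resolutions *)

Section graded.
Context {K : fieldType} {d : nat}.
Local Notation A := (mpoly d K).
Local Notation var i := (mpolyX K (mnm1 i)).

Definition mfilter (P : pred (multinom d)) (p : A) : A :=
  \sum_(m <- msupp p | P m) mcoeff m p *: mpolyX K m.

Lemma mcoeff_mfilter P p m :
  mcoeff m (mfilter P p) = if P m then mcoeff m p else 0.
Proof.
rewrite /mfilter (raddf_sum (mcoeff m))/=.
under eq_bigr do rewrite mcoeffZ mcoeffX.
have [mp|mNp] := boolP (m \in msupp p); last first.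
  rewrite (memN_msupp_eq0 mNp) if_same big_seq_cond big1// => k /andP[kp _].
  by case: eqVneq kp mNp => [->->//|]; rewrite mulr0.
rewrite big_mkcond (bigD1_seq m)//= ?msupp_uniq// eqxx mulr1 big1 ?addr0// => k.
by move=> /negPf ->; rewrite mulr0 if_same.
Qed.

Lemma mcoeffXM (i : 'I_d) (p : A) m :
  mcoeff m (var i * p) = if m i == 0%N then 0 else mcoeff (mnm_sub m (mnm1 i)) p.
Proof.
case: ifPn => mi; last first.
  have mE : mnm_add (mnm1 i) (mnm_sub m (mnm1 i)) = m.
    by rewrite addmC; apply: submK; rewrite lep1mP.
  by rewrite mulrC -{1}mE mcoeffMX.
apply: memN_msupp_eq0; rewrite mulrC (perm_mem (msuppMX _ _)).
apply/mapP => -[k _ mE]; move: mi; rewrite mE mnmDE mnm1E eqxx.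
by [].
Qed.

Definition homog_row b (w : 'I_b -> nat) k (u : 'rV[A]_b) :=
  forall j m, mcoeff m (u 0 j) != 0 -> (mdeg m + w j)%N = k.

Definition wpart b (w : 'I_b -> nat) k (u : 'rV[A]_b) : 'rV[A]_b :=
  \row_j mfilter (fun m => (mdeg m + w j)%N == k) (u 0 j).

Lemma mcoeff_wpart b (w : 'I_b -> nat) k u j m :
  mcoeff m (wpart w k u 0 j) =
  if (mdeg m + w j)%N == k then mcoeff m (u 0 j) else 0.
Proof. by rewrite mxE mcoeff_mfilter. Qed.

Lemma row_mpolyP b (u v : 'rV[A]_b) :
  (forall j m, mcoeff m (u 0 j) = mcoeff m (v 0 j)) -> u = v.
Proof. by move=> uv; apply/rowP => j; apply/mpolyP => m. Qed.

Lemma mcoeff_row_sum b I (r : seq I) (P : pred I) (F : I -> 'rV[A]_b) j m :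
  mcoeff m ((\sum_(i <- r | P i) F i) 0 j) = \sum_(i <- r | P i) mcoeff m (F i 0 j).
Proof. by rewrite summxE (raddf_sum (mcoeff m)). Qed.

Lemma wpart_sum b (w : 'I_b -> nat) k I (r : seq I) (P : pred I) (F : I -> 'rV[A]_b) :
  wpart w k (\sum_(i <- r | P i) F i) = \sum_(i <- r | P i) wpart w k (F i).
Proof.
apply: row_mpolyP => j m; rewrite mcoeff_wpart !mcoeff_row_sum.
under [RHS]eq_bigr do rewrite mcoeff_wpart.
by case: (_ == k) => //; rewrite big1.
Qed.

Lemma wpart_homog b (w : 'I_b -> nat) k u : homog_row w k (wpart w k u).
Proof.
by move=> j m; rewrite mcoeff_wpart; case: ifP => [/eqP//|_]; rewrite eqxx.
Qed.

Lemma homog_wpart b (w : 'I_b -> nat) k l u :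
  homog_row w k u -> wpart w l u = if l == k then u else 0.
Proof.
move=> uk; apply: row_mpolyP => j m; rewrite mcoeff_wpart.
have [/eqP|/uk ->] := boolP (mcoeff m (u 0 j) == 0); last first.
  by rewrite (eq_sym l); case: ifP => // _; rewrite mxE mcoeff0.
by move=> u0; rewrite u0 if_same; case: ifP => // _; rewrite mxE mcoeff0.
Qed.

Lemma homog_row_sum b (w : 'I_b -> nat) k I (r : seq I) (P : pred I) F :
  (forall i, P i -> homog_row w k (F i)) -> homog_row w k (\sum_(i <- r | P i) F i).
Proof.
move=> Fk; elim/big_ind : _ => //.
  by move=> j m; rewrite mxE mcoeff0 eqxx.
move=> u v uk vk j m; rewrite mxE mcoeffD => uv.
have [u0|/uk//] := eqVneq (mcoeff m (u 0 j)) 0; apply: vk.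
by move: uv; rewrite u0 add0r.
Qed.

Lemma homog_rowZ b (w : 'I_b -> nat) c k f u :
  (forall m, mcoeff m f != 0 -> mdeg m = c) -> homog_row w k u ->
  homog_row w (c + k) (f *: u).
Proof.
move=> fc uk j m; rewrite mxE -mcoeff_msupp => /msuppM_le/allpairsP[[m1 m2]/=].
rewrite !mcoeff_msupp => -[/fc <- /uk <- ->].
by rewrite mdegD addnA.
Qed.

Lemma wpart_partition b (w : 'I_b -> nat) u :
  exists B, u = \sum_(k < B) wpart w k u.
Proof.
pose B := (\sum_j (mmeasure (@mdeg d) (u ord0 j) + w j))%N; exists B.
apply: row_mpolyP => j m; rewrite mcoeff_row_sum.
under eq_bigr do rewrite mcoeff_wpart.
have [u0|/eqP u0] := eqVneq (mcoeff m (u 0 j)) 0.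
  by rewrite big1 ?u0// => k _; rewrite if_same.
have mB : (mdeg m + w j < B)%N.
  rewrite /B (bigD1 j)//=; apply: leq_trans (leq_addr _ _).
  by rewrite -addSn leq_add2r msize_mdeg_lt// mcoeff_msupp; exact/eqP.
rewrite (bigD1 (Ordinal mB))//= eqxx big1 ?addr0// => k kB.
by case: eqP => // kE; case/eqP: kB; apply: val_inj.
Qed.

Lemma wpart_mulmx b s (w : 'I_b -> nat) (w' : 'I_s -> nat) (G : 'M[A]_(s, b)) k f :
  (forall i, homog_row w (w' i) (row i G)) ->
  wpart w k (f *m G) = wpart w' k f *m G.
Proof.
move=> Gh; have [B fE] := wpart_partition w' f.
rewrite {1 2}fE mulmx_suml !wpart_sum mulmx_suml; apply: eq_bigr => l _.
rewrite (homog_wpart k (@wpart_homog _ w' l f)).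
rewrite (@homog_wpart _ w l); first by case: ifP => //; rewrite mul0mx.
rewrite mulmx_sum_row; apply: homog_row_sum => i _.
have [->|] := eqVneq (wpart w' l f 0 i) 0.
  by move=> j m; rewrite scale0r mxE mcoeff0 eqxx.
rewrite -msupp_eq0; case E : (msupp _) => [//|m0 ms] _.
have m0P : mcoeff m0 (wpart w' l f 0 i) != 0 by rewrite -mcoeff_msupp E mem_head.
rewrite -(wpart_homog m0P); apply: homog_rowZ => // m mP.
by apply/eqP; rewrite -(eqn_add2r (w' i)) (wpart_homog mP) (wpart_homog m0P).
Qed.

Definition graded b (w : 'I_b -> nat) (N : set 'rV[A]_b) :=
  forall k u, N u -> N (wpart w k u).

Lemma graded_ker b s (w : 'I_b -> nat) (w' : 'I_s -> nat) (G : 'M[A]_(s, b)) :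
  (forall i, homog_row w (w' i) (row i G)) ->
  graded w' [set f : 'rV[A]_s | f *m G = 0].
Proof.
move=> Gh k f /= fG; rewrite -(wpart_mulmx k f Gh) fG.
by apply: row_mpolyP => j m; rewrite mcoeff_wpart mxE mcoeff0 if_same.
Qed.

Lemma submodule_ker b s (G : 'M[A]_(s, b)) :
  submodule [set f : 'rV[A]_s | f *m G = 0].
Proof.
split=> [|f u v /= uG vG]; first exact: mul0mx.
by rewrite mulmxDl -scalemxAl uG vG scaler0 addr0.
Qed.

(** The submodule generated by the products with one of the first [j] variables. *)
Definition xspan b j (N : set 'rV[A]_b) : set 'rV[A]_b :=
  [set u | exists v : 'I_d -> 'rV[A]_b,
     (forall i, N (v i)) /\ u = \sum_(i < d | (i < j)%N) var i *: v i].

(** The first [k] variables form a regular sequence on [N]; the quotient by all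
    of them may vanish. *)
Definition xregular b k (N : set 'rV[A]_b) :=
  forall i : 'I_d, (i < k)%N -> forall u, N u ->
    xspan i N (var i *: u) -> xspan i N u.

Lemma xspan_submodule b j (N : set 'rV[A]_b) : submodule N -> submodule (xspan j N).
Proof.
move=> Nsub; split.
  exists (fun=> 0); split=> [_|]; first exact: submod0.
  by rewrite big1// => i _; rewrite scaler0.
move=> f u v [u' [Nu ->]] [v' [Nv ->]]; exists (fun i => f *: u' i + v' i).
split=> [i|]; first by case: Nsub => _; apply.
rewrite scaler_sumr -big_split/=; apply: eq_bigr => i _.
by rewrite scalerDr !scalerA mulrC.
Qed.

Lemma xspanS b j (N N' : set 'rV[A]_b) : N `<=` N' -> xspan j N `<=` xspan j N'.
Proof. by move=> NN' u [v [Nv ->]]; exists v; split=> // i; exact: NN'. Qed.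

Lemma xspan_recr b (j : 'I_d) (N : set 'rV[A]_b) u : submodule N ->
  xspan j.+1 N u <-> exists a v, [/\ xspan j N a, N v & u = a + var j *: v].
Proof.
move=> Nsub; split=> [[v [Nv ->]]|[_ [v [[v' [Nv' ->]] Nv ->]]]].
  exists (\sum_(i < d | (i < j)%N) var i *: v i), (v j).
  split=> //; first by exists v.
  rewrite (bigD1 j)//= addrC; congr (_ + _); apply: eq_bigl => i.
  by rewrite ltnS ltn_neqAle andbC.
exists (fun i => if i == j then v else v' i); split=> [i|]; first by case: ifP.
rewrite [RHS](bigD1 j)//= eqxx addrC; congr (_ + _); apply: eq_big => [i|i].
  by rewrite ltnS ltn_neqAle andbC.
by rewrite ltn_neqAle => /andP[/negPf ij _]; rewrite -val_eqE/= ij.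
Qed.

Lemma xspan0 b (N : set 'rV[A]_b) u : N 0 -> xspan 0 N u <-> u = 0.
Proof.
move=> N0; split=> [[v [_ ->]]|->]; first by rewrite big_pred0.
by exists (fun=> 0); split=> //; rewrite big_pred0.
Qed.

Lemma xspan_mulmx b s (G : 'M[A]_(s, b)) j u :
  xspan j [set u | exists f : 'rV[A]_s, u = f *m G] u <->
  exists2 a, xspan j setT a & u = a *m G.
Proof.
split=> [[v [vG ->]]|[_ [v [_ ->]] ->]].
  pose a i := projT1 (cid (vG i)).
  exists (\sum_(i < d | (i < j)%N) var i *: a i); first by exists a.
  rewrite mulmx_suml; apply: eq_bigr => i _; rewrite -scalemxAl.
  by congr (_ *: _); exact: projT2 (cid (vG i)).
exists (fun i => v i *m G); split=> [i|]; first by exists (v i).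
by rewrite mulmx_suml; apply: eq_bigr => i _; rewrite scalemxAl.
Qed.

Lemma submoduleT b : submodule [set: 'rV[A]_b]. Proof. by split. Qed.

Definition xfree j (m : multinom d) := [forall i : 'I_d, (i < j)%N ==> (m i == 0%N)].

Lemma xspanTP b j (u : 'rV[A]_b) :
  xspan j setT u <-> forall c m, mcoeff m (u 0 c) != 0 -> ~~ xfree j m.
Proof.
split=> [[v [_ ->]] c m|uj].
  rewrite mcoeff_row_sum => s0.
  apply/negP => /forallP mj; case/eqP: s0; rewrite big1// => i ij.
  by rewrite mxE mcoeffXM (implyP (mj i) ij).
have -> : u = \sum_c \sum_(m <- msupp (u 0 c))
    mpolyX K m *: ((mcoeff m (u 0 c))%:A *: delta_mx 0 c).
  rewrite [LHS]matrix_sum_delta big_ord1; apply: eq_bigr => c _.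
  rewrite {1}[u 0 c]mpolyE scaler_suml; apply: eq_bigr => m _.
  by rewrite scalerA; congr (_ *: _); rewrite mulrC -scalerAl mul1r.
have sub := xspan_submodule j (submoduleT b).
apply: (submod_sum sub) => c _; rewrite big_seq; apply: (submod_sum sub) => m.
rewrite mcoeff_msupp => /uj; rewrite /xfree negb_forall => /existsP [] i.
rewrite negb_imply => /andP[ij mi].
set e := _ *: delta_mx _ _.
exists (fun k => if k == i then mpolyX K (mnm_sub m (mnm1 i)) *: e else 0).
split=> //; rewrite (bigD1 i)//= [X in _ + X]big1 ?addr0.
  rewrite eqxx [RHS]scalerA -mpolyXD addmC submK//; rewrite lep1mP//.
by move=> k /andP[_ /negPf ->]; rewrite scaler0.
Qed.

(** The part of [u] free of the first [j] variables is divisible by the next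
    one when [u] is in the submodule that the first [j + 1] variables span; the
    quotient has a smaller degree. *)
Lemma xspan_divide b (j : 'I_d) (u : 'rV[A]_b) B :
  xspan j.+1 setT u -> (forall c m, mcoeff m (u 0 c) != 0 -> (mdeg m < B.+1)%N) ->
  exists a v, [/\ xspan j setT a, u = a + var j *: v &
    forall c m, mcoeff m (v 0 c) != 0 -> (mdeg m < B)%N].
Proof.
move=> /xspanTP uj uB.
have [r rE] : exists r : 'rV[A]_b, forall c m,
    mcoeff m (r 0 c) = if xfree j m then mcoeff m (u 0 c) else 0.
  exists (\row_c mfilter (xfree j) (u 0 c)) => c m.
  by rewrite mxE mcoeff_mfilter.
have rj c m : mcoeff m (r 0 c) != 0 -> m j != 0%N.
  rewrite rE; case: ifP => [mj|_]; last by rewrite eqxx.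
  move=> /uj; apply: contra => /eqP mj0.
  apply/forallP => i; apply/implyP; rewrite ltnS leq_eqVlt => /orP[/eqP ij|].
    by rewrite (val_inj ij) mj0.
  by move=> ij; exact: (implyP (forallP mj i)).
pose v : 'rV[A]_b := \row_c \sum_(m <- msupp (r 0 c))
  mcoeff m (r 0 c) *: mpolyX K (mnm_sub m (mnm1 j)).
have vE : r = var j *: v.
  apply/rowP => c; rewrite [LHS]mpolyE !mxE mulr_sumr big_seq [RHS]big_seq.
  apply: eq_bigr => m; rewrite mcoeff_msupp => /rj mj.
  by rewrite -scalerAr -mpolyXD addmC submK// lep1mP.
exists (u - r), v; split; last first.
- move=> c m vm.
  have : mcoeff (mnm_add (mnm1 j) m) (r 0 c) != 0.
    by rewrite vE mxE mulrC mcoeffMX.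
  rewrite rE; case: ifP => [_ /uB|_]; last by rewrite eqxx.
  by rewrite mdegD mdeg1 add1n ltnS.
- by rewrite -vE subrK.
apply/xspanTP => c m; rewrite mxE [X in _ + X]mxE mcoeffD mcoeffN rE.
by case: xfree; rewrite ?subrr ?eqxx.
Qed.

Lemma row_bounded b (u : 'rV[A]_b) :
  exists B, forall c m, mcoeff m (u 0 c) != 0 -> (mdeg m < B)%N.
Proof.
exists (\sum_c mmeasure (@mdeg d) (u ord0 c))%N => c m; rewrite -mcoeff_msupp.
by move=> /msize_mdeg_lt /leq_trans; apply; rewrite (bigD1 c)//= leq_addr.
Qed.

Lemma xregular_free b : xregular d [set: 'rV[A]_b].
Proof.
move=> j _ u _ /xspanTP uj; apply/xspanTP => c m um.
have : mcoeff (mnm_add (mnm1 j) m) ((var j *: u) 0 c) != 0.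
  by rewrite mxE mulrC mcoeffMX.
move=> /uj; apply: contra => /forallP mj; apply/forallP => i; apply/implyP => ij.
by rewrite mnmDE (eqP (implyP (mj i) ij)) addn0 mnm1E eqb0 -val_eqE/= gtn_eqF.
Qed.

Lemma xregular1 b (N : set 'rV[A]_b) : N 0 -> xregular 1 N.
Proof.
move=> N0 j; rewrite ltnS leqn0 => /eqP j0 u Nu; rewrite j0 => /(xspan0 _ N0) Xu.
apply/(xspan0 _ N0); apply: row_mpolyP => c m.
have := congr1 (fun v : 'rV[A]_b => mcoeff (mnm_add (mnm1 j) m) (v 0 c)) Xu.
by rewrite /= !mxE mulrC mcoeffMX !mcoeff0.
Qed.

(** Depth increases along a resolution.  Elements of the kernel that the first
    variables span in the free module are spanned in the kernel, because a
    relation that the coefficients satisfy in the image is trivial there. *)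
Lemma xregular_ker s b (G : 'M[A]_(s, b)) k : (k < d)%N ->
  xregular k (mx_span G) -> xregular k.+1 [set f : 'rV[A]_s | f *m G = 0].
Proof.
move=> kd Greg; set N := [set _ | _].
have Nsub : submodule N := submodule_ker G.
have Tsub := submoduleT s.
have NI j : (j <= k)%N -> forall u, N u -> xspan j setT u -> xspan j N u.
  elim: j => [_ u _ /(xspan0 _ (submod0 Tsub)) ->|j IH jk u Nu].
    exact/(xspan0 _ (submod0 Nsub)).
  pose j' := Ordinal (ltn_trans jk kd).
  move=> /(@xspan_recr _ j' _ _ Tsub) [a [v [aj _ uE]]].
  have [c cj cE] : exists2 c, xspan j setT c & v *m G = c *m G.
    apply/xspan_mulmx; apply: (Greg j' jk); first by exists v.
    apply/xspan_mulmx; exists (- a).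
      exact: (submodN (xspan_submodule _ Tsub)).
    rewrite scalemxAl mulNmx; apply/eqP; rewrite -addr_eq0 addrC -mulmxDl.
    by rewrite -uE; apply/eqP.
  apply/(@xspan_recr _ j' _ _ Nsub).
  have vc : N (v - c) by rewrite /N /= mulmxBl cE subrr.
  exists (u - var j' *: (v - c)), (v - c); split=> //; last by rewrite subrK.
  apply: IH; first exact: ltnW.
    by apply: (submodB Nsub) => //; exact: (submodZ Nsub).
  have sub := xspan_submodule j Tsub.
  rewrite uE scalerBr opprB -addrA [_ *: v + _]addrC subrK.
  by apply: (submodD sub) => //; exact: (submodZ sub).
move=> j jk u Nu Xu; apply: NI => //.
apply: xregular_free => //; exact: xspanS Xu.
Qed.

(** [G] is a minimal system of generators when no relation between its rows has
    a unit coefficient, that is when the relations vanish modulo the variables. *)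
Definition minimal_generators s b (G : 'M[A]_(s, b)) :=
  forall f : 'rV[A]_s, xspan d (mx_span G) (f *m G) -> xspan d setT f.

(** Minimal generators of a module of full depth are a basis. *)
Lemma minimal_generators_free s b (G : 'M[A]_(s, b)) :
  minimal_generators G -> xregular d (mx_span G) ->
  forall f : 'rV[A]_s, f *m G = 0 -> f = 0.
Proof.
move=> Gmin Greg.
have Nsub := submodule_mx_span G; have Tsub := submoduleT s.
have down j : (j <= d)%N -> forall f, xspan j (mx_span G) (f *m G) -> xspan j setT f.
  move=> jd; rewrite -(subKn jd); move: (d - j)%N (leq_subr j d) => {jd}t.
  elim: t => [|t IH] td; first by rewrite subn0; exact: Gmin.
  have jE : (d - t = (d - t.+1).+1)%N by rewrite subnSK.
  have jd : (d - t.+1 < d)%N by rewrite -jE leq_subr.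
  pose j' := Ordinal jd.
  move=> f; have [B] := row_bounded f; elim: B f => [|B IHB] f fB fG.
    suff -> : f = 0 by exact: submod0 (xspan_submodule _ Tsub).
    apply: row_mpolyP => c m; rewrite mxE mcoeff0; apply/eqP/negP => /negP.
    by move=> /fB.
  have Xf : xspan j'.+1 setT f.
    have : xspan j'.+1 (mx_span G) (f *m G).
      apply/(@xspan_recr _ j' _ _ Nsub); exists (f *m G), 0; split=> //.
        exact: submod0 Nsub.
      by rewrite scaler0 addr0.
    by rewrite /= -jE; apply: IH; exact: ltnW.
  have [a [v [aj fE vB]]] := xspan_divide Xf fB.
  have sub := xspan_submodule j' Tsub.
  rewrite fE; apply: (submodD sub) => //; apply: (submodZ sub).
  apply: (IHB v vB); apply: (Greg j' jd); first by exists v.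
  have -> : var j' *: (v *m G) = f *m G - a *m G.
    by rewrite fE mulmxDl addrC addKr scalemxAl.
  apply: (submodB (xspan_submodule _ Nsub)) => //.
  by apply/xspan_mulmx; exists a.
move=> f fG; apply/(xspan0 _ (submod0 Tsub)); apply: down => //.
by rewrite fG; exact: submod0 (xspan_submodule _ Nsub).
Qed.

(** A homogeneous generating system with the least number of elements is
    minimal: a relation with a unit coefficient has a homogeneous component
    that expresses one of the generators through the others. *)
Lemma graded_minimal_generators b (w : 'I_b -> nat) (N : set 'rV[A]_b) :
  submodule N -> graded w N ->
  exists s (w' : 'I_s -> nat) (G : 'M[A]_(s, b)),
    [/\ forall i, homog_row w (w' i) (row i G), mx_span G = N & minimal_generators G].
Proof.
move=> Nsub Ngr.
pose gen s := exists (w' : 'I_s -> nat) (G : 'M[A]_(s, b)),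
  (forall i, homog_row w (w' i) (row i G)) /\ mx_span G = N.
have exgen : exists s, `[< gen s >].
  have [s [G [NG spanG]]] := submodule_fg Nsub.
  pose B i := projT1 (cid (wpart_partition w (row i G))).
  have BP i : row i G = \sum_(k < B i) wpart w k (row i G).
    exact: projT2 (cid (wpart_partition w (row i G))).
  pose I := {i : 'I_s & 'I_(B i)}.
  exists #|{: I}|; apply/asboolP.
  pose r (x : I) := wpart w (tagged x) (row (tag x) G).
  pose G1 : 'M[A]_(#|{: I}|, b) := \matrix_l r (enum_val l).
  exists (fun l => tagged (enum_val l : I) : nat), G1; split.
    by move=> l; rewrite rowK; exact: wpart_homog.
  apply/seteqP; split=> [u [f ->]|u /spanG [f ->]].
    by apply: (submod_mulmx Nsub) => l; rewrite rowK; exact: Ngr.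
  have sub := submodule_mx_span G1.
  apply: (submod_mulmx sub) => i; rewrite BP; apply: (submod_sum sub) => k _.
  exists (delta_mx 0 (enum_rank (Tagged (fun i => 'I_(B i)) k : I))).
  by rewrite -rowE rowK enum_rankK.
have [s /asboolP[w' [G [Gh GN]]] smin] := ex_minnP exgen.
exists s, w', G; split=> // f fG; apply/xspanTP => c m fm.
have [m0|] := eqVneq m (@mnm0 d); last first.
  move=> m0; apply/negP => /forallP mf; case/eqP: m0.
  by apply/mnmP => i; rewrite mnm0E; apply/eqP/(implyP (mf i)).
exfalso; rewrite {}m0 in fm.
have [a [_ aE]] : exists a, (forall i, setT (a i)) /\
    f *m G = (\sum_(i < d | (i < d)%N) var i *: a i) *m G.
  by have [_ [a [aT ->]] ->] := (xspan_mulmx _ _ _).1 fG; exists a.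
set q := \sum_(i < d | _) _ in aE.
have q0 : mcoeff (@mnm0 d) (q 0 c) = 0.
  rewrite mcoeff_row_sum big1// => i _.
  by rewrite mxE mcoeffXM mnm0E eqxx.
pose h := wpart w' (w' c) (f - q).
have hG : h *m G = 0.
  rewrite -(wpart_mulmx _ _ Gh) mulmxBl aE subrr; apply: row_mpolyP => j m'.
  by rewrite mcoeff_wpart mxE mcoeff0 if_same.
set e := mcoeff (@mnm0 d) (f 0 c) in fm.
have hc : h 0 c = mpolyC d e.
  apply/mpolyP => m'; rewrite mcoeff_wpart mcoeffC -{2}[w' c]add0n eqn_add2r mdeg_eq0.
  case: eqVneq => [->|_]; rewrite ?mulr1 ?mulr0//.
  by rewrite mxE mcoeffD [X in _ + mcoeff _ X]mxE mcoeffN q0 subr0.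
clearbody e h; move=> {aE q0 q a fG}.
case: s w' G Gh GN smin f c h hG hc => [|s] w' G Gh GN smin f c.
  by case: c.
move=> h hG hc.
have row_lift i : row i (row' c G) = row (lift c i) G by apply/rowP => j; rewrite !mxE.
suff : (s < s)%N by rewrite ltnn.
apply: smin; apply/asboolP; exists (w' \o lift c), (row' c G); split.
  by move=> i; rewrite row_lift /=; exact: Gh.
rewrite -GN; apply/seteqP; split=> u [f' ->].
  apply: (submod_mulmx (submodule_mx_span G)) => i; rewrite row_lift.
  by exists (delta_mx 0 (lift c i)); rewrite -rowE.
have sub := submodule_mx_span (row' c G).
have rowG' i : i != c -> mx_span (row' c G) (row i G).
  rewrite eq_sym => /unlift_some[k -> _].
  by rewrite -row_lift; exists (delta_mx 0 k); rewrite -rowE.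
apply: (submod_mulmx sub) => i; have [->|/rowG'//] := eqVneq i c.
move: hG; rewrite mulmx_sum_row (bigD1 c)//= hc => /eqP.
rewrite addr_eq0 => /eqP /(congr1 (fun v => mpolyC d e^-1 *: v)).
rewrite scalerA -mpolyCM mulVf// mpolyC1 scale1r => ->.
apply: (submodZ sub); apply: (submodN sub); apply: (submod_sum sub) => k kc.
by apply: (submodZ sub); exact: rowG'.
Qed.

End graded.

Section resolution.
Context {K : fieldType} {d : nat}.
Local Notation A := (mpoly d K).

Lemma minimal_generators0 s b (G : 'M[A]_(s, b)) :
  minimal_generators G -> mx_span G `<=` [set 0] -> s = 0%N.
Proof.
case: s G => // s G Gmin G0; exfalso.
pose e := delta_mx 0 ord0 : 'rV[A]_s.+1.
have : xspan d setT e.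
  apply: Gmin; rewrite (G0 (e *m G)); last by exists e.
  exact: submod0 (xspan_submodule _ (submodule_mx_span G)).
move=> /xspanTP /(_ ord0 (@mnm0 d)); rewrite mxE !eqxx mcoeff1 eqxx oner_neq0.
by move=> /(_ isT) /negP; apply; apply/forallP => i; rewrite mnm0E implybT.
Qed.

Record stage := Stage {
  stage_dim : nat;
  stage_weight : 'I_stage_dim -> nat;
  stage_rel : set 'rV[A]_stage_dim;
  stage_submodule : submodule stage_rel;
  stage_graded : graded stage_weight stage_rel }.
Arguments stage_weight : clear implicits.
Arguments stage_rel : clear implicits.
Arguments stage_graded : clear implicits.

Lemma next_stage (s : stage) : exists (s' : stage) (G : 'M[A]_(stage_dim s', stage_dim s)),
  [/\ mx_span G = stage_rel s, stage_rel s' = [set f : 'rV[A]_(stage_dim _) | f *m G = 0] &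
      minimal_generators G].
Proof.
have [n [w [G [Gh Gspan Gmin]]]] :=
  graded_minimal_generators (stage_submodule s) (stage_graded s).
by exists (Stage (submodule_ker G) (graded_ker Gh)), G.
Qed.

(** Hilbert's syzygy theorem for graded relations, with the minimal resolution:
    the [k]-th syzygies have depth greater than [k], so the process stops after
    as many steps as there are variables. *)
Lemma graded_syzygies (s0 : stage) : (0 < d)%N ->
  exists (s : nat -> stage)
         (G : forall k, 'M[A]_(stage_dim (s k.+1), stage_dim (s k))),
    [/\ s 0%N = s0,
        forall k, mx_span (G k) = stage_rel (s k),
        forall k, stage_rel (s k.+1) = [set f : 'rV[A]_(stage_dim _) | f *m G k = 0] &
        forall k, (d < k)%N -> stage_dim (s k) = 0%N].
Proof.
move=> d0.
pose nxt s := projT1 (cid (next_stage s)).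
have nxtP s := projT2 (cid (next_stage s)).
pose s k := iter k nxt s0.
pose G k : 'M[A]_(stage_dim (s k.+1), stage_dim (s k)) := projT1 (cid (nxtP (s k))).
have GP k : [/\ mx_span (G k) = stage_rel (s k),
    stage_rel (s k.+1) = [set f : 'rV[A]_(stage_dim _) | f *m G k = 0] & minimal_generators (G k)].
  exact: projT2 (cid (nxtP (s k))).
have Gspan k : mx_span (G k) = stage_rel (s k) by case: (GP k).
have Gker k : stage_rel (s k.+1) = [set f : 'rV[A]_(stage_dim _) | f *m G k = 0] by case: (GP k).
have Gmin k : minimal_generators (G k) by case: (GP k).
exists s, G; split => //.
have reg k : (k < d)%N -> xregular k.+1 (stage_rel (s k)).
  elim: k => [_|k IH kd]; first exact/xregular1/submod0/stage_submodule.
  by rewrite Gker; apply: xregular_ker => //; rewrite Gspan; apply/IH/ltnW.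
have dim0 k : stage_rel (s k) `<=` [set 0] -> stage_dim (s k.+1) = 0%N.
  by rewrite -Gspan => /(minimal_generators0 (Gmin k)).
elim=> // k IH; rewrite ltnS => dk; apply: dim0.
move: dk; rewrite leq_eqVlt => /orP[/eqP dk|/IH k0].
  case: k dk {IH} => [d1|k dk]; first by exfalso; have := d0; rewrite d1.
  rewrite Gker => f; apply: minimal_generators_free => //.
  by rewrite Gspan; have := reg k; rewrite -dk leqnn; apply.
by move=> f _; apply/rowP => i; case: (cast_ord k0 i).
Qed.

End resolution.
Arguments stage_rel {K d} s _.

(** * The alternating sum of a resolution is the generic rank *)

Section generic_rank.
Context {A : idomainType}.
Local Notation F := {fraction A}.
Local Notation tof := (@FracField.tofrac A).
Local Notation toF := (map_mx tof).

Lemma tofrac_inj : injective tof.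
Proof. by move=> p q pq; apply/eqP; rewrite -tofrac_eq pq. Qed.

Lemma map_tofrac_inj m n : injective (toF : 'M[A]_(m, n) -> 'M[F]_(m, n)).
Proof.
move=> M N MN; apply/matrixP => i j; apply: tofrac_inj.
by move/matrixP: MN => /(_ i j); rewrite !mxE.
Qed.

Lemma clear_denominators m n (M : 'M[F]_(m, n)) :
  exists c (N : 'M[A]_(m, n)), c != 0 /\ toF N = tof c *: M.
Proof.
have den x : exists c : A, c != 0 /\ exists a, tof a = tof c * x.
  elim/quotW: x => x; exists x.2; split; first exact: denom_ratioP.
  exists x.1; unlock FracField.tofrac; rewrite -[RHS]FracField.pi_mul.
  apply/eqmodP; rewrite /= FracField.equivfE /FracField.mulf.
  rewrite !numden_Ratio ?mul1r ?oner_neq0 ?denom_ratioP//.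
  by rewrite mulrC.
pose c i j := projT1 (cid (den (M i j))).
have cP i j : c i j != 0 /\ exists a, tof a = tof (c i j) * M i j.
  exact: projT2 (cid (den (M i j))).
pose e := \prod_(x : 'I_m * 'I_n) c x.1 x.2.
have ex i j : exists a, tof a = tof e * M i j.
  have [_ [a aE]] := cP i j.
  exists ((\prod_(x : 'I_m * 'I_n | x != (i, j)) c x.1 x.2) * a).
  by rewrite tofracM aE /e [in RHS](bigD1 (i, j))//= tofracM mulrCA mulrA.
exists e, (\matrix_(i, j) projT1 (cid (ex i j))); split.
  by apply/prodf_neq0 => -[i j] _ /=; case: (cP i j).
by apply/matrixP => i j; rewrite !mxE; exact: projT2 (cid (ex i j)).
Qed.

Lemma sub_span_tofrac p q (P : 'M[A]_(p, q)) (u : 'rV[A]_q) :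
  mx_span P u -> (toF u <= toF P)%MS.
Proof. by move=> [f ->]; rewrite map_mxM submxMl. Qed.

(** Exactness survives localization: a relation between fractions becomes one
    between elements of the ring once denominators are cleared. *)
Lemma rank_exact p q r (P : 'M[A]_(p, q)) (Q : 'M[A]_(q, r)) :
  mx_span P = [set u : 'rV[A]_q | u *m Q = 0] ->
  (\rank (toF P) + \rank (toF Q) = q)%N.
Proof.
move=> PQ; rewrite -[RHS](subnK (rank_leq_row (toF Q))) -mxrank_ker.
congr (_ + _)%N; apply/eqP; rewrite eqn_leq; apply/andP; split; apply: mxrankS.
  rewrite sub_kermx -map_mxM; suff -> : P *m Q = 0 by rewrite map_mx0.
  apply/row_matrixP => i; rewrite row_mul row0.
  have : mx_span P (row i P) by exists (delta_mx 0 i); rewrite -rowE.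
  by rewrite PQ.
apply/row_subP => i; set u := row i _.
have uQ : u *m toF Q = 0.
  by apply/sub_kermxP; rewrite /u row_sub.
have [c [v [c0 vE]]] := clear_denominators u.
have vQ : v *m Q = 0.
  apply: map_tofrac_inj; rewrite map_mxM vE -scalemxAl uQ scaler0.
  by rewrite map_mx0.
have : mx_span P v by rewrite PQ.
move=> /sub_span_tofrac; rewrite vE.
by rewrite eqmx_scale// tofrac_eq0.
Qed.

(** Rows that complete the span of [P] to a space of full rank. *)
Lemma independent_mod_span p q (P : 'M[A]_(p, q)) :
  exists E : 'M[A]_(q - \rank (toF P), q),
    forall f : 'rV[A]_(q - \rank (toF P)), mx_span P (f *m E) -> f = 0.
Proof.
rewrite -mxrank_compl; set C := ((toF P)^C)%MS.
have [c [E [c0 EE]]] := clear_denominators (row_base C).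
exists E => f /sub_span_tofrac fP; apply: map_tofrac_inj; rewrite map_mx0.
have Efree : row_free (toF E).
  by rewrite /row_free EE eqmx_scale ?tofrac_eq0// eq_row_base.
apply/eqP; rewrite -(mulmx_free_eq0 _ Efree) -submx0.
rewrite -(capmx_compl (toF P)) sub_capmx -map_mxM fP map_mxM.
by rewrite (submx_trans (submxMl _ _))// EE eqmx_scale ?tofrac_eq0// eq_row_base.
Qed.

Lemma independent_in_span p q (P : 'M[A]_(p, q)) :
  exists E : 'M[A]_(\rank (toF P), q), (forall i, mx_span P (row i E)) /\
    forall f : 'rV[A]_(\rank (toF P)), f *m E = 0 -> f = 0.
Proof.
exists (rowsub (maxrankfun (toF P)) P); split=> [i|f fE].
  by exists (delta_mx 0 (maxrankfun (toF P) i)); rewrite row_rowsub -rowE.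
apply: map_tofrac_inj; rewrite map_mx0; apply/eqP.
rewrite -(mulmx_free_eq0 _ (maxrowsub_free (toF P))).
by rewrite -map_mxsub -map_mxM fE map_mx0.
Qed.

(** Consecutive ranks telescope. *)
Lemma alternating_sum_rank (b : nat -> nat) (P : forall k, 'M[A]_(b k.+1, b k)) n :
  (forall k, mx_span (P k.+1) = [set u : 'rV[A]_(b k.+1) | u *m P k = 0]) ->
  (forall k, (n <= k)%N -> b k = 0%N) ->
  \sum_(k < n) (-1) ^+ k * (b k)%:Z = (b 0 - \rank (toF (P 0)))%N%:Z.
Proof.
move=> Pex bn.
have rk k : (\rank (toF (P k.+1)) + \rank (toF (P k)) = b k.+1)%N.
  exact: rank_exact.
have part m : \sum_(k < m.+1) (-1) ^+ k * (b k)%:Z =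
    (b 0)%:Z - (\rank (toF (P 0)))%:Z + (-1) ^+ m * (\rank (toF (P m)))%:Z.
  elim: m => [|m IH]; first by rewrite big_ord1 !mul1r subrK.
  have bE : (b m.+1)%:Z = (\rank (toF (P m.+1)))%:Z + (\rank (toF (P m)))%:Z.
    by rewrite -PoszD rk.
  by rewrite big_ord_recr/= IH bE exprS; ring.
have bn0 : (b n)%:Z = 0 by rewrite bn.
have := part n; rewrite big_ord_recr/= [in LHS]bn0 mulr0 addr0 => ->.
have -> : \rank (toF (P n)) = 0%N.
  by apply/eqP; rewrite -leqn0 (leq_trans (rank_leq_col _))// bn.
by rewrite mulr0 addr0 subzn// rank_leq_col.
Qed.

End generic_rank.

(** * Bounded operators and finite dimensional subspaces of a Hilbert space *)


Section real_norm.
Context {R : realType} {H : completeNormedModType R[i]}.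
Implicit Types (x y : H) (u : nat -> H).

(** The norm of [H] has complex values. *)
Definition rnorm x : R := complex.Re `|x|.

Lemma rnormE x : (rnorm x)%:C = `|x|.
Proof. by rewrite RRe_real// normr_real. Qed.

Lemma rnorm_ge0 x : 0 <= rnorm x.
Proof. by rewrite -(lecR 0) rnormE normr_ge0. Qed.

Lemma rnorm0 : rnorm 0 = 0.
Proof. by apply: complexI; rewrite rnormE normr0. Qed.

Lemma rnorm0_eq0 x : rnorm x = 0 -> x = 0.
Proof. by move=> x0; apply/eqP; rewrite -normr_eq0 -rnormE x0. Qed.

Lemma rnormN x : rnorm (- x) = rnorm x.
Proof. by rewrite /rnorm normrN. Qed.

Lemma rnormD x y : rnorm (x + y) <= rnorm x + rnorm y.
Proof. by rewrite -lecR rmorphD/= !rnormE ler_normD. Qed.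

Lemma rnormB x y : rnorm (x - y) = rnorm (y - x).
Proof. by rewrite -rnormN opprB. Qed.

Definition tends u x := forall e : R, 0 < e ->
  exists N, forall n, (N <= n)%N -> rnorm (u n - x) < e.

Lemma rnorm_complete u :
  (forall e : R, 0 < e -> exists N, forall m n, (N <= m)%N -> (N <= n)%N ->
     rnorm (u m - u n) < e) -> exists x, tends u x.
Proof.
move=> u_cauchy.
have posC (e : R[i]) : 0 < e -> exists2 r : R, 0 < r & e = r%:C.
  move=> e0; have eR : e \is Num.real by rewrite realE ltW.
  exists (complex.Re e); last by rewrite RRe_real.
  by rewrite -(ltcR 0) RRe_real.
have /cauchy_cvgP cu : cauchy (u @ \oo).
  apply: cauchy_exP => _ /posC[e e0 ->]; have [N uN] := u_cauchy e e0.
  exists (u N); exists N => // n /= Nn; rewrite -ball_normE /ball_/=.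
  by rewrite -rnormE ltcR uN.
exists (lim (u @ \oo)) => e e0.
have /cvgrPdist_lt /(_ e%:C) := cu.
rewrite ltcR => /(_ e0) [N _ uN]; exists N => n Nn.
by rewrite rnormB -ltcR rnormE; exact: uN.
Qed.

End real_norm.

Section conjugation.
Context {R : realType}.
Implicit Types a b : R[i].

Lemma cjD a b : Num.conj (a + b) = Num.conj a + Num.conj b.
Proof. exact: rmorphD. Qed.
Lemma cjN a : Num.conj (- a) = - Num.conj a.
Proof. exact: rmorphN. Qed.
Lemma cjM a b : Num.conj (a * b) = Num.conj a * Num.conj b.
Proof. exact: rmorphM. Qed.
Lemma cjV a : Num.conj a^-1 = (Num.conj a)^-1.
Proof. exact: fmorphV. Qed.
Lemma cjX a n : Num.conj (a ^+ n) = Num.conj a ^+ n.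
Proof. exact: rmorphXn. Qed.
Lemma cjK a : Num.conj (Num.conj a) = a.
Proof. exact: conjCK. Qed.
Lemma cj_real (r : R) : Num.conj (r%:C) = r%:C.
Proof. exact: conjc_real. Qed.
Lemma cjexpz a (n : int) : Num.conj (a ^ n) = Num.conj a ^ n.
Proof. by case: n => n; [exact: rmorphXn|rewrite NegzE -!exprnN cjV cjX]. Qed.
Lemma cj_norm a : `|Num.conj a| = `|a|.
Proof. exact: norm_conjC. Qed.

End conjugation.

Section inner_product.
Context {R : realType} {H : completeNormedModType R[i]}.
Variable dot : {dot H for @Num.conj R[i]}.
Implicit Types (x y z : H) (c : R[i]).

Lemma dotDl x y z : dot (x + y) z = dot x z + dot y z.
Proof. exact: linearDl. Qed.
Lemma dotDr x y z : dot z (x + y) = dot z x + dot z y.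
Proof. exact: linearDr. Qed.
Lemma dotZl c x y : dot (c *: x) y = c * dot x y.
Proof. exact: linearZl_LR. Qed.
Lemma dotZr c x y : dot x (c *: y) = Num.conj c * dot x y.
Proof. exact: linearZr_LR. Qed.
Lemma dot0l x : dot 0 x = 0.
Proof. exact: linear0l. Qed.
Lemma dot0r x : dot x 0 = 0.
Proof. exact: linear0r. Qed.
Lemma dotNl x y : dot (- x) y = - dot x y.
Proof. exact: linearNl. Qed.
Lemma dotNr x y : dot x (- y) = - dot x y.
Proof. exact: linearNr. Qed.
Lemma dotBl x y z : dot (x - y) z = dot x z - dot y z.
Proof. by rewrite dotDl dotNl. Qed.
Lemma dotBr x y z : dot z (x - y) = dot z x - dot z y.
Proof. by rewrite dotDr dotNr. Qed.
Lemma dotC x y : dot x y = Num.conj (dot y x).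
Proof. by rewrite hermC mul1r. Qed.
Lemma dot_suml I (r : seq I) (P : pred I) (F : I -> H) z :
  dot (\sum_(i <- r | P i) F i) z = \sum_(i <- r | P i) dot (F i) z.
Proof. exact: (big_morph (dot ^~ z) (fun x y => dotDl x y z) (dot0l z)). Qed.
Lemma dot_sumr I (r : seq I) (P : pred I) (F : I -> H) z :
  dot z (\sum_(i <- r | P i) F i) = \sum_(i <- r | P i) dot z (F i).
Proof. exact: (big_morph (dot z) (fun x y => dotDr x y z) (dot0r z)). Qed.

Lemma dot_inj x y : (forall z, dot x z = dot y z) -> x = y.
Proof.
move=> xy; apply/subr0_eq/eqP; rewrite -(dnorm_eq0 dot) dotBl xy subrr.
by [].
Qed.

Hypothesis Hn : inner_product_norm dot.

Lemma dot_rnorm x : dot x x = ((rnorm x) ^+ 2)%:C.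
Proof. by rewrite rmorphXn/= rnormE Hn. Qed.

Lemma rnormZ c x : rnorm (c *: x) = complex.Re `|c| * rnorm x.
Proof.
apply: complexI; rewrite rnormE normrZ rmorphM/= rnormE.
by congr (_ * _); rewrite RRe_real// normr_real.
Qed.

(** The minimum over the line through [x] with direction [y]. *)
Lemma dot_project x y (t := - (dot x y / dot y y)) :
  dot (x + t *: y) (x + t *: y) * dot y y = dot x x * dot y y - `|dot x y| ^+ 2.
Proof.
have [->|y0] := eqVneq y 0; first by rewrite !dot0r !mulr0 normr0 expr0n subrr.
have yy0 : dot y y != 0 by rewrite dnorm_eq0.
rewrite !dotDl !dotDr !dotZl !dotZr (dotC y x) normCK.
have -> : Num.conj t = - (Num.conj (dot x y) / dot y y).
  by rewrite cjN cjM cjV -(dotC y y).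
by rewrite /t; field.
Qed.

Lemma dot_min x y (e : R) :
  (forall c, (rnorm x) ^+ 2 <= (rnorm (x + c *: y)) ^+ 2 + e) ->
  `|dot x y| ^+ 2 <= (e * (rnorm y) ^+ 2)%:C.
Proof.
move=> /(_ (- (dot x y / dot y y))); rewrite -lecR rmorphD/= -!dot_rnorm => xe.
have : dot x x * dot y y <=
    (dot (x + - (dot x y / dot y y) *: y) (x + - (dot x y / dot y y) *: y) + e%:C) * dot y y.
  by rewrite ler_wpM2r// dnorm_ge0.
by rewrite mulrDl dot_project -addrA lerDl addrC subr_ge0 [dot y y]dot_rnorm -rmorphM.
Qed.

Lemma cauchy_schwarz x y : `|dot x y| <= (rnorm x * rnorm y)%:C.
Proof.
rewrite -(@ler_pXn2r _ 2)// ?nnegrE ?normr_ge0 ?ler0c ?mulr_ge0 ?rnorm_ge0//.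
have -> : ((rnorm x * rnorm y)%:C) ^+ 2 = (rnorm x ^+ 2 * rnorm y ^+ 2)%:C.
  by rewrite -exprMn rmorphXn.
apply: dot_min => c.
by rewrite lerDr sqr_ge0.
Qed.

Lemma rnorm_sqrB x y :
  rnorm (x - y) ^+ 2 + rnorm (x + y) ^+ 2 = 2 * rnorm x ^+ 2 + 2 * rnorm y ^+ 2.
Proof.
have : dot (x - y) (x - y) + dot (x + y) (x + y) = 2 * dot x x + 2 * dot y y.
  by rewrite dnormB dnormD; ring.
by rewrite !dot_rnorm => /(congr1 (@complex.Re R))/= ->; ring.
Qed.

(** The Riesz representation theorem.  Nearly shortest vectors [u n] in the affine
    hyperplane where [f] is 1 form a Cauchy sequence by the parallelogram law,
    and they are nearly orthogonal to the kernel of [f]. *)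
Lemma riesz (f : H -> R[i]) (M : R) :
  (forall c x y, f (c *: x + y) = c * f x + f y) ->
  (forall x, `|f x| <= (M * rnorm x)%:C) ->
  exists y, forall x, f x = dot x y.
Proof.
move=> flin fM.
have f0 : f 0 = 0.
  by apply/eqP; rewrite -normr_le0; apply: (le_trans (fM 0)); rewrite rnorm0 mulr0 lexx.
have fD x y : f (x + y) = f x + f y by have := flin 1 x y; rewrite scale1r mul1r.
have fZ c x : f (c *: x) = c * f x by have := flin c x 0; rewrite !addr0 f0 addr0.
have fB x y : f (x - y) = f x - f y by rewrite fD -scaleN1r fZ mulN1r.
have [allf0|/existsNP[x0 /eqP fx0]] := pselect (forall x, f x = 0).
  by exists 0 => x; rewrite dot0r allf0.
pose S := [set x | f x = 1].
have S1 : S ((f x0)^-1 *: x0) by rewrite /S/= fZ mulVf.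
pose D := inf [set rnorm x ^+ 2 | x in S].
have Dle x : S x -> D <= rnorm x ^+ 2.
  by move=> Sx; apply: ge_inf; [exists 0 => _ [y _ <-]; rewrite sqr_ge0|exists x].
have near n : exists x, S x /\ rnorm x ^+ 2 <= D + n.+1%:R^-1.
  have [||_ [x Sx <-] xD] := @inf_adherent _ [set rnorm x ^+ 2 | x in S] n.+1%:R^-1.
  - by rewrite invr_gt0.
  - split; first by exists (rnorm ((f x0)^-1 *: x0) ^+ 2), ((f x0)^-1 *: x0).
    by exists 0 => _ [y _ <-]; rewrite sqr_ge0.
  by exists x; split=> //; exact: ltW.
pose u n := projT1 (cid (near n)).
have uP n : S (u n) /\ rnorm (u n) ^+ 2 <= D + n.+1%:R^-1 by exact: projT2 (cid (near n)).
have small (e : R) : 0 < e -> exists N, forall n, (N <= n)%N -> n.+1%:R^-1 < e.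
  move=> e0; exists (Num.trunc e^-1) => n Nn.
  have : e^-1 < n.+1%:R.
    by rewrite (lt_le_trans (truncnS_gt _))// ler_nat ltnS.
  by rewrite invf_plt ?posrE// ?invr_gt0 ?ltr0n.
have [|x ux] := @rnorm_complete _ _ u.
  move=> e e0; have [|N NP] := small (e ^+ 2 / 4); first by rewrite divr_gt0 ?exprn_gt0.
  exists N => m n /NP mP /NP nP.
  rewrite -(@ltr_pXn2r _ 2)// ?nnegrE ?rnorm_ge0 ?ltW//.
  have mid : D <= rnorm (2^-1 *: (u m + u n)) ^+ 2.
    apply: Dle; rewrite /S/= fZ fD; have [-> _] := uP m; have [-> _] := uP n.
    by rewrite mulVf// (_ : 1 + 1 = 2%:R)// pnatr_eq0.
  have nE : rnorm (2^-1 *: (u m + u n)) = 2^-1 * rnorm (u m + u n).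
    rewrite rnormZ normfV; congr (_ * _); apply: complexI.
    by rewrite RRe_real ?realV ?normr_real// normr_nat fmorphV rmorph_nat.
  have q : (2^-1 : R) ^+ 2 = 4^-1 by field.
  rewrite nE exprMn q in mid.
  have := rnorm_sqrB (u m) (u n); have [_ +] := uP m; have [_ +] := uP n.
  move: mid mP nP; set a := rnorm (u m) ^+ 2; set b := rnorm (u n) ^+ 2.
  set c := rnorm (_ - _) ^+ 2; set c' := rnorm (_ + _) ^+ 2.
  move: (m.+1%:R^-1) (n.+1%:R^-1) (e ^+ 2) => i j e2; clearbody a b c c' D.
  lra.
have fx1 : f x = 1.
  have M1 : 0 < `|M| + 1 by rewrite ltr_wpDl.
  apply/subr0_eq/eqP; rewrite -normr_le0; apply/ler_addgt0Pr => e e0.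
  have e0R : 0 < complex.Re e by rewrite -(ltcR 0) RRe_real// realE ltW.
  have [|N /(_ N (leqnn N)) uN] := ux (complex.Re e / (`|M| + 1)).
    by rewrite divr_gt0.
  have -> : f x - 1 = f (x - u N) by rewrite fB; have [-> _] := uP N.
  rewrite add0r (le_trans (fM _))// -[e]RRe_real; last by rewrite realE ltW.
  rewrite lecR rnormB; move: uN; rewrite ltr_pdivlMr// => uN.
  apply: le_trans (ltW uN); rewrite mulrC ler_wpM2l ?rnorm_ge0//.
  by rewrite (le_trans (ler_norm _))// lerDl.
have orth y : f y = 0 -> dot y x = 0.
  move=> fy.
  have step n : `|dot (u n) y| ^+ 2 <= (n.+1%:R^-1 * rnorm y ^+ 2)%:C.
    apply: dot_min => c; have [Sn un] := uP n; apply: (le_trans un).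
    by rewrite lerD2r; apply: Dle; rewrite /S/= fD fZ fy mulr0 addr0.
  have {}step (e : R) : 0 < e -> exists N, forall n, (N <= n)%N ->
      (complex.Re `|dot (u n) y|) ^+ 2 <= e.
    move=> e0; have [|N NP] := small (e / (rnorm y ^+ 2 + 1)).
      by rewrite divr_gt0// ltr_wpDl ?sqr_ge0.
    exists N => n /NP; rewrite ltr_pdivlMr ?ltr_wpDl ?sqr_ge0// => ne.
    have := step n; rewrite -[`|dot (u n) y|]RRe_real ?normr_real//.
    rewrite -rmorphXn/= lecR => /le_trans; apply; apply: le_trans (ltW ne).
    by rewrite ler_wpM2l ?invr_ge0// lerDl.
  apply/eqP; rewrite dotC fmorph_eq0 -normr_le0; apply/ler_addgt0Pr => e e0.
  have e0R : 0 < complex.Re e by rewrite -(ltcR 0) RRe_real// realE ltW.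
  rewrite add0r -[e]RRe_real; last by rewrite realE ltW.
  have e2 : 0 < complex.Re e / 2 by rewrite divr_gt0.
  have [N1 uN1] := step _ (exprn_gt0 2 e2).
  have [|N2 uN2] := ux (complex.Re e / 2 / (rnorm y + 1)).
    by rewrite divr_gt0// ltr_wpDl ?rnorm_ge0.
  have := uN1 _ (leq_maxl N1 N2); have := uN2 _ (leq_maxr N1 N2).
  set n := maxn N1 N2; rewrite ltr_pdivlMr ?ltr_wpDl ?rnorm_ge0// => h2.
  rewrite ler_pXn2r// ?nnegrE ?(ltW e2)//; last by rewrite -ler0c RRe_real ?normr_real.
  rewrite -lecR RRe_real ?normr_real// => h1.
  have -> : dot x y = dot (u n) y - dot (u n - x) y by rewrite dotBl opprB addrC subrK.
  rewrite (le_trans (ler_normB _ _))// (splitr (complex.Re e)) rmorphD/= lerD//.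
  rewrite (le_trans (cauchy_schwarz _ _))// lecR; apply: le_trans (ltW h2).
  by rewrite ler_wpM2l ?rnorm_ge0// lerDl.
have xx0 : dot x x != 0.
  by rewrite dnorm_eq0; apply/eqP => xE; move: fx1; rewrite xE f0 => /eqP; rewrite eq_sym oner_eq0.
exists ((dot x x)^-1 *: x) => y.
have : dot (y - f y *: x) x = 0 by apply: orth; rewrite fB fZ fx1 mulr1 subrr.
move=> /eqP; rewrite dotBl subr_eq0 dotZl => /eqP E.
by rewrite dotZr cjV -dotC E mulrC mulfK.
Qed.

(** A contraction has an adjoint, which is a contraction. *)
Lemma adjointP (S : {linear H -> H}) : (forall x, rnorm (S x) <= rnorm x) ->
  forall x y, dot (S x) y = dot x (adjoint dot S y).
Proof.
move=> S1; suff : exists S', forall x y, dot (S x) y = dot x (S' y).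
  by move=> [S' S'P]; exact: (@xgetPex _ (fun=> 0) [set S' | forall x y, dot (S x) y = dot x (S' y)] (ex_intro _ S' S'P)).
have ex y : exists z, forall x, dot (S x) y = dot x z.
  apply: (@riesz _ (rnorm y)) => [c x z|x]; first by rewrite linearP dotDl dotZl.
  rewrite (le_trans (cauchy_schwarz _ _))// lecR mulrC ler_wpM2l ?rnorm_ge0//.
exists (fun y => projT1 (cid (ex y))) => x y.
exact: (projT2 (cid (ex y)) x).
Qed.

Lemma linear_adjoint (S S' : H -> H) :
  (forall x y, dot (S x) y = dot x (S' y)) -> linear S'.
Proof.
move=> SS' c x y; apply: dot_inj => z.
by rewrite dotC -SS' dotDr dotZr !SS' cjD cjM cjK -!dotC dotDl dotZl.
Qed.

End inner_product.

Section finite_dimension.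
Context {R : realType} {H : completeNormedModType R[i]}.
Variable dot : {dot H for @Num.conj R[i]}.
Implicit Types (x y z : H) (c : R[i]) (V W : set H) (S : H -> H).

Definition subspace V := V 0 /\ forall c x y, V x -> V y -> V (c *: x + y).

Lemma subspaceZ V c x : subspace V -> V x -> V (c *: x).
Proof. by case=> V0 VP /(VP c x 0); rewrite addr0; apply. Qed.

Lemma subspaceD V x y : subspace V -> V x -> V y -> V (x + y).
Proof. by case=> V0 VP /(VP 1 x y); rewrite scale1r. Qed.

Lemma subspaceB V x y : subspace V -> V x -> V y -> V (x - y).
Proof.
by move=> sV Vx /(subspaceZ (-1) sV); rewrite scaleN1r; exact: subspaceD.
Qed.

Lemma subspace_sum V I (r : seq I) (P : pred I) (F : I -> H) : subspace V ->
  (forall i, P i -> V (F i)) -> V (\sum_(i <- r | P i) F i).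
Proof.
move=> sV VF; elim/big_ind : _ => //; first by case: sV.
by move=> x y; exact: subspaceD.
Qed.

Lemma lin_span_min V W : subspace W -> V `<=` W -> lin_span V `<=` W.
Proof.
move=> sW VW _ [n [c [v [Vv ->]]]]; apply: subspace_sum => // i _.
by apply: subspaceZ => //; exact: VW.
Qed.

Lemma lin_span_subspace V : subspace (lin_span V).
Proof.
split; first by exists 0%N, (fun=> 0), (fun=> 0); rewrite big_ord0; split=> // -[].
move=> c _ _ [n [a [v [Vv ->]]]] [m [b [w [Vw ->]]]].
exists (n + m)%N, (fun i => match fintype.split i with
    inl j => c * a j | inr j => b j end),
  (fun i => match fintype.split i with inl j => v j | inr j => w j end).
split; first by move=> i; case: fintype.split.
rewrite big_split_ord/= scaler_sumr; congr (_ + _); apply: eq_bigr => i _.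
  by rewrite (unsplitK (inl i)) scalerA.
by rewrite (unsplitK (inr i)).
Qed.

Lemma lin_span_sub V : V `<=` lin_span V.
Proof.
move=> x Vx; exists 1%N, (fun=> 1), (fun=> x); split=> //.
by rewrite big_ord1 scale1r.
Qed.

Lemma lin_span_range (I : finType) (v : I -> H) x :
  lin_span (range v) x <-> exists c : I -> R[i], x = \sum_i c i *: v i.
Proof.
split=> [|[c ->]]; last first.
  apply: subspace_sum; first exact: lin_span_subspace.
  move=> i _; apply: subspaceZ; first exact: lin_span_subspace.
  by apply: lin_span_sub; exists i.
move: x; apply: lin_span_min.
  split; first by exists (fun=> 0); rewrite big1// => i _; rewrite scale0r.
  move=> c _ _ [a ->] [b ->]; exists (fun i => c * a i + b i).
  rewrite scaler_sumr -big_split/=; apply: eq_bigr => i _.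
  by rewrite scalerDl scalerA.
move=> _ [i _ <-]; exists (fun j => (j == i)%:R).
rewrite (bigD1 i)//= eqxx scale1r big1 ?addr0// => j /negPf ->.
by rewrite scale0r.
Qed.

Lemma linear_apply0 S : linear S -> S 0 = 0.
Proof.
by move=> Sl; have := Sl (-1) 0 0; rewrite scaler0 addr0 scaleN1r addNr.
Qed.

Lemma linear_applyZ S c x : linear S -> S (c *: x) = c *: S x.
Proof. by move=> Sl; have := Sl c x 0; rewrite !addr0 linear_apply0// addr0. Qed.

Lemma linear_applyD S x y : linear S -> S (x + y) = S x + S y.
Proof. by move=> Sl; have := Sl 1 x y; rewrite !scale1r. Qed.

Lemma linear_applyB S x y : linear S -> S (x - y) = S x - S y.
Proof. by move=> Sl; rewrite linear_applyD// -scaleN1r linear_applyZ// scaleN1r. Qed.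

Lemma linear_apply_sum S I (r : seq I) (P : pred I) (F : I -> H) : linear S ->
  S (\sum_(i <- r | P i) F i) = \sum_(i <- r | P i) S (F i).
Proof.
move=> Sl; apply: big_morph; last exact: linear_apply0.
by move=> x y; exact: linear_applyD.
Qed.

Lemma range_subspace S : linear S -> subspace (range S).
Proof.
move=> Sl; split; first by exists 0 => //; exact: linear_apply0.
by move=> c _ _ [x _ <-] [y _ <-]; exists (c *: x + y) => //; exact: Sl.
Qed.

Definition orthonormal_family n (e : 'I_n -> H) :=
  forall i j, dot (e i) (e j) = (i == j)%:R.

Lemma dot_orthonormal_sum n (e : 'I_n -> H) (c : 'I_n -> R[i]) j :
  orthonormal_family e -> dot (\sum_i c i *: e i) (e j) = c j.
Proof.
move=> eo; rewrite dot_suml (bigD1 j)//= dotZl eo eqxx mulr1 big1 ?addr0//.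
by move=> i /negPf ij; rewrite dotZl eo ij mulr0.
Qed.

Lemma orthonormal_basis_expand V n (e : 'I_n -> H) x :
  orthonormal_basis dot V e -> V x -> x = \sum_i dot x (e i) *: e i.
Proof.
move=> [eo ->] /lin_span_range[c xE].
by rewrite {1}xE; apply: eq_bigr => i _; rewrite xE dot_orthonormal_sum.
Qed.

Lemma orthonormal_basis_subspace V n (e : 'I_n -> H) :
  orthonormal_basis dot V e -> subspace V.
Proof. by move=> [_ ->]; exact: lin_span_subspace. Qed.

Lemma orthonormal_basis_mem V n (e : 'I_n -> H) i :
  orthonormal_basis dot V e -> V (e i).
Proof. by move=> [_ ->]; apply: lin_span_sub; exists i. Qed.

Lemma parseval V n (e : 'I_n -> H) x y : orthonormal_basis dot V e -> V x ->
  dot x y = \sum_i dot x (e i) * dot (e i) y.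
Proof.
move=> eV Vx; rewrite {1}(orthonormal_basis_expand eV Vx) dot_suml.
by apply: eq_bigr => i _; rewrite dotZl.
Qed.

Lemma orthonormal_leq m (I : finType) (e : 'I_m -> H) (v : I -> H) :
  orthonormal_family e -> (forall i, lin_span (range v) (e i)) -> (m <= #|I|)%N.
Proof.
move=> eo ev; have {}ev i := (lin_span_range v (e i)).1 (ev i).
pose a i := projT1 (cid (ev i)).
have aP i : e i = \sum_j a i j *: v j by exact: projT2 (cid (ev i)).
pose M := \matrix_(i < m, j < #|I|) a i (enum_val j).
pose N := \matrix_(j < #|I|, k < m) dot (v (enum_val j)) (e k).
apply: (@mulmx1_min _ _ _ M N).
apply/matrixP => i k; rewrite !mxE -eo aP dot_suml.
rewrite [RHS](reindex_onto enum_val enum_rank)/=; last by move=> j _; exact: enum_rankK.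
by apply: eq_big => [j|j _]; rewrite ?enum_valK ?eqxx// !mxE dotZl.
Qed.

Hypothesis Hn : inner_product_norm dot.

Lemma orthonormal_extend n (e : 'I_n -> H) x : orthonormal_family e ->
  x != 0 -> (forall i, dot x (e i) = 0) ->
  exists2 a : R[i], a != 0 & orthonormal_family
    (fun i : 'I_n.+1 => if unlift ord0 i is Some j then e j else a *: x).
Proof.
move=> eo x0 xe; have r0 : 0 < rnorm x.
  rewrite lt_neqAle rnorm_ge0 andbT eq_sym; apply: contra x0 => /eqP.
  by move/rnorm0_eq0 ->.
exists (rnorm x)^-1%:C => [|i j].
  by rewrite (inj_eq (@complexI R) _ 0) invr_eq0 gt_eqF.
case: (unliftP ord0 i) => [i' ->|->]; case: (unliftP ord0 j) => [j' ->|->].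
- by rewrite eo (inj_eq lift_inj).
- by rewrite dotZr dotC xe rmorph0 mulr0.
- by rewrite dotZl xe mulr0.
- rewrite eqxx dotZl dotZr cj_real dot_rnorm// mulrA -!rmorphM/= -invfM -expr2.
  by rewrite mulVf// expf_eq0/= gt_eqF.
Qed.

(** Orthonormal families of vectors with a property [P], which has to be stable
    under rescaling, cannot be longer than a spanning family; a longest one
    leaves no vector with the property in its orthogonal complement. *)
Lemma maximal_orthonormal V (P : H -> Prop) n (v : 'I_n -> H) :
  subspace V -> V `<=` lin_span (range v) ->
  (forall a x, P x -> P (a *: x)) ->
  exists m (e : 'I_m -> H), [/\ orthonormal_family e,
    forall i, V (e i) /\ P (e i) &
    forall x, V x -> P x -> (forall i, dot x (e i) = 0) -> x = 0].
Proof.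
move=> sV Vv PZ.
pose fam m := exists e : 'I_m -> H, orthonormal_family e /\ forall i, V (e i) /\ P (e i).
have fam0 : exists m, `[< fam m >].
  by exists 0%N; apply/asboolP; exists (fun=> 0); split=> -[].
have famn m : `[< fam m >] -> (m <= n)%N.
  move=> /asboolP[e [eo eVP]]; rewrite -[leqRHS]card_ord.
  by apply: (orthonormal_leq (v := v) eo) => i; apply: Vv; case: (eVP i).
have [m /asboolP[e [eo eVP]] mmax] := ex_maxnP fam0 famn.
exists m, e; split=> // x Vx Px xe; apply: contrapT => /eqP x0.
have [a a0 eo'] := orthonormal_extend eo x0 xe.
suff /mmax : `[< fam m.+1 >] by rewrite ltnn.
apply/asboolP; exists (fun i => if unlift ord0 i is Some j then e j else a *: x).
split; first exact: eo'.
move=> i; case: (unliftP ord0 i) => [j|] _ //.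
by split; [exact: subspaceZ|exact: PZ].
Qed.

Lemma exists_orthonormal_basis V n (v : 'I_n -> H) :
  subspace V -> V `<=` lin_span (range v) ->
  exists m (e : 'I_m -> H), orthonormal_basis dot V e.
Proof.
move=> sV Vv; have [|m [e [eo eV emax]]] := @maximal_orthonormal V (fun=> True) n v sV Vv.
  by [].
exists m, e; split => //; apply/seteqP; split=> x; last first.
  move: x; apply: lin_span_min => // _ [i _ <-].
  by case: (eV i).
move=> Vx; apply/lin_span_range; exists (fun i => dot x (e i)).
apply/subr0_eq/emax => //.
  apply: subspaceB => //; apply: subspace_sum => // i _; apply: subspaceZ => //.
  by case: (eV i).
by move=> i; rewrite dotBl dot_orthonormal_sum// subrr.
Qed.

Lemma orthonormal_basis_proper V W m n (e : 'I_m -> H) (f : 'I_n -> H) x :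
  orthonormal_basis dot W e -> orthonormal_basis dot V f -> W `<=` V ->
  V x -> ~ W x -> (m < n)%N.
Proof.
move=> eW fV WV Vx Wx.
have sV := orthonormal_basis_subspace fV.
have sW := orthonormal_basis_subspace eW.
set p := \sum_i dot x (e i) *: e i.
have Wp : W p.
  by apply: subspace_sum => // i _; apply/(subspaceZ _ sW)/(orthonormal_basis_mem i eW).
have y0 : x - p != 0 by rewrite subr_eq0; apply: contra_notN Wx => /eqP ->.
have [|a a0 eo'] := orthonormal_extend eW.1 y0.
  by move=> i; rewrite dotBl dot_orthonormal_sum ?subrr//; case: eW.
rewrite -[leqRHS]card_ord; apply: (orthonormal_leq (v := f) eo') => i.
have [_ <-] := fV; case: (unliftP ord0 i) => [j|] _.
  exact/WV/(orthonormal_basis_mem j eW).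
by apply: subspaceZ => //; apply: subspaceB => //; exact: WV.
Qed.

Lemma exists_eigenvector V n (e : 'I_n -> H) S x0 :
  orthonormal_basis dot V e -> linear S -> (forall x, V x -> V (S x)) ->
  V x0 -> x0 != 0 -> exists x a, [/\ V x, x != 0 & S x = a *: x].
Proof.
move=> eV Sl SV Vx0 x00.
pose M := \matrix_(i < n, j < n) dot (S (e i)) (e j).
have [a] : exists a, root (char_poly M) a.
  apply/closed_rootP; rewrite size_char_poly eqSS.
  case: n e eV M => // e eV _; exfalso; case/eqP: x00.
  by rewrite (orthonormal_basis_expand eV Vx0) big_ord0.
rewrite -eigenvalue_root_char => /eigenvalueP[v vM v0].
have sV := orthonormal_basis_subspace eV.
have expand : S (\sum_i v 0 i *: e i) = \sum_j (v *m M) 0 j *: e j.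
  rewrite linear_apply_sum//.
  under [RHS]eq_bigr do rewrite mxE scaler_suml.
  rewrite exchange_big/=; apply: eq_bigr => i _; rewrite linear_applyZ//.
  have -> : S (e i) = \sum_j dot (S (e i)) (e j) *: e j.
    by apply: (orthonormal_basis_expand eV); exact/SV/(orthonormal_basis_mem i eV).
  by rewrite scaler_sumr; apply: eq_bigr => j _; rewrite scalerA mxE.
exists (\sum_i v 0 i *: e i), a; split.
- apply: subspace_sum => // i _; apply: subspaceZ => //.
  exact: orthonormal_basis_mem eV.
- apply: contra v0 => /eqP ve; apply/eqP/rowP => i; rewrite mxE.
  by rewrite -(dot_orthonormal_sum (fun i => v 0 i) i eV.1) ve dot0l.
- rewrite expand vM scaler_sumr; apply: eq_bigr => j _.
  by rewrite mxE scalerA.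
Qed.

(** Commuting operators on a finite dimensional space have a common eigenvector:
    in a nonzero invariant subspace of least dimension, an eigenspace of one of
    them is invariant under all, hence is the whole subspace. *)
Lemma exists_common_eigenvector (I : Type) (S : I -> H -> H) V n (e : 'I_n -> H) x0 :
  (forall i, linear (S i)) -> (forall i j x, S i (S j x) = S j (S i x)) ->
  (forall i x, V x -> V (S i x)) -> orthonormal_basis dot V e -> V x0 -> x0 != 0 ->
  exists2 x, V x /\ x != 0 & forall i, exists a, S i x = a *: x.
Proof.
move=> Sl SC; elim/ltn_ind: n V e x0 => n IH V e x0 SV eV Vx0 x00.
have sV := orthonormal_basis_subspace eV.
have [scal|/existsNP[i nscal]] :=
  pselect (forall i, exists a, forall x, V x -> S i x = a *: x).
  by exists x0 => // i; have [a aP] := scal i; exists a; exact: aP.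
have [x1 [a [Vx1 x10 Sx1]]] := exists_eigenvector eV (Sl i) (SV i) Vx0 x00.
pose W := [set x | V x /\ S i x = a *: x].
have sW : subspace W.
  split; first by split; [case: sV|rewrite linear_apply0// scaler0].
  move=> c x y [Vx xa] [Vy ya]; split; first by case: sV => _; apply.
  by rewrite Sl xa ya scalerDr !scalerA mulrC.
have [y Vy Wy] : exists2 y, V y & ~ W y.
  apply: contrapT => nex; apply: nscal; exists a => x Vx.
  by apply: contrapT => Sx; apply: nex; exists x => // -[].
have [|m [f fW]] := exists_orthonormal_basis (v := e) sW.
  by move=> x [Vx _]; case: eV => _ <-.
have mn := orthonormal_basis_proper fW eV (fun x Wx => Wx.1) Vy Wy.
have [||x [[Vx _] x0' xa]] := IH m mn W f x1 _ fW _ x10.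
- move=> j x [Vx Sx]; split; first exact: SV.
  by rewrite SC Sx linear_applyZ.
- by [].
by exists x.
Qed.

(** Neumann's series for the inverse of [1 - S]. *)
Lemma neumann S (q : R) : linear S -> 0 <= q < 1 ->
  (forall x, rnorm (S x) <= q * rnorm x) -> bijective (fun x => x - S x).
Proof.
move=> Sl /andP[q0 q1] Sq.
have inj x y : x - S x = y - S y -> x = y.
  move=> xy; apply/subr0_eq/rnorm0_eq0; have := Sq (x - y).
  rewrite linear_applyB//; have -> : S x - S y = x - y.
    move/eqP: xy; rewrite subr_eq addrAC -[eqbRHS]addrA [eqbRHS]addrC -subr_eq.
    by move/eqP.
  have := rnorm_ge0 (x - y); nra.
have iterq n x : rnorm (iter n S x) <= q ^+ n * rnorm x.
  elim: n => [|n IHn]; first by rewrite mul1r.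
  rewrite iterS exprS -mulrA; apply: (le_trans (Sq _)).
  by rewrite ler_wpM2l.
have surj y : exists x, x - S x = y.
  pose u n := \sum_(k < n) iter k S y.
  have uS n : u n.+1 = y + S (u n).
    by rewrite /u big_ord_recl (linear_apply_sum _ _ _ Sl).
  have q1' : 0 < 1 - q by rewrite subr_gt0.
  have dist k m : rnorm (u (k + m)%N - u m) <= q ^+ m * (rnorm y / (1 - q)).
    elim: m => [|m IHm].
      rewrite addn0 /u big_ord0 subr0 mul1r ler_pdivlMr//.
      elim: k => [|k IHk]; first by rewrite big_ord0 rnorm0 mul0r rnorm_ge0.
      have := uS k; rewrite /u => ->.
      have := rnormD y (S (\sum_(i < k) iter i S y)).
      have := Sq (\sum_(i < k) iter i S y).
      have := rnorm_ge0 (\sum_(i < k) iter i S y); have := rnorm_ge0 y.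
      move: IHk; set a := rnorm (bigop _ _ _); set b := rnorm (S _).
      set c := rnorm (y + _); nra.
    rewrite addnS !uS opprD addrACA subrr add0r -linear_applyB//.
    by rewrite exprS -mulrA; apply: (le_trans (Sq _)); rewrite ler_wpM2l.
  have [|x ux] := @rnorm_complete _ _ u.
    move=> e e0; set B := rnorm y / (1 - q).
    have B0 : 0 <= B by rewrite divr_ge0 ?rnorm_ge0// ltW.
    have qn0 : (GRing.exp q : R^nat) @ \oo --> (0 : R).
      by apply: cvg_expr; rewrite ger0_norm.
    have /cvgrPdist_lt /(_ (e / (B + 1))) [|N _ NP] := qn0.
      by rewrite divr_gt0// ltr_wpDl.
    have small m k : (N <= m)%N -> rnorm (u (k + m)%N - u m) < e.
      move=> /NP /=; rewrite sub0r normrN ger0_norm ?exprn_ge0//.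
      rewrite ltr_pdivlMr ?ltr_wpDl// => me; apply: le_lt_trans (dist _ _) _.
      by apply: le_lt_trans me; rewrite ler_wpM2l ?exprn_ge0// lerDl.
    exists N => m n Nm Nn; have [mn|/ltnW nm] := leqP m n.
      by rewrite rnormB -(subnK mn); exact: small.
    by rewrite -(subnK nm); exact: small.
  exists x; apply/subr0_eq/rnorm0_eq0/eqP; rewrite eq_le rnorm_ge0 andbT.
  apply/ler_addgt0Pr => e e0; rewrite add0r.
  have [|N uN] := ux (e / 2); first by rewrite divr_gt0.
  have := uN N (leqnn N); have := uN N.+1 (leqnSn N).
  have -> : x - S x - y = - (u N.+1 - x) + S (u N - x).
    by rewrite uS (linear_applyB _ _ Sl) opprB opprD !addrA subrK addrAC.
  have := rnormD (- (u N.+1 - x)) (S (u N - x)); rewrite rnormN.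
  have := Sq (u N - x); have := rnorm_ge0 (u N - x).
  set a := rnorm (S _); set b := rnorm (u N - x); nra.
pose g y := projT1 (cid (surj y)).
have gP y : g y - S (g y) = y by exact: projT2 (cid (surj y)).
by exists g => x //; apply: inj; exact: gP.
Qed.

Lemma op_invP S : bijective S -> cancel S (op_inv S) /\ cancel (op_inv S) S.
Proof.
move=> [S' SS' S'S].
exact: (@xgetPex _ (fun=> 0) [set S' | cancel S S' /\ cancel S' S]
  (ex_intro _ S' (conj SS' S'S))).
Qed.

End finite_dimension.

(** * Characters of the circle *)

Section characters.
Context {R : realType}.
Implicit Types (s t : R) (g : R -> R[i]).

Definition cis t : R[i] := cos t +i* sin t.

Lemma cisD s t : cis (s + t) = cis s * cis t.
Proof. by rewrite /cis cosD sinD; simpc; rewrite [X in _ +i* X]addrC. Qed.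

Lemma cis0 : cis 0 = 1.
Proof. by rewrite /cis cos0 sin0. Qed.

Lemma cis_neq0 t : cis t != 0.
Proof.
apply/eqP => t0; have := cisD t (- t); rewrite subrr cis0 t0 mul0r.
by move/eqP; rewrite oner_eq0.
Qed.

Lemma cisN t : cis (- t) = (cis t)^-1.
Proof.
apply: (mulIf (cis_neq0 t)); rewrite -cisD addNr cis0 mulVf//.
exact: cis_neq0.
Qed.

Lemma cisMn t n : cis (t *+ n) = cis t ^+ n.
Proof.
elim: n => [|n IH]; first by rewrite mulr0n cis0.
by rewrite mulrS cisD IH exprS.
Qed.

Lemma cisMz t (n : int) : cis (n%:~R * t) = cis t ^ n.
Proof.
case: n => n; first by rewrite -[_%:~R]/(n%:R) mulr_natl cisMn.
by rewrite NegzE rmorphN/= mulNr cisN -[_%:~R]/(n.+1%:R) mulr_natl cisMn.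
Qed.

Lemma norm_cis t : `|cis t| = 1.
Proof. by rewrite normc_def/= cos2Dsin2 sqrtr1. Qed.

Lemma cis2pi : cis (pi *+ 2) = 1.
Proof. by rewrite /cis cos2pi sin2pi. Qed.

Lemma cispi : cis pi = -1.
Proof. by rewrite /cis cospi sinpi; simpc. Qed.

Lemma cis_onto (l : R[i]) : `|l| = 1 -> exists t, l = cis t.
Proof.
case: l => a b; rewrite normc_def/= => /(congr1 (@complex.Re R))/= ab.
have {}ab : a ^+ 2 + b ^+ 2 = 1.
  by rewrite -[LHS]sqr_sqrtr ?addr_ge0 ?sqr_ge0// ab expr1n.
have a1 : -1 <= a <= 1 by apply/andP; split; have := sqr_ge0 b; nra.
have sa : sin (acos a) = `|b|.
  by rewrite sin_acos// -ab addrC addKr sqrtr_sqr.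
have [b0|b0] := leP 0 b.
  by exists (acos a); rewrite /cis acosK// sa ger0_norm.
exists (- acos a); rewrite /cis cosN sinN acosK// sa ltr0_norm// opprK.
by [].
Qed.

Lemma sqr_right_half_plane (z w : R[i]) : z ^+ 2 = w ^+ 2 ->
  0 < complex.Re z -> 0 <= complex.Re w -> z = w.
Proof.
move=> /eqP; rewrite eqf_sqr => /orP[/eqP//|/eqP ->].
by rewrite raddfN/= oppr_gt0 => /lt_le_trans /[apply]; rewrite ltxx.
Qed.

Lemma cis_near1 (e : R) : 0 < e ->
  exists2 r : R, 0 < r & forall t, `|t| < r -> `|cis t - 1| < e%:C.
Proof.
move=> e0; have e2 : 0 < e / 2 by rewrite divr_gt0.
have := @continuous_cos R 0; have := @continuous_sin R 0.
move=> /cvgrPdist_lt /(_ _ e2) /nbhs_ballP[r1 r10 sr].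
move=> /cvgrPdist_lt /(_ _ e2) /nbhs_ballP[r2 r20 cr].
exists (Num.min r1 r2); first by rewrite lt_min r10 r20.
move=> t; rewrite lt_min => /andP[t1 t2].
have {}sr : `|sin t| < e / 2.
  by have := sr t; rewrite /ball/= sub0r normrN sin0 sub0r normrN; apply.
have {}cr : `|cos t - 1| < e / 2.
  by have := cr t; rewrite /ball/= sub0r normrN cos0 distrC; apply.
have -> : cis t - 1 = (cos t - 1)%:C + (sin t)%:C * 'i%C.
  by rewrite /cis; simpc.
rewrite (le_lt_trans (ler_normD _ _))// normrM !normc_def/=.
rewrite !expr0n/= !addr0 expr1n add0r sqrtr1 mulr1 !sqrtr_sqr -rmorphD/= ltcR.
by rewrite (splitr e) ltrD.
Qed.

(** A character takes the value of a power function at a root of unity of order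
    a large power of two.  The same power gives its value at the iterated square
    roots, because both values are in the right half plane where square roots
    are unique, and the angles reached in this way are dense. *)
Lemma circle_character g :
  (forall s t, g (s + t) = g s * g t) -> g (pi *+ 2) = 1 ->
  (forall e : R, 0 < e -> exists2 r : R, 0 < r & forall t, `|t| < r -> `|g t - 1| < e%:C) ->
  exists n : int, forall t, g t = cis (n%:~R * t).
Proof.
move=> gD g2pi gcont.
have g0 : g 0 = 1.
  have g00 : g 0 != 0.
    apply/eqP => g00; have := gD (pi *+ 2) 0; rewrite addr0 g2pi g00 mulr0.
    by move/eqP; rewrite oner_eq0.
  by apply: (mulIf g00); rewrite -gD addr0 mul1r.
have gMn t n : g (t *+ n) = g t ^+ n.
  by elim: n => [|n IH]; rewrite ?mulr0n// mulrS gD IH exprS.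
have [r r0 gr] := gcont 1 ltr01.
pose a j : R := pi *+ 2 / 2 ^+ j.
have a0 j : 0 <= a j 
  by apply: divr_ge0; [exact/mulrn_wge0/pi_ge0|exact: exprn_ge0].
have aS j : a j.+1 *+ 2 = a j.
  by rewrite /a exprS invfM -mulr_natr; field; rewrite expf_neq0.
have aM j k : a (j + k)%N *+ 2 ^ k = a j.
  elim: k => [|k IH]; first by rewrite addn0.
  by rewrite addnS expnSr mulnC mulrnA aS.
have small (e : R) : 0 < e -> exists m, forall j, (m <= j)%N -> a j < e.
  move=> e0; have half0 : (GRing.exp (2^-1 : R) : R^nat) @ \oo --> (0 : R).
    by apply: cvg_expr; rewrite ger0_norm// invf_lt1// ltr1n.
  have /cvgrPdist_lt /(_ (e / (pi *+ 2))) [|m _ mP] := half0.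
    by rewrite divr_gt0// pmulrn_lgt0// pi_gt0.
  exists m => j /mP/=; rewrite sub0r normrN ger0_norm ?exprn_ge0// exprVn.
  have p2 : 0 < (pi *+ 2 : R) by rewrite pmulrn_lgt0// pi_gt0.
  by rewrite (ltr_pdivlMr _ _ p2) [X in X < e -> _]mulrC.
have [m0 m0P] := small r r0; pose m := m0.+1.
have mP j : (m <= j)%N -> a j < r by move=> /ltnW; exact: m0P.
have Rpos j : (m <= j)%N -> 0 < complex.Re (g (a j)).
  move=> mj; have := gr (a j); rewrite ger0_norm// => /(_ (mP _ mj)).
  have := normc_ge_Re (g (a j) - 1) => /le_lt_trans /[apply].
  rewrite ltcR raddfB/= ltr_norml => /andP[+ _].
  by rewrite ltrBrDr addNr.
have half j : a j.+1 *+ 2 ^ j = pi.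
  have := aM 0%N j.+1; rewrite add0n expnS mulnC mulrnA /a expr0 divr1.
  move=> /(congr1 (fun x => x / 2)); rewrite -[X in X / 2]mulr_natr -[pi *+ 2]mulr_natr.
  by rewrite !mulfK.
have root j : exists k, (k < 2 ^ j)%N /\ g (a j) = cis (a j *+ k).
  elim: j => [|j [k [kj gk]]].
    by exists 0%N; split=> //; rewrite mulr0n cis0 /a expr0 divr1.
  have : g (a j.+1) ^+ 2 = cis (a j.+1 *+ k) ^+ 2.
    by rewrite -gMn aS gk -cisMn mulrnAC aS.
  move=> /eqP; rewrite eqf_sqr => /orP[/eqP gE|/eqP gE].
    by exists k; split=> //; rewrite (leq_trans kj)// leq_exp2l.
  exists (k + 2 ^ j)%N; split; first by rewrite expnS mul2n -addnn ltn_add2r.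
  by rewrite gE mulrnDr half cisD cispi mulrN1.
have [k [km gk]] := root m.
have [n [nm gn]] : exists n : int, (`|n| <= 2 ^ m0)%N /\ g (a m) = cis (n%:~R * a m).
  have [km0|km0] := leqP k (2 ^ m0).
    by exists k%:Z; split=> //; rewrite gk -[_%:~R]/(k%:R) mulr_natl.
  exists (k%:Z - (2 ^ m)%:Z); split.
    rewrite -abszN opprB subzn ?(ltnW km)// absz_nat leq_subLR.
    by rewrite expnS mul2n -addnn leq_add2r ltnW.
  rewrite rmorphB/= mulrBl -![_%:~R]/(_%:R) !mulr_natl cisD cisN -gk.
  have -> : a m *+ 2 ^ m = pi *+ 2.
    by have := aM 0%N m; rewrite add0n => ->; rewrite /a expr0 divr1.
  by rewrite cis2pi invr1 mulr1.
have gj j : g (a (m + j)%N) = cis (n%:~R * a (m + j)%N).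
  elim: j => [|j IH]; first by rewrite addn0.
  rewrite addnS; apply: sqr_right_half_plane.
  - by rewrite -gMn aS IH -cisMn -(aS (m + j)%N) mulrnAr.
  - by rewrite Rpos// -addnS leq_addr.
  - rewrite /= cos_ge0_pihalf// -ler_norml normrM [X in _ * X]ger0_norm//.
    rewrite ler_pdivlMr// -mulrA mulr_natr aS.
    have am : a (m + j)%N <= a m.
      rewrite -[leRHS](aM m j) -mulr_natr ler_peMr//.
      by rewrite ler1n expn_gt0.
    apply: le_trans (ler_wpM2l _ am) _ => //.
    rewrite -(half m0) -mulr_natl ler_wpM2r//.
    by rewrite -intr_norm -[leRHS]/((2 ^ m0)%:Z%:~R) ler_int -abszE.
exists n => t.
pose h t := g t * cis (- (n%:~R * t)).
have hD s u : h (s + u) = h s * h u.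
  by rewrite /h gD mulrDr opprD cisD mulrACA.
suff ht : h t = 1.
  by rewrite -[g t]mulr1 -(mulVf (cis_neq0 (n%:~R * t))) -cisN mulrA -/(h t) ht mul1r.
have hcont (e : R) : 0 < e -> exists2 r : R, 0 < r & forall t, `|t| < r -> `|h t - 1| < e%:C.
  move=> e0; have e2 : 0 < e / 2 by rewrite divr_gt0.
  have [r1 r10 gr1] := gcont _ e2; have [r2 r20 gr2] := cis_near1 e2.
  have n1 : 0 < `|n%:~R : R| + 1 by rewrite ltr_wpDl.
  exists (Num.min r1 (r2 / (`|n%:~R| + 1))); first by rewrite lt_min r10 divr_gt0.
  move=> u; rewrite lt_min => /andP[u1]; rewrite ltr_pdivlMr// => u2.
  have -> : h u - 1 = (g u - 1) * cis (- (n%:~R * u)) + (cis (- (n%:~R * u)) - 1).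
    by rewrite mulrBl mul1r addrA subrK.
  rewrite (le_lt_trans (ler_normD _ _))// normrM norm_cis mulr1.
  rewrite (splitr e) rmorphD/= ltrD//; first exact: gr1.
  apply: gr2; rewrite normrN normrM; apply: le_lt_trans u2.
  by rewrite mulrC ler_wpM2l// lerDl.
have hj j (p : int) : h (p%:~R * a (m + j)%N) = 1.
  have h1 : h (a (m + j)%N) = 1 by rewrite /h gj -cisD subrr cis0.
  have hn k' : h (a (m + j)%N *+ k') = 1.
    elim: k' => [|k' IHk]; last by rewrite mulrS hD h1 IHk mulr1.
    by rewrite mulr0n /h g0 mulr0 oppr0 cis0 mulr1.
  case: p => p; first by rewrite -[_%:~R]/(p%:R) mulr_natl hn.
  rewrite NegzE rmorphN/= mulNr -[_%:~R]/(p.+1%:R) mulr_natl.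
  have := hD (- (a (m + j)%N *+ p.+1)) (a (m + j)%N *+ p.+1).
  rewrite addNr hn mulr1 => <-.
  by rewrite /h g0 mulr0 oppr0 cis0 mulr1.
apply/subr0_eq/eqP; rewrite -normr_le0; apply/ler_addgt0Pr => e e0.
have eR : (complex.Re e)%:C = e by rewrite RRe_real// realE ltW.
have e0R : 0 < complex.Re e by rewrite -(ltcR 0) eR.
have [r' r'0 hr] := hcont _ e0R.
have [j0 j0P] := small _ r'0.
have am0 : 0 < a (m + j0)%N 
  by apply: divr_gt0; [rewrite pmulrn_lgt0// pi_gt0|exact: exprn_gt0].
pose p := Num.floor (t / a (m + j0)%N).
have tE : t = (t - p%:~R * a (m + j0)%N) + p%:~R * a (m + j0)%N by rewrite subrK.
rewrite add0r tE hD hj mulr1 -eR ltW//; apply: hr.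
have /andP[p1 p2] := floor_itv (t / a (m + j0)%N).
rewrite ger0_norm; last by rewrite subr_ge0 -ler_pdivlMr.
rewrite (lt_trans _ (j0P (m + j0)%N (leq_addl _ _)))//.
rewrite ltrBlDl -[X in _ + X]mul1r -mulrDl -ltr_pdivrMr//.
by move: p2; rewrite intrD.
Qed.

End characters.

(** * The homogeneous components of a graded Hilbert module *)

Section frames.
Context {R : realType} {H : completeNormedModType R[i]}.
Variable dot : {dot H for @Num.conj R[i]}.
Hypothesis Hn : inner_product_norm dot.

(** A Parseval frame of [W] computes the trace of its identity. *)
Lemma frame_dim (W : set H) n (e : 'I_n -> H) (s : seq H) :
  orthonormal_basis dot W e -> (forall v, v \in s -> W v) ->
  (forall x, W x -> x = \sum_(v <- s) dot x v *: v) ->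
  n%:R = \sum_(v <- s) rnorm v ^+ 2 :> R.
Proof.
move=> eW sW frame; apply: complexI; rewrite rmorph_nat rmorph_sum/=.
under eq_bigr do rewrite -(dot_rnorm Hn).
rewrite [RHS]big_seq.
under [RHS]eq_bigr => v vs do rewrite (parseval _ eW (sW v vs)).
rewrite -big_seq exchange_big/=.
rewrite -[n in LHS]card_ord -sumr_const; apply: eq_bigr => i _.
have := frame _ (orthonormal_basis_mem i eW).
move=> /(congr1 (dot ^~ (e i))); rewrite /= eW.1 eqxx mulr1n dot_suml => ->.
by apply: eq_bigr => v _; rewrite dotZl mulrC.
Qed.

(** Families with the same frame operator have the same image energy under a
    linear map, namely its Hilbert-Schmidt norm weighted by that operator. *)
Lemma frame_energy (V : set H) n (u : 'I_n -> H) (I J : finType)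
    (a : I -> H) (b : J -> H) (X : H -> H) :
  orthonormal_basis dot V u -> (forall i, V (a i)) -> (forall j, V (b j)) ->
  (forall x, \sum_i dot x (a i) *: a i = \sum_j dot x (b j) *: b j) -> linear X ->
  \sum_i rnorm (X (a i)) ^+ 2 = \sum_j rnorm (X (b j)) ^+ 2.
Proof.
move=> uV aV bV ab Xl; apply: complexI; rewrite !rmorph_sum/=.
have energy (K : finType) (c : K -> H) : (forall k, V (c k)) ->
    \sum_k (rnorm (X (c k)) ^+ 2)%:C =
    \sum_p \sum_q dot (\sum_k dot (u q) (c k) *: c k) (u p) * dot (X (u p)) (X (u q)).
  move=> cV.
  have one k : (rnorm (X (c k)) ^+ 2)%:C = \sum_p \sum_q
      dot (u q) (c k) * dot (c k) (u p) * dot (X (u p)) (X (u q)).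
    rewrite -(dot_rnorm Hn) [c k in LHS](orthonormal_basis_expand uV (cV k)).
    rewrite (linear_apply_sum _ _ _ Xl) dot_suml; apply: eq_bigr => p _.
    rewrite dot_sumr; apply: eq_bigr => q _.
    by rewrite !(linear_applyZ _ _ Xl) dotZl dotZr -dotC; ring.
  under eq_bigr do rewrite one.
  rewrite exchange_big/=; apply: eq_bigr => p _.
  rewrite exchange_big/=; apply: eq_bigr => q _.
  rewrite dot_suml mulr_suml; apply: eq_bigr => k _.
  by rewrite dotZl.
rewrite !energy//; apply: eq_bigr => p _; apply: eq_bigr => q _.
by rewrite ab.
Qed.

End frames.

Section graded_module.
Context {R : realType} {H : completeNormedModType R[i]} {d : nat}.
Variable dot : {dot H for @Num.conj R[i]}.
Variable T : 'I_d -> {linear H -> H}.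
Variable Gamma : R[i] -> H -> H.
Hypothesis HM : contractive_hilbert_module dot T.
Hypothesis HG : gauge_group dot T Gamma.
Variable N0 : int.
Hypothesis HN0 : forall n, gauge_spectrum Gamma n -> N0 <= n.
Hypothesis HF : finite_rank dot T.

Local Notation Ta k := (adjoint dot (T k)).
Let D x := x - \sum_k T k (Ta k x).
Hypothesis Hdefect : is_positive_sqrt dot D (defect dot T).

Let Hn : inner_product_norm dot := module_norm HM.

Lemma module_row_contraction (xi : 'I_d -> H) :
  rnorm (\sum_k T k (xi k)) ^+ 2 <= \sum_k rnorm (xi k) ^+ 2.
Proof.
rewrite -lecR rmorphXn/= rnormE rmorph_sum/=.
apply: le_trans (module_contractive HM xi) _.
by apply: ler_sum => k _; rewrite rmorphXn/= rnormE.
Qed.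

Lemma module_contraction k x : rnorm (T k x) <= rnorm x.
Proof.
rewrite -(@ler_pXn2r _ 2)// ?nnegrE ?rnorm_ge0//.
have := module_row_contraction (fun i => if i == k then x else 0).
rewrite (bigD1 k)//= eqxx big1 ?addr0 => [|i /negPf ->]; last by rewrite linear0.
rewrite (bigD1 k)//= eqxx big1 ?addr0// => i /negPf ->.
by rewrite rnorm0 expr0n.
Qed.

Lemma module_adjoint k x y : dot (T k x) y = dot x (Ta k y).
Proof. by apply: adjointP => // z; exact: module_contraction. Qed.

Lemma adjoint_linear k : linear (Ta k).
Proof. by apply: linear_adjoint; exact: module_adjoint. Qed.

Lemma frame_operator_linear : linear D.
Proof.
move=> c x y; rewrite /D.
under eq_bigr do rewrite adjoint_linear linearP.
by rewrite big_split/= -scaler_sumr scalerBr opprD addrACA.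
Qed.

Lemma frame_operator_selfadjoint x y : dot (D x) y = dot x (D y).
Proof.
rewrite /D dotBl dotBr dot_suml dot_sumr; congr (_ - _); apply: eq_bigr => k _.
by rewrite module_adjoint [RHS]dotC module_adjoint -dotC.
Qed.

Lemma circle1 : circle (1 : R[i]). Proof. exact: normr1. Qed.

Lemma circleV (l : R[i]) : circle l -> circle l^-1.
Proof. by rewrite /circle /= => l1; rewrite normfV l1 invr1. Qed.

Lemma circle_neq0 (l : R[i]) : circle l -> l != 0.
Proof. by rewrite /circle /= -normr_eq0 => ->; exact: oner_neq0. Qed.

Lemma circle_conj (l : R[i]) : circle l -> Num.conj l = l^-1.
Proof.
move=> l1; apply: (mulfI (circle_neq0 l1)).
by rewrite mulfV ?circle_neq0// -normCK l1 expr1n.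
Qed.

Lemma gaugeK l x : circle l -> Gamma l (Gamma l^-1 x) = x.
Proof.
move=> l1; rewrite -(gaugeM HG)//; last exact: circleV.
by rewrite mulfV ?circle_neq0// (gauge1 HG).
Qed.

Lemma gaugeVK l x : circle l -> Gamma l^-1 (Gamma l x) = x.
Proof. by move=> l1; rewrite -{2}[l]invrK gaugeK//; exact: circleV. Qed.

Lemma gauge_adjoint l x y : circle l -> dot (Gamma l x) y = dot x (Gamma l^-1 y).
Proof. by move=> l1; rewrite -{1}(gaugeK y l1) (gauge_isometry HG). Qed.

Lemma gauge_T l k x : circle l -> Gamma l (T k x) = l *: T k (Gamma l x).
Proof. by move=> l1; rewrite -(gauge_covariant HG)// gaugeVK. Qed.

Lemma gauge_Ta l k x : circle l -> Gamma l (Ta k x) = l^-1 *: Ta k (Gamma l x).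
Proof.
move=> l1; apply: (@dot_inj _ _ dot) => y; have l1' := circleV l1.
rewrite gauge_adjoint// dotC -module_adjoint dotZl [dot (Ta k _) y]dotC.
rewrite -module_adjoint.
have -> : T k (Gamma l^-1 y) = l *: Gamma l^-1 (T k y).
  by rewrite gauge_T// scalerA mulfV ?circle_neq0// scale1r.
rewrite dotZl cjM circle_conj//.
by rewrite gauge_adjoint// invrK.
Qed.

Lemma gauge_frame_operator l x : circle l -> Gamma l (D x) = D (Gamma l x).
Proof.
move=> l1; rewrite /D (linear_applyB _ _ (gauge_linear HG l1)).
rewrite (linear_apply_sum _ _ _ (gauge_linear HG l1)); congr (_ - _).
apply: eq_bigr => k _; rewrite gauge_T// gauge_Ta// linearZ/= scalerA.
by rewrite mulfV ?circle_neq0// scale1r.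
Qed.

Definition weight_space (m : nat) : set H :=
  [set x | forall l, circle l -> Gamma l x = l ^ (N0 + m%:Z) *: x].

Lemma weight_subspace m : subspace (weight_space m).
Proof.
split=> [l l1|c x y xm ym l l1]; first by rewrite (linear_apply0 (gauge_linear HG l1)) scaler0.
by rewrite (gauge_linear HG l1) xm// ym// scalerDr !scalerA mulrC.
Qed.

Lemma weight_T m k x : weight_space m x -> weight_space m.+1 (T k x).
Proof.
move=> xm l l1; rewrite gauge_T// xm// linearZ/= scalerA.
rewrite -[in l * _](expr1z l) -expfzDr ?circle_neq0//.
by have -> : 1 + (N0 + m%:Z) = N0 + m.+1%:Z by lia.
Qed.

Lemma weight_Ta m k x : weight_space m.+1 x -> weight_space m (Ta k x).
Proof.
move=> xm l l1; rewrite gauge_Ta// xm// (linear_applyZ _ _ (adjoint_linear k)).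
rewrite scalerA -[l^-1]/(l ^ (-1)) -expfzDr ?circle_neq0//.
by have -> : -1 + (N0 + m.+1%:Z) = N0 + m%:Z by lia.
Qed.

Lemma weight_Ta0 k x : weight_space 0 x -> Ta k x = 0.
Proof.
move=> x0; apply: contrapT => /eqP Tx0.
suff /HN0 : gauge_spectrum Gamma (N0 - 1) by lia.
exists (Ta k x) => // l l1.
rewrite gauge_Ta// x0// (linear_applyZ _ _ (adjoint_linear k)).
by rewrite scalerA -[l^-1]/(l ^ (-1)) -expfzDr ?circle_neq0// addr0 [-1 + _]addrC.
Qed.

Lemma weight_orthogonal m n x y : m != n ->
  weight_space m x -> weight_space n y -> dot x y = 0.
Proof.
wlog mn : m n x y / (n < m)%N => [wl|].
  rewrite neq_ltn => /orP[nm|nm] xm yn; last exact: (wl m n x y nm (negbT (gtn_eqF nm))).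
  by rewrite dotC (wl n m y x nm (negbT (gtn_eqF nm)))// rmorph0.
move=> _ xm yn; pose l : R[i] := cis (pi / (m - n)%:R).
have q0 : (m - n)%:R != 0 :> R by rewrite pnatr_eq0 subn_eq0 -ltnNge.
have l1 : circle l by exact: norm_cis.
have := gauge_isometry HG l1 x y; rewrite xm// yn// dotZl dotZr.
rewrite mulrA cjexpz circle_conj// exprz_inv -expfzDr ?circle_neq0//.
have -> : N0 + m%:Z + - (N0 + n%:Z) = (m - n)%N%:Z by rewrite -subzn ?(ltnW mn)//; lia.
rewrite -exprnP -cisMn -[(_ / _) *+ _]mulr_natr divfK// cispi mulN1r.
by move=> /eqP; rewrite eq_sym -addr_eq0 -mulr2n mulrn_eq0/= => /eqP.
Qed.

(** The common eigenvectors of the gauge group are homogeneous. *)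
Lemma gauge_eigenvector (f : H) : f != 0 ->
  (forall l, circle l -> exists a, Gamma l f = a *: f) ->
  exists n : int, forall l, circle l -> Gamma l f = l ^ n *: f.
Proof.
move=> f0 eig; pose g (t : R) := dot (Gamma (cis t) f) f / dot f f.
have ff0 : dot f f != 0 by rewrite dnorm_eq0.
have c1 (t : R) : circle (cis t) by exact: norm_cis.
have gE t : Gamma (cis t) f = g t *: f.
  by have [a aE] := eig _ (c1 t); rewrite /g aE dotZl mulfK.
have fI (a b : R[i]) : a *: f = b *: f -> a = b.
  by move=> /(congr1 (dot ^~ f))/=; rewrite !dotZl => /(mulIf ff0).
have [||e e0|n nE] := @circle_character _ g.
- move=> s t; apply: fI; rewrite -gE cisD (gaugeM HG)// gE.
  by rewrite (linear_applyZ _ _ (gauge_linear HG (c1 s))) gE scalerA mulrC.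
- by apply: fI; rewrite -gE cis2pi (gauge1 HG) scale1r.
- have fn0 : 0 < rnorm f.
    by rewrite lt_neqAle rnorm_ge0 andbT eq_sym; apply: contra f0 => /eqP/rnorm0_eq0 ->.
  have /subspace_continuousP /(_ 1 circle1) := @gauge_continuous _ _ _ _ _ _ HG f.
  move=> /cvgrPdist_lt /(_ (e * rnorm f)%:C).
  rewrite (ltcR 0) mulr_gt0// => /(_ isT) /nbhs_ballP[r r0 rP].
  have rR : (complex.Re r)%:C = r by rewrite RRe_real// realE ltW.
  have [|s s0 sP] := @cis_near1 R (complex.Re r); first by rewrite -(ltcR 0) rR.
  exists s => // t /sP; rewrite rR => tr.
  have : `|f - Gamma (cis t) f| < (e * rnorm f)%:C.
    rewrite -[X in X - _](gauge1 HG f); apply: (rP (cis t)) (c1 t).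
    by rewrite /ball/= distrC.
  have -> : f - Gamma (cis t) f = (1 - g t) *: f by rewrite gE scalerBl scale1r.
  rewrite normrZ distrC -rnormE rmorphM/=.
  by rewrite ltr_pM2r// (ltcR 0).
exists n => l /cis_onto[t ->].
by rewrite gE nE cisMz.
Qed.

Lemma frame_operator_range x : D x = defect dot T (defect dot T x).
Proof. by have [_ _ _ ->] := Hdefect. Qed.

Lemma defect_linear : linear (defect dot T).
Proof. by case: Hdefect. Qed.

(** A positive operator on a complex space is self-adjoint, by polarization. *)
Lemma positive_selfadjoint S : linear S -> (forall x, 0 <= dot (S x) x) ->
  forall x y, dot (S x) y = dot x (S y).
Proof.
move=> Sl Spos x y.
have real z : dot (S z) z = dot z (S z).
  by rewrite [RHS]dotC conj_Creal// ger0_real.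
have := real (x + y); have := real (x + 'i%C *: y).
rewrite !(linear_applyD _ _ Sl) !(linear_applyZ _ _ Sl) !dotDl !dotDr.
rewrite !dotZl !dotZr.
have -> : Num.conj ('i%C : R[i]) = - 'i%C by rewrite -[Num.conj _]/(conjc _) /=; simpc.
rewrite (real x) (real y); set a := dot (S x) y; set b := dot x (S y).
set a' := dot (S y) x; set b' := dot y (S x).
set c := dot x (S x); set e := dot y (S y) => E1 E2.
have i0 : ('i%C : R[i]) != 0 by rewrite eq_complex/= oner_eq0 andbF.
have F1 : 'i%C * ((a' - a) - (b' - b)) = 0.
  by move/eqP: E1; rewrite -subr_eq0 => /eqP <-; ring.
have F2 : (a + a') - (b + b') = 0.
  by move/eqP: E2; rewrite -subr_eq0 => /eqP <-; ring.
move/eqP: F1; rewrite mulf_eq0 (negPf i0)/= => /eqP F1.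
have : 2 * (a - b) = 0.
  have -> : 2 * (a - b) = ((a + a') - (b + b')) - ((a' - a) - (b' - b)) by ring.
  by rewrite F1 F2 subr0.
by move=> /eqP; rewrite mulf_eq0 pnatr_eq0/= subr_eq0 => /eqP.
Qed.

Lemma defect_selfadjoint x y : dot (defect dot T x) y = dot x (defect dot T y).
Proof. by apply: positive_selfadjoint; [exact: defect_linear|case: Hdefect]. Qed.

Lemma defect_eq0 x : D x = 0 -> defect dot T x = 0.
Proof.
move=> Dx; apply/eqP; rewrite -(dnorm_eq0 dot) defect_selfadjoint.
by rewrite -frame_operator_range Dx dot0r.
Qed.

Definition homogeneous_eigenvector f :=
  (forall l, circle l -> exists a, Gamma l f = a *: f) /\
  exists a, D f = a *: f.

(** The gauge unitaries commute with [D], so a longest orthonormal family of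
    their joint eigenvectors in the range of [D] is a basis: its orthogonal
    complement is invariant and contains no further joint eigenvector. *)
Lemma homogeneous_basis : exists n (f : 'I_n -> H),
  orthonormal_basis dot (range D) f /\ forall i, homogeneous_eigenvector (f i).
Proof.
have sV := range_subspace frame_operator_linear.
have [N [v Vv]] : exists N (v : 'I_N -> H), range D `<=` lin_span (range v).
  have [N [v vE]] := HF; exists N, v; rewrite -vE.
  apply: subset_trans (@subset_closure _ _).
  by move=> _ [x _ <-]; rewrite frame_operator_range; exists (defect dot T x).
have [|n [f [fo fV fmax]]] :=
    @maximal_orthonormal _ _ _ Hn (range D) homogeneous_eigenvector N v sV Vv.
  move=> a x [xG [b xD]]; split.
    move=> l l1; have [c xc] := xG l l1; exists c.
    by rewrite (linear_applyZ _ _ (gauge_linear HG l1)) xc !scalerA mulrC.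
  by exists b; rewrite (linear_applyZ _ _ frame_operator_linear) xD !scalerA mulrC.
exists n, f; split=> [|i]; last by case: (fV i).
split=> //; apply/seteqP; split=> [x Vx|]; last first.
  by apply: lin_span_min => // _ [i _ <-]; case: (fV i).
pose W := [set x | range D x /\ forall i, dot x (f i) = 0].
have sW : subspace W.
  split; first by split=> [|i]; [case: sV|rewrite dot0l].
  move=> c y z [Vy yf] [Vz zf]; split; first by case: sV => _; apply.
  by move=> i; rewrite dotDl dotZl yf zf mulr0 addr0.
suff W0 y : W y -> y = 0.
  apply/lin_span_range; exists (fun i => dot x (f i)); apply/subr0_eq/W0; split.
    apply: subspaceB => //; apply: subspace_sum => // i _; apply: subspaceZ => //.
    by case: (fV i).
  by move=> i; rewrite dotBl dot_orthonormal_sum// subrr.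
move=> Wy; apply: contrapT => /eqP y0.
have [|m [e eW]] := exists_orthonormal_basis Hn (v := v) sW.
  by move=> z [Vz _]; exact: Vv.
pose S (o : option {l | circle l}) := if o is Some l then Gamma (projT1 l) else D.
have SE l (l1 : circle l) : S (Some (exist _ l l1)) = Gamma l by [].
have [|||z [Wz z0] zS] := @exists_common_eigenvector _ _ _ Hn _ S W m e y _ _ _ eW Wy y0.
- case=> [[l l1]|]; [rewrite SE; exact: (gauge_linear HG l1)|exact: frame_operator_linear].
- move=> [[l l1]|] [[k k1]|] x' //=; last 2 first.
  + by rewrite gauge_frame_operator.
  + by rewrite gauge_frame_operator.
  by rewrite -!(gaugeM HG)// mulrC.
- move=> [[l l1]|] x' [Vx' x'f] /=; split.
  + have [w _ <-] := Vx'; rewrite gauge_frame_operator//; by exists (Gamma l w).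
  + move=> i; rewrite gauge_adjoint//.
    have [_ [fG _]] := fV i; have [a ->] := fG _ (circleV l1).
    by rewrite dotZr x'f mulr0.
  + by exists x'.
  + move=> i; rewrite frame_operator_selfadjoint.
    by have [_ [_ [a ->]]] := fV i; rewrite dotZr x'f mulr0.
case/eqP: z0; apply: fmax.
- by case: Wz.
- split=> [l l1|]; last exact: zS None.
  exact: zS (Some (exist _ l l1)).
- by case: Wz.
Qed.

Lemma weighted_frame : exists n (g : 'I_n -> H) (w : 'I_n -> nat),
  [/\ forall i, weight_space (w i) (g i),
      forall x, D x = \sum_i dot x (g i) *: g i &
      range (defect dot T) = lin_span (range g)].
Proof.
have [n [f [fV fH]]] := homogeneous_basis.
have wt i : exists m : nat, weight_space m (f i).
  have f0 : f i != 0.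
    by rewrite -(dnorm_eq0 dot) fV.1 eqxx oner_neq0.
  have [k kE] := gauge_eigenvector f0 (fH i).1.
  have kN : N0 <= k by apply: HN0; exists (f i).
  exists `|k - N0|%N => l l1; rewrite kE//.
  by have -> : N0 + `|k - N0|%N%:Z = k by lia.
pose w i := projT1 (cid (wt i)).
have wP i : weight_space (w i) (f i) by exact: projT2 (cid (wt i)).
pose a i := projT1 (cid (fH i).2).
have aP i : D (f i) = a i *: f i by exact: projT2 (cid (fH i).2).
have a0 i : 0 <= a i.
  have -> : a i = dot (D (f i)) (f i) by rewrite aP dotZl fV.1 eqxx mulr1.
  by rewrite frame_operator_range defect_selfadjoint dnorm_ge0.
pose g i := sqrtC (a i) *: f i.
have Dg x : D x = \sum_i dot x (g i) *: g i.
  rewrite (orthonormal_basis_expand fV (x := D x)); last by exists x.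
  apply: eq_bigr => i _; rewrite frame_operator_selfadjoint aP dotZr.
  rewrite /g dotZr scalerA; congr (_ *: _).
  rewrite [RHS]mulrAC !conj_Creal ?ger0_real ?sqrtC_ge0//.
  by rewrite -expr2 sqrtCK.
exists n, g, w; split=> //.
  by move=> i; exact: (subspaceZ _ (weight_subspace (w i)) (wP i)).
have sV := range_subspace defect_linear.
have DV : range D `<=` range (defect dot T).
  by move=> _ [x _ <-]; rewrite frame_operator_range; exists (defect dot T x).
apply/seteqP; split; last first.
  apply: lin_span_min => // _ [i _ <-]; apply: subspaceZ => //.
  by apply: DV; exact: orthonormal_basis_mem fV.
move=> x Vx; pose p := \sum_i dot x (f i) *: f i.
have pV : range D p.
  apply: subspace_sum; first exact: range_subspace frame_operator_linear.
  move=> i _; apply: subspaceZ; first exact: range_subspace frame_operator_linear.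
  exact: orthonormal_basis_mem fV.
have -> : x = p.
  apply/subr0_eq; have : D (x - p) = 0.
    apply/eqP; rewrite -(dnorm_eq0 dot) frame_operator_selfadjoint.
    have DD : range D (D (D (x - p))) by exists (D (x - p)).
    rewrite dotC (parseval _ fV (x := D (D (x - p))))//.
    rewrite big1 ?rmorph0// => i _; rewrite [X in _ * X]dotC dotBl dot_orthonormal_sum ?subrr ?rmorph0 ?mulr0//.
    by case: fV.
  move=> /defect_eq0 xp0; have [y _ yE] : range (defect dot T) (x - p).
    by apply: subspaceB => //; exact: DV.
  apply/eqP; rewrite -(dnorm_eq0 dot) -{1}yE defect_selfadjoint xp0.
  by rewrite dot0r.
have [y _ <-] := pV; rewrite Dg; apply/lin_span_range.
by exists (fun i => dot y (g i)).
Qed.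

End graded_module.

Section word_frames.
Context {R : realType} {H : completeNormedModType R[i]} {d : nat}.
Variable dot : {dot H for @Num.conj R[i]}.
Variable T : 'I_d -> {linear H -> H}.
Context {n : nat}.
Variables (g : 'I_n -> H) (w : 'I_n -> nat).

(** The vectors [T_u (g i)] of weight [m], for all words [u] in the operators. *)
Fixpoint word_frame m : seq H :=
  [seq g i | i <- enum 'I_n & w i == m] ++
  (if m is m'.+1 then [seq T k v | k <- enum 'I_d, v <- word_frame m'] else [::]).

(** The sum of [|T_u x|^2] over all words [u] of length [j]. *)
Fixpoint word_energy j (x : H) : R :=
  if j is j'.+1 then \sum_k word_energy j' (T k x) else rnorm x ^+ 2.

Lemma word_energy_ge0 j x : 0 <= word_energy j x.
Proof.
elim: j x => [|j IH] x /=; first exact: sqr_ge0.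
by apply: sumr_ge0 => k _; exact: IH.
Qed.

Lemma word_frame_sum (V : nmodType) (F : H -> V) m :
  \sum_(v <- word_frame m) F v = \sum_(i | w i == m) F (g i) +
    (if m is m'.+1 then \sum_k \sum_(v <- word_frame m') F (T k v) else 0).
Proof.
case: m => [|m] /=; rewrite big_cat big_map big_filter big_enum_cond/=.
  by rewrite big_nil.
by rewrite big_allpairs_dep big_enum.
Qed.

Lemma word_frame_energy m j : \sum_(v <- word_frame m) word_energy j v =
  \sum_(i | (w i <= m)%N) word_energy (m - w i + j) (g i).
Proof.
elim: m j => [|m IH] j; rewrite word_frame_sum.
  rewrite addr0; apply: eq_big => [i|i /eqP ->]; first by rewrite leqn0.
  by rewrite subnn.
rewrite exchange_big/= (IH j.+1) [RHS](bigID (fun i => w i == m.+1))/=.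
congr (_ + _).
  apply: eq_big => [i|i /eqP ->]; last by rewrite subnn.
  by case: eqVneq => [->|]; rewrite ?leqnn ?andbF.
apply: eq_big => [i|i wm]; first by rewrite -ltnS ltn_neqAle andbC.
by rewrite addnS subSn.
Qed.

Variable Gamma : R[i] -> H -> H.
Hypothesis HM : contractive_hilbert_module dot T.
Hypothesis HG : gauge_group dot T Gamma.
Variable N0 : int.
Hypothesis HN0 : forall n, gauge_spectrum Gamma n -> N0 <= n.
Hypothesis gw : forall i, weight_space Gamma N0 (w i) (g i).
Hypothesis gD : forall x,
  x - \sum_k T k (adjoint dot (T k) x) = \sum_i dot x (g i) *: g i.

Local Notation weight := (weight_space Gamma N0).

Lemma word_frame_weight m v : v \in word_frame m -> weight m v.
Proof.
elim: m v => [|m IH] v /=; rewrite mem_cat => /orP[].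
- by move=> /mapP [] i; rewrite mem_filter => /andP[/eqP <- _] ->.
- by [].
- by move=> /mapP [] i; rewrite mem_filter => /andP[/eqP <- _] ->.
- move=> /allpairsP[[k u] /= [_ um ->]].
  exact: (weight_T HG k (IH _ um)).
Qed.

(** A homogeneous vector satisfies [x = D x + sum_k T_k T_k^* x], where the [T_k^* x]
    have a smaller weight. *)
Lemma word_frame_expand m x : weight m x ->
  x = \sum_(v <- word_frame m) dot x v *: v.
Proof.
elim: m x => [|m IH] x xm; rewrite word_frame_sum.
  rewrite addr0 -[LHS](subrK (\sum_k T k (adjoint dot (T k) x))) gD.
  rewrite [X in _ + X]big1 ?addr0 => [|k _]; last first.
    by rewrite (weight_Ta0 HM HG HN0 _ xm) linear0.
  rewrite (bigID (fun i => w i == 0%N))/= [X in _ + X]big1 ?addr0// => i wi.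
  by rewrite (weight_orthogonal HG _ xm (gw i)) 1?eq_sym// scale0r.
rewrite -[LHS](subrK (\sum_k T k (adjoint dot (T k) x))) gD; congr (_ + _).
  rewrite (bigID (fun i => w i == m.+1))/= [X in _ + X]big1 ?addr0// => i wi.
  by rewrite (weight_orthogonal HG _ xm (gw i)) 1?eq_sym// scale0r.
apply: eq_bigr => k _; rewrite [X in T k X](IH _ (weight_Ta HM HG k xm)).
rewrite linear_sum; apply: eq_bigr => v _.
by rewrite linearZ/= dotC -(module_adjoint HM) -dotC.
Qed.

Definition word_span m : set H :=
  lin_span [set v | exists2 k, (k <= m)%N & v \in word_frame k].

Definition word_frames m : seq H := flatten [seq word_frame k | k <- iota 0 m.+1].

Lemma word_spanP m v : v \in word_frames m <-> exists2 k, (k <= m)%N & v \in word_frame k.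
Proof.
split=> [/flattenP[s /mapP[k]]|[k km vk]].
  by rewrite mem_iota/= add0n ltnS => km -> vk; exists k.
apply/flattenP; exists (word_frame k) => //; apply: map_f.
by rewrite mem_iota/= add0n ltnS.
Qed.

Lemma word_frames_sum (V : nmodType) (F : H -> V) m :
  \sum_(v <- word_frames m) F v = \sum_(k < m.+1) \sum_(v <- word_frame k) F v.
Proof.
rewrite /word_frames big_flatten big_map -[RHS](big_mkord xpredT (fun k => \sum_(v <- word_frame k) F v)).
by rewrite /index_iota subn0.
Qed.

Lemma word_span_expand m x : word_span m x ->
  x = \sum_(v <- word_frames m) dot x v *: v.
Proof.
move: x; apply: lin_span_min.
  split; first by rewrite big1// => v _; rewrite dot0l scale0r.
  move=> c x y xE yE; rewrite {1}xE {1}yE scaler_sumr -big_split/=.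
  by apply: eq_bigr => v _; rewrite dotDl dotZl scalerDl scalerA.
move=> x [k km xk]; rewrite word_frames_sum (bigD1 (Ordinal (km : (k < m.+1)%N)))//=.
rewrite -(word_frame_expand (word_frame_weight xk)) big1 ?addr0// => j jk.
rewrite big_seq big1// => v vj.
rewrite (weight_orthogonal HG _ (word_frame_weight xk) (word_frame_weight vj)) ?scale0r//.
by apply: contra jk => /eqP kj; apply/eqP/val_inj.
Qed.

(** The Hilbert function of the module in terms of word energies. *)
Lemma word_span_basis m : exists N (e : 'I_N -> H), orthonormal_basis dot (word_span m) e /\
  N%:R = \sum_(k < m.+1) \sum_(i | (w i <= k)%N) word_energy (k - w i) (g i).
Proof.
have Hn := module_norm HM.
pose v (i : 'I_(size (word_frames m))) := (word_frames m)`_i.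
have sW : subspace (word_span m) by exact: lin_span_subspace.
have [|N [e eW]] := exists_orthonormal_basis Hn (v := v) sW.
  move=> x /word_span_expand xE; apply/lin_span_range.
  by exists (fun i => dot x (v i)); rewrite {1}xE (big_nth 0) big_mkord.
exists N, e; split=> //.
rewrite (frame_dim Hn eW (s := word_frames m)).
- rewrite word_frames_sum; apply: eq_bigr => k _.
  rewrite (eq_bigr (word_energy 0))// word_frame_energy.
  by apply: eq_bigr => i _; rewrite addn0.
- by move=> u /word_spanP uk; exact: lin_span_sub.
- exact: word_span_expand.
Qed.

End word_frames.

(** * The action of polynomials *)

Section polynomial_action.
Context {R : realType} {H : completeNormedModType R[i]} {d : nat}.
Variable T : 'I_d -> {linear H -> H}.
Hypothesis TC : forall j k x, T j (T k x) = T k (T j x).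
Local Notation A := (mpoly d R[i]).
Local Notation mact := (monomial_act T).
Local Notation act := (poly_act T).

Lemma iter_linear k n : linear (iter n (T k)).
Proof. by elim: n => [//|n IH] c x y /=; rewrite IH linearP. Qed.

Lemma monomial_act_linear m : linear (mact m).
Proof.
rewrite /monomial_act; elim: (enum _) => [//|k s IH] c x y /=.
by rewrite IH iter_linear.
Qed.

Lemma monomial_actD m m' x : mact (mnm_add m m') x = mact m (mact m' x).
Proof.
have itT j n k x' : iter n (T j) (T k x') = T k (iter n (T j) x').
  by elim: n => //= n ->; rewrite TC.
have itit j n k p x' : iter n (T j) (iter p (T k) x') = iter p (T k) (iter n (T j) x').
  by elim: p => //= p <-; rewrite itT.
rewrite /monomial_act; elim: (enum _) => [//|k s IH] /=.
rewrite IH mnmDE iterD.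
have comm j n y : iter n (T j) (foldr (fun k y => iter (m k) (T k) y) y s) =
    foldr (fun k y => iter (m k) (T k) y) (iter n (T j) y) s.
  by elim: s {IH} => //= i s <-; rewrite itit.
by rewrite comm.
Qed.

Lemma monomial_act0 x : mact (@mnm0 d) x = x.
Proof.
rewrite /monomial_act; elim: (enum _) => //= k s ->.
by rewrite mnm0E.
Qed.

Lemma monomial_act1 k x : mact (mnm1 k) x = T k x.
Proof.
rewrite /monomial_act.
have nots s : k \notin s -> foldr (fun j y => iter (mnm1 k j) (T j) y) x s = x.
  elim: s => //= j s IH; rewrite inE negb_or => /andP[kj /IH ->].
  by rewrite mnm1E (negPf kj).
have : k \in enum 'I_d by rewrite mem_enum.
have := enum_uniq 'I_d; elim: (enum _) => //= j s IH /andP[js us].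
rewrite inE => /orP[/eqP kj|ks].
  by rewrite -kj in js *; rewrite nots// mnm1E eqxx.
rewrite IH// mnm1E; case: eqVneq => // kj.
by rewrite -kj ks in js.
Qed.

Lemma poly_act_sum (s : seq (multinom d)) f x : uniq s -> {subset msupp f <= s} ->
  act f x = \sum_(m <- s) mcoeff m f *: mact m x.
Proof.
move=> us fs; rewrite /poly_act [RHS](bigID (fun m => m \in msupp f))/=.
rewrite [X in _ + X]big1 ?addr0 => [|m mf]; last by rewrite memN_msupp_eq0// scale0r.
rewrite -[RHS]big_filter; apply: perm_big; apply: uniq_perm.
- exact: msupp_uniq.
- exact: filter_uniq.
- move=> m; rewrite mem_filter; case: (boolP (m \in msupp f)) => //= mf.
  by rewrite fs.
Qed.

Lemma poly_actD f f' x : act (f + f') x = act f x + act f' x.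
Proof.
pose s := undup (msupp f ++ msupp f').
have us : uniq s by exact: undup_uniq.
have s1 : {subset msupp (f + f') <= s} by move=> m /msuppD_le; rewrite mem_undup.
have s2 : {subset msupp f <= s} by move=> m mf; rewrite mem_undup mem_cat mf.
have s3 : {subset msupp f' <= s} by move=> m mf; rewrite mem_undup mem_cat mf orbT.
rewrite (poly_act_sum _ us s1) (poly_act_sum _ us s2) (poly_act_sum _ us s3).
by rewrite -big_split/=; apply: eq_bigr => m _; rewrite mcoeffD scalerDl.
Qed.

Lemma poly_actZ c f x : act (c *: f) x = c *: act f x.
Proof.
have us := msupp_uniq f.
rewrite (poly_act_sum (s := msupp f) _ us) => [|m /msuppZ_le//].
rewrite (poly_act_sum (s := msupp f) _ us)//.
by rewrite scaler_sumr; apply: eq_bigr => m _; rewrite mcoeffZ scalerA.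
Qed.

Lemma poly_act0 x : act 0 x = 0.
Proof. by rewrite -(scale0r (0 : A)) poly_actZ scale0r. Qed.

Lemma poly_act_suml I (r : seq I) (P : pred I) (F : I -> A) x :
  act (\sum_(i <- r | P i) F i) x = \sum_(i <- r | P i) act (F i) x.
Proof. exact: (big_morph (act ^~ x) (fun f f' => poly_actD f f' x) (poly_act0 x)). Qed.

Lemma poly_act_linear f : linear (act f).
Proof.
move=> c x y; rewrite /poly_act scaler_sumr -big_split/=; apply: eq_bigr => m _.
by rewrite monomial_act_linear scalerDr !scalerA mulrC.
Qed.

Lemma poly_actX m x : act (mpolyX _ m) x = mact m x.
Proof. by rewrite /poly_act msuppX big_seq1 mcoeffX eqxx scale1r. Qed.

Lemma poly_act1 x : act 1 x = x.
Proof. by rewrite -mpolyX0 poly_actX monomial_act0. Qed.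

Lemma poly_actM f f' x : act (f * f') x = act f (act f' x).
Proof.
rewrite [RHS]/poly_act [f in LHS]mpolyE mulr_suml poly_act_suml.
apply: eq_bigr => m _; rewrite -scalerAl poly_actZ; congr (_ *: _).
rewrite [f' in LHS]mpolyE mulr_sumr poly_act_suml.
rewrite (linear_apply_sum _ _ _ (monomial_act_linear m)); apply: eq_bigr => m' _.
rewrite -scalerAr poly_actZ -mpolyXD poly_actX monomial_actD.
by rewrite (linear_applyZ _ _ (monomial_act_linear m)).
Qed.

Definition generated n (g : 'I_n -> H) (u : 'rV[A]_n) : H := \sum_i act (u 0 i) (g i).

Lemma generatedP n (g : 'I_n -> H) f u v :
  generated g (f *: u + v) = act f (generated g u) + generated g v.
Proof.
rewrite /generated (linear_apply_sum _ _ _ (poly_act_linear f)) -big_split/=.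
by apply: eq_bigr => i _; rewrite !mxE poly_actD poly_actM.
Qed.

Lemma generatedD n (g : 'I_n -> H) u v :
  generated g (u + v) = generated g u + generated g v.
Proof. by rewrite -{1}(scale1r u) generatedP poly_act1. Qed.

Lemma generated0 n (g : 'I_n -> H) : generated g 0 = 0.
Proof. by rewrite /generated big1// => i _; rewrite mxE poly_act0. Qed.

Lemma generatedZ n (g : 'I_n -> H) f u : generated g (f *: u) = act f (generated g u).
Proof. by rewrite -[f *: u]addr0 generatedP generated0 addr0. Qed.

Lemma generated_sum n (g : 'I_n -> H) I (r : seq I) (P : pred I) F :
  generated g (\sum_(i <- r | P i) F i) = \sum_(i <- r | P i) generated g (F i).
Proof. exact: (big_morph _ (generatedD g) (generated0 g)). Qed.

Lemma generated_delta n (g : 'I_n -> H) i : generated g (delta_mx 0 i) = g i.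
Proof.
rewrite /generated (bigD1 i)//= mxE !eqxx poly_act1 big1 ?addr0// => j /negPf ji.
by rewrite mxE eqxx ji poly_act0.
Qed.

End polynomial_action.

(** * Counting monomials *)

Section counting.

Lemma card_bmultinom d m : #|{: bmultinom d m.+1}| = 'C(d + m, d).
Proof.
rewrite -card_partial_ord_partitions.
pose F (u : bmultinom d m.+1) : d.-tuple 'I_m.+1 := [tuple inord ((u : multinom d) i) | i < d].
have small (u : bmultinom d m.+1) i : ((u : multinom d) i < m.+1)%N.
  apply: leq_ltn_trans (bmdeg u); rewrite mdegE (bigD1 i)//=.
  exact: leq_addr.
have Finj : injective F.
  move=> u v uv; apply/val_inj/mnmP => i /=.
  have := congr1 (fun t => nat_of_ord (tnth t i)) uv.
  by rewrite !tnth_mktuple !inordK// small.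
rewrite -cardsT -(card_imset _ Finj); apply: eq_card => t; rewrite !inE.
apply/imsetP/idP => [[u _ ->]|tm].
  rewrite big_tuple -ltnS; apply: leq_ltn_trans (bmdeg u).
  rewrite mdegE; apply: leq_sum => i _.
  by rewrite tnth_mktuple inordK// small.
have tS : (mdeg (Multinom [tuple nat_of_ord (tnth t i) | i < d]) < m.+1)%N.
  rewrite mdegE ltnS; apply: leq_trans tm; rewrite big_tuple.
  by apply: leq_sum => i _; rewrite multinomE tnth_mktuple.
exists (BMultinom tS) => //; apply: eq_from_tnth => i.
by rewrite tnth_mktuple /= multinomE tnth_mktuple inord_val.
Qed.

Lemma injective_card (K : fieldType) (I J : finType) (M : I -> J -> K) :
  (forall c : I -> K, (forall j, \sum_i c i * M i j = 0) -> forall i, c i = 0) ->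
  (#|I| <= #|J|)%N.
Proof.
move=> Minj; pose N := \matrix_(i < #|I|, j < #|J|) M (enum_val i) (enum_val j).
have Nfree : row_free N.
  rewrite -kermx_eq0; apply/eqP/row_matrixP => k; rewrite row0.
  set v := row k _; have vN : v *m N = 0 by apply/sub_kermxP; exact: row_sub.
  have v0 : forall i, v 0 (enum_rank i) = 0.
    apply: Minj => j; have := congr1 (fun u : 'rV_#|J| => u 0 (enum_rank j)) vN.
    rewrite /= !mxE => E; rewrite -[RHS]E (reindex_onto enum_val enum_rank)/=.
      apply: eq_big => [i|i _]; first by rewrite enum_valK eqxx.
      by rewrite enum_valK [N _ _]mxE enum_rankK.
    by move=> i _; exact: enum_rankK.
  by apply/rowP => i; rewrite [RHS]mxE -(enum_valK i) v0.
by rewrite -[X in (X <= _)%N](eqP Nfree); exact: rank_leq_col.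
Qed.

End counting.

(** * The Hilbert function and the generic rank *)

Section bounded_degree.
Context {K : fieldType} {d : nat}.
Local Notation A := (mpoly d K).

Definition degree_le b B (u : 'rV[A]_b) :=
  forall j m, mcoeff m (u 0 j) != 0 -> (mdeg m <= B)%N.

Lemma degree_leW b B B' (u : 'rV[A]_b) : (B <= B')%N -> degree_le B u -> degree_le B' u.
Proof. by move=> BB' uB j m /uB /leq_trans; apply. Qed.

Lemma degree_leD b B (u v : 'rV[A]_b) :
  degree_le B u -> degree_le B v -> degree_le B (u + v).
Proof.
move=> uB vB j m; rewrite mxE mcoeffD; have [->|/uB//] := eqVneq (mcoeff m (u 0 j)) 0.
by rewrite add0r => /vB.
Qed.

Lemma degree_le0 b B : degree_le B (0 : 'rV[A]_b).
Proof. by move=> j m; rewrite mxE mcoeff0 eqxx. Qed.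

Lemma degree_le_sum b B I (r : seq I) (P : pred I) (F : I -> 'rV[A]_b) :
  (forall i, P i -> degree_le B (F i)) -> degree_le B (\sum_(i <- r | P i) F i).
Proof.
by move=> FB; elim/big_ind : _ => //; [exact: degree_le0|exact: degree_leD].
Qed.

Lemma degree_leM b B a f (u : 'rV[A]_b) :
  (forall m, mcoeff m f != 0 -> (mdeg m <= a)%N) -> degree_le B u ->
  degree_le (a + B) (f *: u).
Proof.
move=> fa uB j m; rewrite mxE -mcoeff_msupp => /msuppM_le/allpairsP[[m1 m2]/=].
rewrite !mcoeff_msupp => -[/fa m1a /uB m2B ->].
by rewrite mdegD leq_add.
Qed.

Lemma degree_leX b B m (u : 'rV[A]_b) :
  degree_le B u -> degree_le (mdeg m + B) (mpolyX K m *: u).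
Proof.
move=> uB; apply: degree_leM => // k; rewrite mcoeffX.
by case: (eqVneq m k) => [->//|_]; rewrite eqxx.
Qed.

Lemma degree_leC b B c (u : 'rV[A]_b) : degree_le B u -> degree_le B (mpolyC d c *: u).
Proof.
move=> uB; rewrite -[B]add0n; apply: degree_leM => // k; rewrite mcoeffC.
by case: (eqVneq k (@mnm0 d)) => [->|_]; rewrite ?mdeg0// mulr0 eqxx.
Qed.

Lemma degree_le_ex (I : finType) b (u : I -> 'rV[A]_b) :
  exists B, forall i, degree_le B (u i).
Proof.
pose B i := projT1 (cid (row_bounded (u i))).
have BP i : forall c m, mcoeff m (u i 0 c) != 0 -> (mdeg m < B i)%N.
  exact: projT2 (cid (row_bounded (u i))).
exists (\sum_i B i)%N => i j m /BP /ltnW /leq_trans; apply.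
by rewrite (bigD1 i)//= leq_addr.
Qed.

Lemma mcoeff_bmultinom_sum B (c : bmultinom d B -> K) (m : bmultinom d B) :
  mcoeff m (\sum_a c a *: mpolyX K a) = c m.
Proof.
rewrite (raddf_sum (mcoeff m))/= (bigD1 m)//= mcoeffZ mcoeffX eqxx mulr1.
rewrite big1 ?addr0// => a am; rewrite mcoeffZ mcoeffX.
have [am'|_] := eqVneq (a : multinom d) (m : multinom d); last by rewrite mulr0.
by rewrite (val_inj am') eqxx in am.
Qed.

Lemma multinom_ind (P : multinom d -> Prop) :
  P (@mnm0 d) -> (forall i m, P m -> P (mnm_add (mnm1 i) m)) -> forall m, P m.
Proof.
move=> P0 PS m; have [k] := ubnP (mdeg m); elim: k m => // k IH m.
rewrite ltnS => mk; have [->//|m0] := eqVneq m (@mnm0 d).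
have [i mi] : exists i, m i != 0%N.
  apply/existsP; rewrite -negb_forall; apply: contra m0 => /forallP m0.
  by apply/eqP/mnmP => i; rewrite mnm0E; exact/eqP.
have mE : mnm_add (mnm1 i) (mnm_sub m (mnm1 i)) = m.
  by rewrite addmC submK// lep1mP.
rewrite -mE; apply/PS/IH; apply: leq_trans mk.
by rewrite -[in X in (_ < X)%N]mE mdegD mdeg1 add1n.
Qed.

End bounded_degree.

Section hilbert_function.
Context {R : realType} {H : completeNormedModType R[i]} {d : nat}.
Variable dot : {dot H for @Num.conj R[i]}.
Variable T : 'I_d -> {linear H -> H}.
Context {n : nat}.
Variables (g : 'I_n -> H) (w : 'I_n -> nat).
Variable Gamma : R[i] -> H -> H.
Hypothesis HM : contractive_hilbert_module dot T.
Hypothesis HG : gauge_group dot T Gamma.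
Variable N0 : int.
Hypothesis HN0 : forall n, gauge_spectrum Gamma n -> N0 <= n.
Hypothesis gw : forall i, weight_space Gamma N0 (w i) (g i).
Hypothesis gD : forall x,
  x - \sum_k T k (adjoint dot (T k) x) = \sum_i dot x (g i) *: g i.

Local Notation A := (mpoly d R[i]).
Local Notation act := (poly_act T).
Local Notation weight := (weight_space Gamma N0).
Local Notation W := (word_span T g w).
Let TC : forall j k x, T j (T k x) = T k (T j x) := module_commute HM.

Lemma word_span_subspace m : subspace (W m).
Proof. exact: lin_span_subspace. Qed.

Lemma word_spanW m m' : (m <= m')%N -> W m `<=` W m'.
Proof.
move=> mm'; apply: lin_span_min; first exact: lin_span_subspace.
move=> v [k km vk]; apply: lin_span_sub; exists k => //.
exact: leq_trans mm'.
Qed.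

Lemma word_span_T k m x : W m x -> W m.+1 (T k x).
Proof.
move: x; apply: lin_span_min.
  split; first by rewrite linear0; case: (word_span_subspace m.+1).
  by move=> c x y Wx Wy; rewrite linearP; case: (word_span_subspace m.+1) => _; apply.
move=> v [j jm vj]; apply: lin_span_sub; exists j.+1 => //=.
rewrite mem_cat; apply/orP; right; apply/allpairsP; exists (k, v).
by split=> //; rewrite mem_enum.
Qed.

Lemma word_span_act m B f x : (forall a, mcoeff a f != 0 -> (mdeg a <= B)%N) ->
  W m x -> W (B + m) (act f x).
Proof.
move=> fB Wx; have mono (a : multinom d) : W (mdeg a + m) (monomial_act T a x).
  move: a; apply: multinom_ind => [|i a IH]; first by rewrite mdeg0 (monomial_act0 T).
  rewrite (monomial_actD TC) (monomial_act1 T) mdegD mdeg1 add1n addSn.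
  exact: word_span_T.
rewrite /poly_act big_seq; apply: subspace_sum; first exact: word_span_subspace.
move=> a; rewrite mcoeff_msupp => /fB aB; apply: subspaceZ.
  exact: word_span_subspace.
by apply: word_spanW (mono a); rewrite leq_add2r.
Qed.

Lemma word_span_gen i : W (w i) (g i).
Proof.
apply: lin_span_sub; exists (w i) => //.
by case wm : (w i) => [|m] /=; rewrite mem_cat map_f// mem_filter mem_enum wm eqxx.
Qed.

Lemma word_span_generated (u : 'rV[A]_n) : exists m, W m (generated T g u).
Proof.
have [B uB] := row_bounded u.
exists (\sum_i (B + w i))%N; rewrite /generated; apply: subspace_sum.
  exact: word_span_subspace.
move=> i _; apply: (@word_spanW (B + w i)); first by rewrite (bigD1 i)//= leq_addr.
by apply: word_span_act (word_span_gen i) => a /uB /ltnW.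
Qed.

Lemma word_frame_generated m v : v \in word_frame T g w m ->
  exists2 u, degree_le m u & v = generated T g u.
Proof.
have gen m' i : exists2 u, degree_le m' u & g i = generated T g u.
  exists (delta_mx 0 i); last by rewrite (generated_delta T).
  move=> j a; rewrite mxE eqxx; case: (j == i) => /=; last first.
    by rewrite mulr0n mcoeff0 eqxx.
  rewrite mulr1n mcoeff1.
  by case: (eqVneq a (@mnm0 d)) => [->|_]; rewrite ?mdeg0// eqxx.
elim: m v => [|m IH] v /=; rewrite mem_cat => /orP[].
- by move=> /mapP[] i _ ->.
- by [].
- by move=> /mapP[] i _ ->.
move=> /allpairsP[[k v'] /= [_ /IH[u um ->] ->]].
exists (mpolyX _ (mnm1 k) *: u).
  by have := degree_leX (m := mnm1 k) um; rewrite mdeg1 add1n.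
by rewrite (generatedZ TC) (poly_actX T) (monomial_act1 T).
Qed.

(** ** The graded resolution *)

Lemma generated_submodule : submodule [set u : 'rV[A]_n | generated T g u = 0].
Proof.
split=> [|f u v /= u0 v0]; first exact: generated0.
by rewrite (generatedP TC) u0 v0 addr0 (linear_apply0 (poly_act_linear _ _)).
Qed.

Lemma weight_mact m a x : weight m x -> weight (mdeg a + m) (monomial_act T a x).
Proof.
move=> xm; move: a; apply: multinom_ind => [|i a IH]; first by rewrite mdeg0 (monomial_act0 T).
rewrite (monomial_actD TC) (monomial_act1 T) mdegD mdeg1 add1n addSn.
exact: (weight_T HG i IH).
Qed.

Lemma generated_wpart k (u : 'rV[A]_n) : weight k (generated T g (wpart w k u)).
Proof.
have sub : subspace (weight k) by exact: (weight_subspace HG).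
rewrite /generated; apply: subspace_sum => // i _.
rewrite /poly_act big_seq; apply: subspace_sum => // a.
rewrite mcoeff_msupp => /wpart_homog ak.
by apply: (subspaceZ _ sub); rewrite -ak; exact: weight_mact.
Qed.

Lemma generated_graded : graded w [set u : 'rV[A]_n | generated T g u = 0].
Proof.
move=> k u /= u0; have [B uE] := wpart_partition w u.
have [kB|Bk] := ltnP k B; last first.
  rewrite uE wpart_sum big1 ?(generated0 T)// => l _.
  by rewrite (homog_wpart k (@wpart_homog _ _ _ w l u)) gtn_eqF// (leq_trans _ Bk).
apply/eqP; rewrite -(dnorm_eq0 dot); apply/eqP.
transitivity (dot (generated T g (wpart w k u)) (generated T g u)); last first.
  by rewrite u0 dot0r.
rewrite [X in _ = dot _ (generated T g X)]uE (generated_sum TC) dot_sumr (bigD1 (Ordinal kB))//=.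
rewrite big1 ?addr0// => l lk.
apply: (weight_orthogonal HG _ (generated_wpart k u) (generated_wpart l u)).
by apply: contra lk => /eqP kl; apply/eqP/val_inj.
Qed.

Hypothesis gdefect : range (defect dot T) = lin_span (range g).

Lemma M_module_generated : M_module dot T = range (generated T g).
Proof.
apply/seteqP; split.
  apply: lin_span_min.
    split; first by exists 0 => //; exact: generated0.
    move=> c _ _ [u _ <-] [v _ <-]; exists (mpolyC d c *: u + v) => //.
    rewrite (generatedP TC); congr (_ + _).
    by rewrite -[mpolyC d c]mulr1 mul_mpolyC poly_actZ (poly_act1 T).
  move=> _ [f [xi ->]].
  have : lin_span (range g) (defect dot T xi) by rewrite -gdefect; exists xi.
  move=> /lin_span_range[c ->].
  exists (f *: \row_i mpolyC d (c i)) => //; rewrite (generatedZ TC); congr (act f _).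
  apply: eq_bigr => i _; rewrite mxE -[mpolyC d _]mulr1 mul_mpolyC poly_actZ.
  by rewrite (poly_act1 T).
move=> _ [u _ <-]; apply: subspace_sum; first exact: lin_span_subspace.
move=> i _; apply: lin_span_sub.
have [xi _ xiE] : range (defect dot T) (g i).
  by rewrite gdefect; apply: lin_span_sub; exists i.
by exists (u 0 i), xi; rewrite xiE.
Qed.

Lemma resolution_ex : (0 < d)%N -> exists N b eps phi,
  @free_resolution _ _ _ T (M_module dot T) N b eps phi.
Proof.
move=> d0.
pose s0 := Stage generated_submodule generated_graded.
have [s [G [s00 Gspan Gker Gdim]]] := graded_syzygies s0 d0.
have [eps epsP] : exists eps : 'rV[A]_(stage_dim (s 0%N)) -> H,
    [/\ forall u v, eps (u + v) = eps u + eps v,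
        forall f u, eps (f *: u) = act f (eps u),
        range eps = M_module dot T & stage_rel (s 0%N) = [set u | eps u = 0]].
  rewrite s00; exists (generated T g); split=> //.
  - exact: generatedD.
  - exact: (generatedZ TC).
  - by rewrite M_module_generated.
have [epsD epsZ epsM eps0] := epsP.
exists d.+1, (fun k => stage_dim (s k)), eps, (fun k => mulmxr (G k)).
have spanE k : range (mulmxr (G k)) = stage_rel (s k).
  rewrite -Gspan; apply/seteqP; split=> [u [f _ <-]|u [f ->]].
    by exists f.
  by exists f.
split=> //.
- by rewrite spanE eps0.
- by move=> k; rewrite spanE Gker.
Qed.

Section growth.
Context {N : nat} {b : nat -> nat} {eps : 'rV[A]_(b 0%N) -> H}
  {phi : forall k, {linear 'rV[A]_(b k.+1) -> 'rV[A]_(b k)}}.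
Hypothesis res : free_resolution T (M_module dot T) N eps phi.

Let P : 'M[A]_(b 1%N, b 0%N) := lin1_mx (phi 0%N).
Let rho := \rank (map_mx (@FracField.tofrac A) P).

Let spanP : mx_span P = [set u | eps u = 0].
Proof.
rewrite -(resolution_exact0 res); apply/seteqP; split=> [u [f ->]|_ [f _ <-]].
  by exists f => //; rewrite mul_rV_lin1.
by exists f; rewrite mul_rV_lin1.
Qed.

Let eps0 : eps 0 = 0.
Proof. by rewrite -(scale0r (0 : 'rV[A]_(b 0%N))) (resolution_scale res) (poly_act0 T). Qed.

Let eps_sum I (r : seq I) (Q : pred I) F :
  eps (\sum_(i <- r | Q i) F i) = \sum_(i <- r | Q i) eps (F i).
Proof. exact: (big_morph eps (resolution_add res) eps0). Qed.

Let epsC c u : eps (mpolyC d c *: u) = c *: eps u.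
Proof.
by rewrite (resolution_scale res) -[mpolyC d c]mulr1 mul_mpolyC poly_actZ (poly_act1 T).
Qed.

Lemma euler_sum : \sum_(k < N) (-1) ^+ k * (b k)%:Z = (b 0%N - rho)%N%:Z.
Proof.
apply: (@alternating_sum_rank _ b (fun k => lin1_mx (phi k))) => [k|].
  have E j : mx_span (lin1_mx (phi j)) = range (phi j).
    apply/seteqP; split=> [u [f ->]|_ [f _ <-]].
      by exists f => //; rewrite mul_rV_lin1.
    by exists f; rewrite mul_rV_lin1.
  rewrite E (resolution_exact res); apply/seteqP; split=> u.
    by move=> u0; apply: etrans u0; exact: mul_rV_lin1.
  by move=> u0; apply: etrans u0; apply/esym; exact: mul_rV_lin1.
exact: resolution_length res.
Qed.

(** Elements that are independent over the polynomials span free submodules. *)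
Lemma hilbert_lower : exists c, forall m B k (e : 'I_k -> H),
  orthonormal_basis dot (W m) e -> (B + c <= m)%N ->
  ((b 0%N - rho) * 'C(d + B, d) <= k)%N.
Proof.
have [E Eindep] := independent_mod_span P.
move: (b 0%N - _)%N E Eindep => r E Eindep.
have Ein i : exists m, W m (eps (row i E)).
  have : range eps (eps (row i E)) by exists (row i E).
  rewrite (resolution_onto res) M_module_generated => -[u _ <-].
  exact: word_span_generated.
pose c0 i := projT1 (cid (Ein i)).
have c0P i : W (c0 i) (eps (row i E)) by exact: projT2 (cid (Ein i)).
exists (\sum_i c0 i)%N => m B k e eW Bcm.
have Ec i : W (\sum_i c0 i)%N (eps (row i E)).
  by apply: word_spanW (c0P i); rewrite (bigD1 i)//= leq_addr.
rewrite -[k]card_ord -card_bmultinom -[X in (X * _)%N]card_ord -card_prod.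
pose v (x : 'I_r * bmultinom d B.+1) := mpolyX R[i] x.2 *: row x.1 E.
have vW x : W m (eps (v x)).
  rewrite /v (resolution_scale res); apply: word_spanW Bcm _ _.
  apply: word_span_act (Ec _) => a; rewrite mcoeffX.
  case: (eqVneq (x.2 : multinom d) a) => [<- _|_]; last by rewrite eqxx.
  by rewrite -ltnS bmdeg.
apply: (@injective_card _ _ _ (fun x j => dot (eps (v x)) (e j))) => c cM.
pose f : 'rV[A]_r := \row_i \sum_(a : bmultinom d B.+1) c (i, a) *: mpolyX R[i] a.
have fE : f *m E = \sum_x mpolyC d (c x) *: v x.
  transitivity (\sum_i \sum_a mpolyC d (c (i, a)) *: v (i, a)); last first.
    by rewrite pair_bigA; apply: eq_bigr => -[].
  rewrite mulmx_sum_row.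
  apply: eq_bigr => i _; rewrite mxE scaler_suml; apply: eq_bigr => a _.
  by rewrite /v scalerA mul_mpolyC.
have x0 : eps (f *m E) = 0.
  have fW : W m (eps (f *m E)).
    rewrite fE eps_sum; apply: subspace_sum; first exact: word_span_subspace.
    by move=> x _; rewrite epsC; apply: subspaceZ => //; exact: word_span_subspace.
  rewrite (orthonormal_basis_expand eW fW) big1// => j _.
  suff -> : dot (eps (f *m E)) (e j) = 0 by rewrite scale0r.
  rewrite fE eps_sum dot_suml.
  transitivity (\sum_x c x * dot (eps (v x)) (e j)); last exact: cM.
  apply: eq_bigr => x _; rewrite -(dotZl dot (c x) (eps (v x)) (e j)).
  exact: (congr1 (fun z => dot z (e j)) (epsC (c x) (v x))).
have f0 : f = 0 by apply: Eindep; rewrite spanP.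
move=> -[i a]; rewrite -(mcoeff_bmultinom_sum (fun a => c (i, a)) a).
have := congr1 (fun u : 'rV[A]_r => mcoeff a (u 0 i)) f0.
by rewrite /= !mxE mcoeff0.
Qed.

Lemma hilbert_upper : exists c c', forall m B k (e : 'I_k -> H),
  orthonormal_basis dot (W m) e -> (B + c' <= m + c)%N ->
  (k + rho * 'C(d + B, d) <= b 0%N * 'C(d + (m + c), d))%N.
Proof.
have [E [Erel Eindep]] := independent_in_span P.
have gen i : exists u, g i = eps u.
  have : range eps (g i).
    rewrite (resolution_onto res) M_module_generated; exists (delta_mx 0 i) => //.
    exact: generated_delta.
  by move=> [u _ <-]; exists u.
pose u i := projT1 (cid (gen i)).
have uP i : g i = eps (u i) by exact: projT2 (cid (gen i)).
have [c uc] := degree_le_ex u.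
have [c' Ec'] := degree_le_ex (fun i => row i E).
exists c, c' => m B k e eW Bm.
have lift x : W m x -> exists2 y, degree_le (m + c) y & x = eps y.
  move: x; apply: lin_span_min.
    split; first by exists 0; [exact: degree_le0|rewrite eps0].
    move=> a _ _ [y yB ->] [z zB ->]; exists (mpolyC d a *: y + z).
      by apply: degree_leD => //; exact: degree_leC.
    by rewrite (resolution_add res) epsC.
  move=> x [j jm /word_frame_generated[y yj ->]].
  exists (\sum_i y 0 i *: u i).
    apply: degree_le_sum => i _; apply: (@degree_leW _ _ _ (j + c)).
      by rewrite leq_add2r.
    by apply: degree_leM (uc i) => a /yj.
  rewrite eps_sum; apply: eq_bigr => i _.
  by rewrite (resolution_scale res) -uP.
pose y i := projT1 (cid2 (lift _ (orthonormal_basis_mem i eW))).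
have yB i : degree_le (m + c) (y i).
  by rewrite /y; case: cid2.
have yE i : e i = eps (y i) by rewrite /y; case: cid2.
rewrite -{1}[k]card_ord -{1}[rho]card_ord -[b 0%N]card_ord -!card_bmultinom.
rewrite -!card_prod -card_sum.
pose v (x : 'I_k + 'I_rho * bmultinom d B.+1) : 'rV[A]_(b 0%N) :=
  match x with inl i => y i | inr z => mpolyX R[i] z.2 *: row z.1 E end.
have vB x : degree_le (m + c) (v x).
  case: x => [i|z] /=; first exact: yB.
  apply: degree_leW (degree_leX (Ec' z.1)); apply: leq_trans Bm.
  by rewrite leq_add2r -ltnS bmdeg.
apply: (@injective_card _ _ _ (fun x (z : 'I_(b 0%N) * bmultinom d (m + c).+1) =>
  mcoeff z.2 (v x 0 z.1))) => a aM.
have v0 : \sum_x mpolyC d (a x) *: v x = 0.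
  apply: row_mpolyP => j t; rewrite [in RHS]mxE mcoeff0.
  have [tm|tm] := ltnP (mdeg t) (m + c).+1; last first.
    apply/eqP/negP => /negP /(degree_le_sum (fun x _ => degree_leC (c := a x) (@vB x))).
    by rewrite leqNgt tm.
  rewrite mcoeff_row_sum -[RHS](aM (j, BMultinom tm)); apply: eq_bigr => x _.
  by rewrite mxE mcoeffCM.
move: v0; rewrite big_sumType/= => v0.
have kerE (i : 'I_rho) : eps (row i E) = 0.
  by have := Erel i; rewrite spanP.
have a1 i : a (inl i) = 0.
  have : \sum_i a (inl i) *: e i = 0.
    have := congr1 eps v0; rewrite eps0 (resolution_add res) !eps_sum.
    rewrite [X in _ + X]big1 ?addr0 => [|z _]; last first.
      by rewrite epsC (resolution_scale res) kerE (linear_apply0 (poly_act_linear _ _)) scaler0.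
    move=> s0; apply: etrans s0; apply: eq_bigr => j _; rewrite yE.
    exact/esym/(epsC (a (inl j)) (y j)).
  move=> /(congr1 (dot ^~ (e i))); rewrite /= dot0l => <-.
  by rewrite dot_orthonormal_sum//; have [] := eW.
have {}v0 : \sum_z mpolyC d (a (inr z)) *: (mpolyX R[i] z.2 *: row z.1 E) = 0.
  rewrite -[RHS]v0 [X in _ = X + _]big1 ?add0r// => i _.
  by rewrite a1 mpolyC0 scale0r.
pose f : 'rV[A]_rho := \row_i \sum_(t : bmultinom d B.+1) a (inr (i, t)) *: mpolyX R[i] t.
have f0 : f = 0.
  apply: Eindep; rewrite -[RHS]v0 mulmx_sum_row.
  transitivity (\sum_i \sum_t mpolyC d (a (inr (i, t))) *: (mpolyX R[i] t *: row i E)); last first.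
    by rewrite pair_bigA; apply: eq_bigr => -[].
  apply: eq_bigr => i _; rewrite mxE scaler_suml; apply: eq_bigr => t _.
  by rewrite scalerA mul_mpolyC.
case=> [i|[i t]]; first exact: a1.
rewrite -(mcoeff_bmultinom_sum (fun t => a (inr (i, t))) t).
have := congr1 (fun z : 'rV[A]_rho => mcoeff t (z 0 i)) f0.
by rewrite /= !mxE mcoeff0.
Qed.

End growth.
End hilbert_function.

(** * Gaussian moments *)

Section gaussian_moments.
Context {R : realType}.
Local Notation mu := (@lebesgue_measure R).
Implicit Types (x a : R) (k : nat).

Definition gauss_pow k x : R := x ^+ k * gauss_fun x.

Lemma continuous_gauss_pow k : continuous (gauss_pow k).
Proof.
move=> x; apply: (@continuousM _ _ (fun x => x ^+ k) gauss_fun).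
  exact: exprn_continuous.
exact: continuous_gauss_fun.
Qed.

Lemma measurable_gauss_pow k : measurable_fun [set: measurableTypeR R] (gauss_pow k).
Proof. exact: continuous_measurable_fun (@continuous_gauss_pow k). Qed.

Lemma is_derive_gauss_pow k x : is_derive x 1 (gauss_pow k)
  (k%:R * gauss_pow k.-1 x - 2 * gauss_pow k.+1 x).
Proof.
have dg : is_derive x 1 (@gauss_fun R) (expR (- x ^+ 2) * (- (2 * x))).
  apply: (@is_derive1_comp _ expR (fun x : R => - x ^+ 2)).
  apply: is_derive_eq; rewrite /= /GRing.scale/= !mulr1.
  by rewrite -mulr2n mulr_natl.
have dk : is_derive x 1 (fun x : R => x ^+ k) (k%:R * x ^+ k.-1).
  apply: DeriveDef; first exact: exprn_derivable.
  by rewrite exp_derive /GRing.scale/= mulr1.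
have := is_deriveM dk dg; rewrite /GRing.scale/= => H.
apply: (is_derive_eq H); rewrite /gauss_pow /gauss_fun (exprS x k). ring.
Qed.

Lemma exp_power_bound k (y : R) : 0 <= y -> y ^+ k.+1 <= k.+1%:R ^+ k.+1 * expR y.
Proof.
move=> y0; rewrite -{2}[y](divfK (_ : k.+1%:R != 0))// ?pnatr_eq0//.
rewrite -[y in leLHS](divfK (_ : k.+1%:R != 0)) ?pnatr_eq0//.
rewrite exprMn mulrC (mulrC (y / _)) expRM_natl ler_wpM2l// ?exprn_ge0//.
rewrite lerXn2r ?nnegrE ?expR_ge0//; first by rewrite divr_ge0.
by rewrite (le_trans _ (expR_ge1Dx _))// lerDr.
Qed.

Lemma gauss_pow_tail k a : 1 <= a -> a ^+ k.+1 * gauss_fun a <= k.+1%:R ^+ k.+1 / a.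
Proof.
move=> a1; have a0 : 0 < a by exact: lt_le_trans ltr01 a1.
have ey := exp_power_bound k (sqr_ge0 a).
rewrite /gauss_fun expRN ler_pdivlMr// -mulrA (mulrC _^-1) mulrA.
rewrite ler_pdivrMr ?expR_gt0//; apply: le_trans ey.
by rewrite -exprSr -exprM ler_weXn2l//; lia.
Qed.

Local Notation I n := (`[(- n.+1%:R : R), (n.+1%:R : R)]%classic : set (measurableTypeR R)).

Lemma gauss_pow_FTC k n :
  k%:R * \int[mu]_(x in I n) gauss_pow k.-1 x -
    2 * \int[mu]_(x in I n) gauss_pow k.+1 x =
  gauss_pow k n.+1%:R - gauss_pow k (- n.+1%:R).
Proof.
have ab : - n.+1%:R < n.+1%:R :> R by rewrite gtrN.
have int j : mu.-integrable (I n) (EFin \o gauss_pow j).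
  apply: continuous_compact_integrable; first exact: segment_compact.
  by apply: continuous_subspaceT; exact: continuous_gauss_pow.
have cZ (c : R) j : continuous (fun x => c * gauss_pow j x).
  by move=> x; apply: cvgM; [exact: cvg_cst|exact: continuous_gauss_pow].
have intZ (c : R) j : mu.-integrable (I n) (EFin \o (fun x => c * gauss_pow j x)).
  apply: continuous_compact_integrable; first exact: segment_compact.
  by apply: continuous_subspaceT; exact: cZ.
pose f x := k%:R * gauss_pow k.-1 x - 2 * gauss_pow k.+1 x.
have fE : (\int[mu]_(x in I n) (f x)%:E =
    (gauss_pow k n.+1%:R)%:E - (gauss_pow k (- n.+1%:R))%:E)%E.
  apply: continuous_FTC2 => //.
  - by apply: continuous_subspaceT => x; apply: cvgB; exact: cZ.
  - split.
    + by move=> x _; have [] := is_derive_gauss_pow k x.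
    + exact/cvg_at_right_filter/continuous_gauss_pow.
    + exact/cvg_at_left_filter/continuous_gauss_pow.
  - by move=> x _; rewrite derive1E; have [_ ->] := is_derive_gauss_pow k x.
by rewrite -!RintegralZl// -RintegralB// /Rintegral fE.
Qed.

(** Half of the exponent is enough to absorb the power, which leaves a
    multiple of the standard normal density. *)
Lemma integrable_gauss_pow k : mu.-integrable setT (EFin \o gauss_pow k).
Proof.
pose c : R := 1 + k.+1%:R ^+ k.+1 * 2 ^+ k.+1.
have c0 : 0 <= c by rewrite addr_ge0// mulr_ge0// exprn_ge0.
pose p : R := normal_peak 1.
have p0 : 0 < p by rewrite normal_peak_gt0// oner_eq0.
have cint : mu.-integrable setT (fun x : R => ((c / p)%:E * (normal_pdf 0 1 x)%:E)%E).
  exact/integrableZl/integrable_normal_pdf.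
apply: (le_integrable measurableT _ _ cint).
  by apply/measurable_EFinP; exact: measurable_gauss_pow.
move=> x _; rewrite /= lee_fin normal_pdfE ?oner_eq0// -/p.
rewrite mulrA divfK ?gt_eqF// /normal_fun subr0 expr1n.
rewrite [leRHS]ger0_norm ?mulr_ge0 ?expR_ge0// normrM normrX.
rewrite (ger0_norm (expR_ge0 _)) /gauss_fun.
pose h := x ^+ 2 / 2.
have -> : - x ^+ 2 / (1 *+ 2) = - h by rewrite /h mulNr.
have -> : - x ^+ 2 = - h + - h by rewrite /h; field.
rewrite expRD mulrA ler_wpM2r ?expR_ge0// expRN ler_pdivrMr ?expR_gt0//.
have h0 : 0 <= h by rewrite divr_ge0// sqr_ge0.
have e1 : 1 <= expR h by rewrite (le_trans _ (expR_ge1Dx _))// lerDl.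
have : `|x| ^+ k <= 1 + (2 * h) ^+ k.+1.
  have -> : 2 * h = `|x| ^+ 2 by rewrite real_normK ?num_real// /h; field.
  have [x1|x1] := leP `|x| 1.
    apply: le_trans (exprn_ile1 k (normr_ge0 x) x1) _.
    by rewrite lerDl exprn_ge0// exprn_ge0.
  rewrite (le_trans (y := `|x| ^+ 2 ^+ k.+1)) ?lerDr// -exprM.
  by rewrite ler_weXn2l ?ltW//; lia.
move/le_trans; apply; rewrite /c [leRHS]mulrDl mul1r lerD// exprMn.
by rewrite mulrAC mulrC ler_wpM2r ?exprn_ge0// exp_power_bound.
Qed.

Definition gauss_moment k : R := \int[mu]_x gauss_pow k x.

Lemma gauss_moment_trunc k :
  (\int[mu]_(x in I n) gauss_pow k x) @[n --> \oo] --> gauss_moment k.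
Proof.
have mI n : measurable (I n) by exact: measurable_itv.
have mT : measurable_fun setT (EFin \o gauss_pow k).
  by apply/measurable_EFinP; exact: measurable_gauss_pow.
have ig := integrable_gauss_pow k.
suff [_ _] : [/\ mu.-integrable setT (EFin \o gauss_pow k),
  [sequence (\int[mu]_x (`|((EFin \o gauss_pow k) \_ (I n)) x - (EFin \o gauss_pow k) x|)%E)%E]_n @ \oo --> 0%E &
  [sequence (\int[mu]_x ((EFin \o gauss_pow k) \_ (I n)) x)%E]_n @ \oo
    --> (\int[mu]_x (EFin \o gauss_pow k) x)%E].
  move=> cv; apply: fine_cvg; rewrite /gauss_moment /Rintegral fineK; last first.
    exact: integrable_fin_num.
  by under eq_fun do rewrite integral_mkcond.
apply: (@dominated_convergence _ _ R mu setT measurableT _ _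
  (abse \o (EFin \o gauss_pow k))) => //.
- by move=> n; apply/(measurable_restrictT _ (mI n)); exact: measurable_funTS.
- apply: aeW => x _ /=; apply: cvg_near_cst.
  exists (Num.Def.archi_bound `|x|) => // n /= xn.
  rewrite patchE mem_set//= in_itv/=.
  rewrite -ler_norml (le_trans (ltW (archi_boundP (normr_ge0 x))))//.
  by rewrite ler_nat leqW.
- exact: integrable_abse.
- apply: aeW => x n _ /=; rewrite patchE; case: ifP => // _.
  by rewrite abse0 lee_fin.
Qed.

Lemma gauss_pow_boundary k : gauss_pow k n.+1%:R @[n --> \oo] --> (0 : R).
Proof.
have cC : (k.+1%:R ^+ k.+1 * harmonic n : R) @[n --> \oo] --> (0 : R).
  by rewrite -(mulr0 (k.+1%:R ^+ k.+1)); apply: cvgM; [exact: cvg_cst|exact: cvg_harmonic].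
apply: (squeeze_cvgr _ (cvg_cst 0) cC); near=> n.
have n1 : 1 <= n.+1%:R :> R by rewrite ler1n.
rewrite mulr_ge0 ?exprn_ge0 ?expR_ge0//= (le_trans _ (gauss_pow_tail k n1))//.
by rewrite ler_wpM2r ?expR_ge0// ler_weXn2l.
Unshelve. all: by end_near. Qed.

Lemma gauss_pow_opp k x : gauss_pow k (- x) = (-1) ^+ k * gauss_pow k x.
Proof. by rewrite /gauss_pow /gauss_fun sqrrN (exprNn x) mulrA. Qed.

Lemma gauss_moment_step k : 2 * gauss_moment k.+1 = k%:R * gauss_moment k.-1.
Proof.
apply/esym/eqP; rewrite -subr_eq0; apply/eqP.
have c1 : (k%:R * (\int[mu]_(x in I n) gauss_pow k.-1 x) -
    2 * (\int[mu]_(x in I n) gauss_pow k.+1 x)) @[n --> \oo] -->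
    k%:R * gauss_moment k.-1 - 2 * gauss_moment k.+1.
  by apply: cvgB; (apply: cvgM; [exact: cvg_cst|exact: gauss_moment_trunc]).
have c2 : (gauss_pow k n.+1%:R - (-1) ^+ k * gauss_pow k n.+1%:R) @[n --> \oo]
    --> (0 - (-1) ^+ k * 0 : R).
  apply: cvgB; first exact: gauss_pow_boundary.
  by apply: cvgM; [exact: cvg_cst|exact: gauss_pow_boundary].
rewrite mulr0 subr0 in c2; apply: (cvg_unique _ c1) => //.
apply: cvg_trans c2; apply: near_eq_cvg; apply: nearW => n.
by rewrite gauss_pow_FTC gauss_pow_opp.
Qed.

Lemma gauss_moment0 : gauss_moment 0 = Num.sqrt pi.
Proof.
rewrite -[RHS]/(fine (Num.sqrt pi)%:E) -integralT_gauss.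
by apply: eq_Rintegral => x _; rewrite /gauss_pow mul1r.
Qed.

Lemma gauss_moment0_gt0 : 0 < gauss_moment 0.
Proof. by rewrite gauss_moment0 sqrtr_gt0 pi_gt0. Qed.

End gaussian_moments.

(** * Integrals of products over tuples *)

Section product_integrals.
Context d1 d2 (T1 : measurableType d1) (T2 : measurableType d2) (R : realType).
Variables (m1 : {sigma_finite_measure set T1 -> \bar R})
  (m2 : {sigma_finite_measure set T2 -> \bar R}).
Variables (f : T1 -> R) (g : T2 -> R).
Hypotheses (intf : m1.-integrable setT (EFin \o f))
  (intg : m2.-integrable setT (EFin \o g)).

Let h (z : T1 * T2) : \bar R := (f z.1 * g z.2)%:E.

Lemma integrable_tensor : (m1 \x m2)%E.-integrable setT h.
Proof.
have mf := measurable_int _ intf; have mg := measurable_int _ intg.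
have maf : measurable_fun setT (fun x => `|f x|%:E).
  exact: (measurableT_comp (@abse_measurable R setT) mf).
have mag : measurable_fun setT (fun x => `|g x|%:E).
  exact: (measurableT_comp (@abse_measurable R setT) mg).
apply/integrable12ltyP.
  rewrite (_ : h = fun z => ((EFin \o f) z.1 * (EFin \o g) z.2)%E) //.
  by apply: emeasurable_funM; exact: measurableT_comp.
have [_ foo] := integrableP _ _ _ intf; have [_ goo] := integrableP _ _ _ intg.
under eq_integral => x _.
  under eq_integral => y _ do rewrite /h /= normrM EFinM.
  rewrite ge0_integralZl//.
  over.
rewrite ge0_integralZr//; last by apply: integral_ge0 => y _; rewrite lee_fin.
by apply: lte_mul_pinfty; rewrite ?integral_ge0// ge0_fin_numE// integral_ge0.
Qed.

Lemma integral_tensor :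
  (\int[(m1 \x m2)%E]_z h z = (\int[m1]_x f x * \int[m2]_y g y)%:E)%E.
Proof.
rewrite -(integral12_prod_meas1 integrable_tensor) /fubini_F.
under eq_integral => x _.
  under eq_integral => y _ do rewrite /h /= EFinM.
  rewrite integralZl// -[(\int[_]_ _ _)%E](fineK (integrable_fin_num measurableT intg)).
  over.
rewrite integralZr// EFinM; congr (_ * _)%E.
by rewrite fineK// integrable_fin_num.
Qed.

End product_integrals.

Section tuple_integrals.
Context d (T : measurableType d) (R : realType).
Variable mu : {sigma_finite_measure set T -> \bar R}.

(** The integral of a product of functions of separate coordinates, by
    induction on the number of coordinates. *)
Lemma tuple_integral_prod n (f : 'I_n -> T -> R) :
  (forall i, mu.-integrable setT (EFin \o f i)) ->
  (tuple_measure mu n).-integrable setT (fun t => (\prod_i f i (tnth t i))%:E) /\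
  (\int[tuple_measure mu n]_t (\prod_i f i (tnth t i))%:E =
    (\prod_i \int[mu]_x f i x)%:E)%E.
Proof.
elim: n f => [|n IH] f intf.
  have -> : (fun t : 0.-tuple T => (\prod_i f i (tnth t i))%:E) = cst 1%E.
    by apply/funext => t; rewrite big_ord0.
  have i1 : (\int[tuple_measure mu 0]_t cst 1%E t)%E = 1%E.
    by rewrite integral_cst//= diracT mule1.
  rewrite i1 big_ord0; split => //; apply/integrableP; split => //.
  by under eq_integral do rewrite /= normr1; rewrite i1 ltry.
have [ig eg] := IH (fun i => f (lift ord0 i)) (fun i => intf _).
pose h (t : n.+1.-tuple T) := (\prod_i f i (tnth t i))%:E.
have hE p : h (tuple_cons p) =
    (f ord0 p.1 * \prod_i f (lift ord0 i) (tnth p.2 i))%:E.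
  rewrite /h big_ord_recl tnth0; congr ((_ * _)%:E).
  by apply: eq_bigr => i _; rewrite tnthS.
have mh : measurable_fun setT h.
  apply/measurable_EFinP; apply: measurable_prod => i _.
  apply: (measurableT_comp (f := f i)); last exact: measurable_tnth.
  by apply/measurable_EFinP; exact: measurable_int (intf i).
have ih : (mu \x tuple_measure mu n)%E.-integrable setT (h \o @tuple_cons _ T n).
  rewrite (_ : _ \o _ = fun p => (f ord0 p.1 *
      \prod_i f (lift ord0 i) (tnth p.2 i))%:E).
    exact: (integrable_tensor (intf ord0) ig).
  by apply/funext => p; exact: hE.
have mc := @measurable_tuple_cons _ T n.
split; first exact: (integrable_pushforward mc mh ih measurableT).
have := integral_pushforward mc mh ih measurableT.
rewrite preimage_setT => -> /=.
rewrite big_ord_recl EFinM.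
under eq_integral do rewrite hE.
rewrite (integral_tensor (intf ord0) ig) EFinM; congr (_ * _)%E.
by rewrite /Rintegral eg.
Qed.

End tuple_integrals.

(** * Polar coordinates *)

Section lebesgue_scaling.
Context {R : realType}.
Local Notation mu := (@lebesgue_measure R).
Local Notation RR := (measurableTypeR R).
Variable s : R.
Hypothesis s0 : 0 < s.

Let mulm : measurable_fun [set: RR] (fun x : RR => s * x : RR).
Proof. exact: measurable_funM. Qed.

Let sng : {nonneg R} := NngNum (ltW s0).

Let scaled : {measure set RR -> \bar R} :=
  mscale sng (measure_function_pushforward__canonical__measure_function_Measure
     mu mulm).

Lemma lebesgue_measure_scale (A : set RR) : measurable A -> scaled A = mu A.
Proof.
move=> mA; apply/esym/lebesgue_measure_unique => // _ [[a b]] _ <- /=.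
rewrite /mscale/= /pushforward.
rewrite (_ : _ @^-1` _ = `]a / s, b / s]%classic); last first.
  apply/seteqP; split => x /=; rewrite !in_itv/= ltr_pdivrMr// ler_pdivlMr//;
  by rewrite (mulrC x).
rewrite -/(lebesgue_measure _) !lebesgue_measure_itv/= !lte_fin.
rewrite ltr_pM2r ?invr_gt0//; case: ifP => _; last by rewrite mule0.
rewrite -!EFinB -EFinM; congr EFin.
by rewrite -mulrBl mulrC divfK// gt_eqF.
Qed.

Lemma ge0_integral_scale (f : RR -> \bar R) : measurable_fun setT f ->
  (forall x, 0 <= f x)%E ->
  (s%:E * \int[mu]_x f (s * x)%R = \int[mu]_x f x)%E.
Proof.
move=> mf f0; rewrite [RHS](eq_measure_integral scaled); last first.
  by move=> A mA _; exact/esym/lebesgue_measure_scale.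
rewrite /scaled ge0_integral_mscale//; congr (_ * _)%E.
by rewrite (ge0_integral_pushforward mulm)//= => x; rewrite inE.
Qed.

End lebesgue_scaling.

Section polar.
Context {R : realType}.
Local Notation mu := (@lebesgue_measure R).
Local Notation RR := (measurableTypeR R).
Local Notation Rn n := (n.-tuple RR).
Local Notation leb n := (@lebesgue_tuple R n).
Implicit Types n : nat.

Definition scale_tuple n (s : R) (x : Rn n) : Rn n :=
  [tuple s * (tnth x i : R) | i < n].

Lemma measurable_scale_tuple n s : measurable_fun setT (@scale_tuple n s).
Proof.
apply/measurable_fun_tnthP => i.
rewrite (_ : _ \o _ = (fun x : Rn n => s * (tnth x i : R))).
  by apply: measurable_funM => //; exact: measurable_tnth.
by apply/funext => x /=; rewrite tnth_mktuple.
Qed.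

Lemma scale_tuple_cons n s (x : RR) (t : Rn n) :
  scale_tuple s (tuple_cons (x, t)) = tuple_cons (s * x : RR, scale_tuple s t).
Proof.
apply: eq_from_tnth => i; rewrite tnth_mktuple.
case: (unliftP ord0 i) => [j ->|->]; last by rewrite !tnth0.
by rewrite !tnthS tnth_mktuple.
Qed.

Lemma lebesgue_tuple_scale n s (A : set (Rn n)) : 0 < s -> measurable A ->
  ((s ^+ n)%:E * leb n (scale_tuple s @^-1` A) = leb n A)%E.
Proof.
move=> s0; elim: n A => [|n IH] A mA.
  rewrite expr0 mul1e; congr (leb 0 _); apply/seteqP.
  by split => x; rewrite /preimage/= (tuple0 (scale_tuple s x)) (tuple0 x).
pose B := @tuple_cons _ RR n @^-1` A.
have mB : measurable B.
  by rewrite -[B]setTI; exact: measurable_tuple_cons.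
have mS : measurable (scale_tuple s @^-1` A).
  by rewrite -[X in measurable X]setTI; exact: measurable_scale_tuple.
rewrite /= /cons_measure /pushforward -/B.
rewrite /product_measure1.
have -> : (\int[mu]_x (leb n \o xsection B) x =
    s%:E * \int[mu]_x (leb n \o xsection B) (s * x)%R)%E.
  rewrite (ge0_integral_scale s0)//.
  exact: measurable_fun_xsection.
rewrite exprS EFinM -muleA; congr (_ * _)%E.
rewrite -ge0_integralZl//; last 2 first.
- apply: measurable_fun_xsection.
  by rewrite -[X in measurable X]setTI; exact: measurable_tuple_cons.
- by rewrite lee_fin exprn_ge0// ltW.
apply: eq_integral => x _ /=; rewrite -[RHS]IH; last exact: measurable_xsection.
congr (_ * leb n _)%E; apply/seteqP; split => t.
  by rewrite /xsection/= !inE /preimage/= scale_tuple_cons.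
by rewrite /xsection/= !inE /preimage/= scale_tuple_cons.
Qed.

Lemma enorm_ge0 n (x : Rn n) : 0 <= enorm x.
Proof. exact: sqrtr_ge0. Qed.

Lemma enorm_scale n s (x : Rn n) : 0 < s -> enorm (scale_tuple s x) = s * enorm x.
Proof.
move=> s0; rewrite /enorm.
under eq_bigr do rewrite tnth_mktuple exprMn.
by rewrite -mulr_sumr sqrtrM ?sqr_ge0// sqrtr_sqr gtr0_norm.
Qed.

Lemma normalize_scale n s (x : Rn n) : 0 < s ->
  normalize (scale_tuple s x) = normalize x.
Proof.
move=> s0; apply: eq_from_tnth => i; rewrite !tnth_mktuple enorm_scale//.
by rewrite invfM mulrACA divff ?mul1r// gt_eqF.
Qed.

Lemma enorm_eq0 n (x : Rn n) : enorm x = 0 -> forall i, tnth x i = 0 :> R.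
Proof.
move/eqP; rewrite sqrtr_eq0 => x0 i.
have : \sum_(j < n) (tnth x j : R) ^+ 2 == 0.
  by rewrite eq_le x0/= sumr_ge0// => j _; exact: sqr_ge0.
rewrite psumr_eq0 => [/allP/(_ i)|j _]; last exact: sqr_ge0.
by rewrite mem_index_enum sqrf_eq0 => /(_ isT)/eqP.
Qed.

Lemma enorm_normalize n (x : Rn n) : enorm x != 0 -> enorm (normalize x) = 1.
Proof.
move=> x0; have xp : 0 < enorm x by rewrite lt_def x0 enorm_ge0.
rewrite -(mulVf x0) -enorm_scale ?invr_gt0//; congr enorm.
by apply: eq_from_tnth => i; rewrite !tnth_mktuple mulrC.
Qed.

Lemma sqr_enorm n (x : Rn n) : enorm x ^+ 2 = \sum_(i < n) (tnth x i : R) ^+ 2.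
Proof. by rewrite sqr_sqrtr// sumr_ge0// => i _; exact: sqr_ge0. Qed.

End polar.

Section radial.
Context {R : realType} (n : nat).
Local Notation mu := (@lebesgue_measure R).
Local Notation Rn := (n.-tuple (measurableTypeR R)).
Local Notation leb := (@lebesgue_tuple R n).
Local Notation vol := (leb (@eball R n)).
Local Notation sigma := (@surface_measure R n).

Definition gaussian (x : Rn) : R := \prod_(i < n) gauss_fun (tnth x i : R).

Lemma gaussianE x : gaussian x = expR (- enorm x ^+ 2).
Proof. by rewrite sqr_enorm -sumrN expR_sum. Qed.

Lemma gaussian_integral : leb.-integrable setT (EFin \o gaussian) /\
  (\int[leb]_x (gaussian x)%:E = (@gauss_moment R 0 ^+ n)%:E)%E.
Proof.
have g0 : mu.-integrable setT (EFin \o @gauss_fun R) by exact: integrableT_gauss.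
have [i1 ->] := tuple_integral_prod (fun _ : 'I_n => g0); split => //.
rewrite big_const_ord iter_mulr_1; congr ((_ ^+ _)%:E).
by apply: eq_Rintegral => x _; rewrite /gauss_pow mul1r.
Qed.

Lemma vol_lty : (vol < +oo)%E.
Proof.
have [ig eg] := gaussian_integral.
have mg : measurable_fun setT (EFin \o gaussian) := measurable_int _ ig.
have mb := @measurable_eball R n.
have g0 x : (0 <= (gaussian x)%:E)%E by rewrite lee_fin gaussianE expR_ge0.
have h : (vol <= \int[leb]_(x in @eball R n) ((expR 1)%:E * (gaussian x)%:E))%E.
  rewrite -[vol]mul1e -integral_cst//; apply: ge0_le_integral => //.
  - by apply: measurable_funeM; exact: measurable_funTS.
  - move=> x xb; rewrite gaussianE -EFinM -expRD lee_fin -[leLHS]expR0 ler_expR.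
    by rewrite subr_ge0 expr_le1 ?enorm_ge0// ltW.
apply: le_lt_trans h _; rewrite ge0_integralZl ?lee_fin ?expR_ge0//; last exact: measurable_funTS.
rewrite lte_mul_pinfty ?lee_fin ?expR_ge0//.
apply: (@le_lt_trans _ _ (\int[leb]_x (gaussian x)%:E)%E); last by rewrite eg ltry.
exact: ge0_subset_integral.
Qed.

Lemma measurable_enorm_lt (s : R) : measurable [set x : Rn | enorm x < s].
Proof.
have := measurable_fun_ltr (@measurable_enorm R n) (measurable_cst s).
move=> /(_ measurableT [set true] I); rewrite setTI.
by congr measurable; apply/seteqP; split => x.
Qed.

Lemma cone_ball (E : set Rn) (s : R) : 0 < s -> measurable E ->
  leb (@normalize R n @^-1` E `&` [set x | enorm x < s]) =
  ((s ^+ n)%:E * leb (@normalize R n @^-1` E `&` @eball R n))%E.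
Proof.
move=> s0 mE; rewrite -(lebesgue_tuple_scale s0); last first.
  apply: measurableI.
    by rewrite -[X in measurable X]setTI; exact: measurable_normalize.
  exact: measurable_enorm_lt.
congr (_ * leb _)%E; apply/seteqP; split => x /=;
  by rewrite /preimage/= normalize_scale// /eball/= enorm_scale// gtr_pMr.
Qed.

Lemma ball_volume (s : R) : 0 < s -> leb [set x | enorm x < s] = ((s ^+ n)%:E * vol)%E.
Proof.
by move=> s0; have := cone_ball s0 measurableT; rewrite preimage_setT !setTI.
Qed.

Lemma vol_gt0 : (0 < vol)%E.
Proof.
rewrite lt_def measure_ge0 andbT; apply/eqP => v0.
have [_ eg] := gaussian_integral.
have : (leb setT = 0)%E.
  have -> : setT = \bigcup_k [set x : Rn | enorm x < k.+1%:R].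
    apply/esym/seteqP; split => // x _.
    exists (Num.Def.archi_bound (enorm x)) => //=.
    by rewrite (lt_trans (archi_boundP (enorm_ge0 _)))// ltr_nat.
  have mk k : measurable [set x : Rn | enorm x < k.+1%:R] by exact: measurable_enorm_lt.
  apply: measure_negligible; first exact: bigcupT_measurable.
  apply: negligible_bigcup => k; apply/(negligibleP _ (mk k)).
  have := ball_volume (ltr0Sn R k); rewrite v0 mule0; exact.
have [ig _] := gaussian_integral.
move=> l0; have : (\int[leb]_x (gaussian x)%:E = 0)%E.
  by apply: null_set_integral => //; exact: measurable_int ig.
rewrite eg => /eqP; rewrite eqe expf_eq0 gt_eqF ?andbF//.
exact: gauss_moment0_gt0.
Qed.

Lemma vol_fin : vol = (fine vol)%:E.
Proof. by rewrite fineK// ge0_fin_numE ?vol_lty. Qed.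

Lemma fine_vol_gt0 : 0 < fine vol.
Proof. by rewrite fine_gt0// vol_gt0 vol_lty. Qed.


Let surface_fin : fin_num_fun sigma.
Proof.
move=> E mE; rewrite /surface_measure vol_fin /= ge0_fin_numE; last first.
  by rewrite mule_ge0// lee_fin invr_ge0 ltW// fine_vol_gt0.
rewrite lte_mul_pinfty ?lee_fin ?invr_ge0 ?ltW ?fine_vol_gt0//.
apply: le_lt_trans vol_lty; apply: le_measure; rewrite ?inE//.
  apply: measurableI; last exact: measurable_eball.
  by rewrite -[X in measurable X]setTI; exact: measurable_normalize.
exact: measurable_eball.
Qed.

HB.instance Definition _ := Measure_isFinite.Build _ _ _ sigma surface_fin.

Definition radial_measure : set R -> \bar R := pushforward leb (@enorm R n).

HB.instance Definition _ := measure_function.Measure.copy radial_measure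
  (measure_function_pushforward__canonical__measure_function_Measure
     leb (@measurable_enorm R n)).

Let radial_sigma_finite : sigma_finite setT radial_measure.
Proof.
exists (fun k => `]-oo, k.+1%:R[%classic).
  apply/esym/seteqP; split => // x _; exists (Num.Def.archi_bound `|x|) => //=.
  rewrite in_itv/= (le_lt_trans (ler_norm x))//.
  by rewrite (lt_trans (archi_boundP (normr_ge0 _)))// ltr_nat.
move=> k; split; first exact: measurable_itv.
rewrite /radial_measure/= /pushforward.
have -> : @enorm R n @^-1` `]-oo, k.+1%:R[ = [set x | enorm x < k.+1%:R].
  by apply/seteqP; split => x /=; rewrite in_itv.
by rewrite ball_volume// vol_fin -EFinM ltry.
Qed.

HB.instance Definition _ := Measure_isSigmaFinite.Build _ _ _
  radial_measure radial_sigma_finite.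

Section cone.
Variable E : set Rn.
Hypothesis mE : measurable E.

Let mnE : measurable (@normalize R n @^-1` E).
Proof. by rewrite -[X in measurable X]setTI; exact: measurable_normalize. Qed.

Let c : R := fine (sigma E).
Let c0 : 0 <= c. Proof. by rewrite fine_ge0. Qed.

Let m1 : {measure set R -> \bar R} :=
  measure_function_pushforward__canonical__measure_function_Measure
    (mrestr leb mnE) (@measurable_enorm R n).
Let m2 : {measure set R -> \bar R} := mscale (NngNum c0) radial_measure.

(** Both sides are measures in [B], and they agree on half-lines by the scaling
    of Lebesgue measure. *)
Lemma cone_measure (B : set R) : measurable B ->
  leb (@normalize R n @^-1` E `&` @enorm R n @^-1` B) =
  (sigma E * radial_measure B)%E.
Proof.
have cE : (sigma E = c%:E)%E by rewrite fineK// surface_fin.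
have lt s : m1 `]-oo, s[%classic = m2 `]-oo, s[%classic.
  have eE : @enorm R n @^-1` `]-oo, s[ = [set x | enorm x < s].
    by apply/seteqP; split => x /=; rewrite in_itv.
  rewrite /m1 /m2 /= /mscale/= /radial_measure /pushforward /mrestr eE setIC.
  have [s0|s0] := leP s 0.
    have -> : [set x : Rn | enorm x < s] = set0.
      apply/seteqP; split => x //= xs.
      by have := lt_le_trans xs s0; rewrite ltNge enorm_ge0.
    by rewrite setI0 !measure0 mule0.
  rewrite cone_ball// ball_volume// -cE /surface_measure.
  rewrite [RHS]muleCA; congr (_ * _)%E.
  by rewrite muleAC vol_fin/= -EFinM mulVf ?mul1e// gt_eqF// fine_vol_gt0.
move=> mB; rewrite cE.
have -> : leb (@normalize R n @^-1` E `&` @enorm R n @^-1` B) = m1 B.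
  by rewrite /m1 /= /pushforward /mrestr setIC.
apply: (@measure_unique _ R R _ (fun k => `]-oo, k.+1%:R[%classic)
   (RGenInftyO.measurableE R) _ _ _ m1 m2) => //.
- move=> _ _ [x ->] [y ->]; exists (Num.min x y).
  by apply/seteqP; split => z /=; rewrite !in_itv/= lt_min => /andP.
- by move=> k; exists k.+1%:R.
- apply/seteqP; split => // x _; exists (Num.Def.archi_bound `|x|) => //=.
  rewrite in_itv/= (le_lt_trans (ler_norm x))//.
  by rewrite (lt_trans (archi_boundP (normr_ge0 _)))// ltr_nat.
- by move=> _ [x ->].
- move=> k; rewrite lt /m2/= /mscale/= /radial_measure /pushforward.
  have -> : @enorm R n @^-1` `]-oo, k.+1%:R[ = [set x | enorm x < k.+1%:R].
    by apply/seteqP; split => x /=; rewrite in_itv.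
  by rewrite ball_volume// vol_fin -!EFinM ltry.
Qed.

End cone.

Let polar (x : Rn) : Rn * R := (normalize x, enorm x).

Let measurable_polar : measurable_fun setT polar.
Proof.
apply/measurable_fun_pair; first exact: measurable_normalize.
exact: measurable_enorm.
Qed.

Let polar_measure : {measure set (Rn * R) -> \bar R} :=
  measure_function_pushforward__canonical__measure_function_Measure
    leb measurable_polar.

(** Lebesgue measure is the image of the product of the surface measure and the
    distribution of the norm. *)
Lemma polar_integral (f : Rn -> R) (h : R -> R) :
  sigma.-integrable setT (EFin \o f) ->
  leb.-integrable setT (fun x => (h (enorm x))%:E) ->
  measurable_fun setT h ->
  \int[leb]_x (f (normalize x) * h (enorm x)) =
  (\int[sigma]_x f x) * (\int[leb]_x h (enorm x)).
Proof.
move=> intf inth mh.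
have mf : measurable_fun setT f by apply/measurable_EFinP; exact: measurable_int intf.
have mh' : measurable_fun setT (EFin \o h) by exact/measurable_EFinP.
have inth' : radial_measure.-integrable setT (EFin \o h).
  exact: (integrable_pushforward (@measurable_enorm R n) mh' inth measurableT).
have ih := integrable_tensor intf inth'.
have eh := integral_tensor intf inth'.
have mfh : measurable_fun setT (fun z : Rn * R => (f z.1 * h z.2)%:E).
  exact: measurable_int ih.
have -> : \int[leb]_x h (enorm x) = \int[radial_measure]_y h y.
  rewrite /Rintegral; congr fine.
  by have := integral_pushforward (@measurable_enorm R n) mh' inth measurableT.
have key A : measurable A -> A `<=` setT ->
    (sigma \x radial_measure)%E A = polar_measure A.
  move=> mA _; apply: product_measure_unique mA => B C mB mC.
  by rewrite -cone_measure.
rewrite (eq_measure_integral polar_measure key) in eh.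
have ip : leb.-integrable setT ((fun z : Rn * R => (f z.1 * h z.2)%:E) \o polar).
  apply/integrableP; split; first exact: measurableT_comp.
  have maf : measurable_fun setT (fun z : Rn * R => `|(f z.1 * h z.2)%:E|%E).
    exact: (measurableT_comp (@abse_measurable R setT) mfh).
  have e := ge0_integral_pushforward measurable_polar leb measurableT maf
    (fun _ _ => abse_ge0 _).
  rewrite preimage_setT in e; rewrite -[X in (X < _)%E]e.
  rewrite -/polar_measure -(eq_measure_integral polar_measure key).
  by have /integrableP[] := ih.
have := integral_pushforward measurable_polar mfh ip measurableT.
rewrite -/polar_measure eh preimage_setT => e.
by rewrite {1}/Rintegral -[LHS]/(fine (\int[leb]_x (((fun z : Rn * R => (f z.1 * h z.2)%:E) \o polar) x))%E) -e.
Qed.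

End radial.

(** * Gaussian integrals of polynomials *)

Section gauss_polynomial.
Context {R : realType} (n : nat).
Local Notation leb := (@lebesgue_tuple R n).
Local Notation Rn := (n.-tuple (measurableTypeR R)).
Local Notation C := R[i].
Local Notation P := (mpoly n C).
Local Notation X i := (@mpolyX n C (mnm1 i)).

Definition tuple_eval (p : P) (x : Rn) : C := meval (fun i => (tnth x i : R)%:C) p.

Let F p (x : Rn) : R := complex.Re (tuple_eval p x) * gaussian x.

Definition gauss_int (p : P) : R := \int[leb]_x F p x.

Lemma tuple_evalX m x : tuple_eval (mpolyX _ m) x = (\prod_i (tnth x i : R) ^+ m i)%:C.
Proof.
rewrite /tuple_eval mevalX rmorph_prod; apply: eq_bigr => i _.
by rewrite rmorphXn.
Qed.

Let FX c m x : F (c *: mpolyX _ m) x =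
  complex.Re c * \prod_i gauss_pow (m i) (tnth x i : R).
Proof.
rewrite /F /tuple_eval mevalZ -/(tuple_eval _ _) tuple_evalX.
by case: c => a b /=; rewrite mulr0 subr0 -mulrA /gaussian -big_split.
Qed.

Let FD p q x : F (p + q) x = F p x + F q x.
Proof. by rewrite /F /tuple_eval mevalD raddfD mulrDl. Qed.

Let moments (m : multinom n) := tuple_integral_prod
  (fun i => @integrable_gauss_pow R (m i)).

Lemma integrable_gauss_poly p : leb.-integrable setT (EFin \o F p).
Proof.
elim/mpolyind: p => [|c m p _ _ IH].
  rewrite (_ : EFin \o _ = cst 0%E); first exact: integrable0.
  by apply/funext => x /=; rewrite /F /tuple_eval meval0 raddf0 mul0r.
rewrite (_ : EFin \o _ = ((EFin \o F (c *: mpolyX _ m)) \+ (EFin \o F p))%E).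
  apply: integrableD => //; rewrite (_ : EFin \o _ = fun x => ((complex.Re c)%:E *
      (\prod_i gauss_pow (m i) (tnth x i : R))%:E)%E).
    by apply: integrableZl => //; have [] := moments m.
  by apply/funext => x /=; rewrite FX EFinM.
by apply/funext => x /=; rewrite FD EFinD.
Qed.

Lemma gauss_intD p q : gauss_int (p + q) = gauss_int p + gauss_int q.
Proof.
rewrite /gauss_int -RintegralD//; try exact: integrable_gauss_poly.
by apply: eq_Rintegral => x _; rewrite FD.
Qed.

Lemma gauss_int0 : gauss_int 0 = 0.
Proof. by apply: (addrI (gauss_int 0)); rewrite -gauss_intD !addr0. Qed.

Lemma gauss_int_sum (I : Type) (s : seq I) (f : I -> P) :
  gauss_int (\sum_(i <- s) f i) = \sum_(i <- s) gauss_int (f i).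
Proof. exact: (big_morph gauss_int gauss_intD gauss_int0). Qed.

Lemma gauss_intMn p k : gauss_int (p *+ k) = k%:R * gauss_int p.
Proof.
elim: k => [|k IH]; first by rewrite mulr0n gauss_int0 mul0r.
by rewrite mulrS gauss_intD IH -natr1 mulrDl mul1r addrC.
Qed.

Lemma gauss_intX c m :
  gauss_int (c *: mpolyX _ m) = complex.Re c * \prod_i @gauss_moment R (m i).
Proof.
rewrite /gauss_int; have [i1 e1] := moments m.
have -> : \int[leb]_x F (c *: mpolyX _ m) x =
    \int[leb]_x (complex.Re c * \prod_i gauss_pow (m i) (tnth x i : R)).
  by apply: eq_Rintegral => x _; exact: FX.
by rewrite RintegralZl// /Rintegral e1.
Qed.

Lemma gauss_int_const c :
  gauss_int (mpolyC n c) = complex.Re c * (@gauss_moment R 0) ^+ n.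
Proof.
rewrite -[mpolyC n c]mulr1 mul_mpolyC -mpolyX0 gauss_intX; congr (_ * _).
under eq_bigr do rewrite mnm0E.
by rewrite big_const_ord iter_mulr_1.
Qed.

(** Integration by parts against the Gaussian weight. *)
Lemma gauss_int_stein i p : gauss_int (X i * p *+ 2) = gauss_int (mderiv i p).
Proof.
elim/mpolyind: p => [|c m p _ _ IH]; first by rewrite mulr0 mul0rn mderiv0 gauss_int0.
have -> : X i * (c *: mpolyX _ m + p) *+ 2 =
    X i * (c *: mpolyX _ m) *+ 2 + X i * p *+ 2 by rewrite mulrDr mulrnDl.
transitivity (gauss_int (X i * (c *: mpolyX _ m) *+ 2) + gauss_int (X i * p *+ 2)).
  exact: gauss_intD.
transitivity (gauss_int (mderiv i (c *: mpolyX _ m)) + gauss_int (mderiv i p)); last first.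
  by rewrite mderivD; exact/esym/gauss_intD.
apply: (congr2 +%R _ IH).
rewrite -scalerAr -mpolyXD mderivZ mderivX scalerA gauss_intMn !gauss_intX.
have -> : complex.Re (c * (m i)%:R) = complex.Re c * (m i)%:R.
  case: c => a b; have -> : (m i)%:R = ((m i)%:R : R)%:C by rewrite rmorph_nat.
  by rewrite /= mulr0 subr0.
rewrite [LHS]mulrCA -[RHS]mulrA; congr (_ * _).
have split (l : multinom n) : \prod_j @gauss_moment R (l j) =
    gauss_moment (l i) * \prod_(j | j != i) gauss_moment (l j) by exact: bigD1.
have mi : mnm_add (mnm1 i) m i = (m i).+1 by rewrite mnmDE mnm1E eqxx add1n.
have mi' : mnm_sub m (mnm1 i) i = (m i).-1 by rewrite mnmBE mnm1E eqxx subn1.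
rewrite (split (mnm_add _ _)) (split (mnm_sub _ _)) mi mi' mulrA [RHS]mulrA.
rewrite gauss_moment_step; congr (_ * _).
apply: eq_bigr => j ji; rewrite mnmDE mnmBE mnm1E eq_sym (negPf ji).
by rewrite add0n subn0.
Qed.

End gauss_polynomial.

(** * The mean of [|T(z)^n x|^2] over the sphere *)

Section complex_coordinates.
Context {R : realType} (d : nat).
Local Notation C := R[i].
Local Notation P := (mpoly (d + d) C).
Local Notation X i := (@mpolyX (d + d) C (mnm1 i)).
Implicit Types (p q : P) (k j : 'I_d).

Definition zvar k : P := X (lshift d k) + 'i%C *: X (rshift d k).
Definition zbar k : P := X (lshift d k) - 'i%C *: X (rshift d k).

(** Twice the Wirtinger derivative in the [k]-th complex coordinate. *)
Definition wirtinger k p : P :=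
  mderiv (lshift d k) p - 'i%C *: mderiv (rshift d k) p.

Lemma wirtingerD k p q : wirtinger k (p + q) = wirtinger k p + wirtinger k q.
Proof. by rewrite /wirtinger !mderivD scalerDr opprD addrACA. Qed.

Lemma wirtinger0 k : wirtinger k 0 = 0.
Proof. by rewrite /wirtinger !mderiv0 scaler0 subr0. Qed.

Lemma wirtinger_sum k (I : Type) (s : seq I) (f : I -> P) :
  wirtinger k (\sum_(i <- s) f i) = \sum_(i <- s) wirtinger k (f i).
Proof. exact: (big_morph _ (wirtingerD k) (wirtinger0 k)). Qed.

Lemma wirtingerM k p q : wirtinger k (p * q) = wirtinger k p * q + p * wirtinger k q.
Proof.
rewrite /wirtinger !mderivM scalerDr opprD addrACA mulrBl mulrBr.
by rewrite scalerAl scalerAr.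
Qed.

Lemma wirtinger_const k c : wirtinger k (mpolyC _ c) = 0.
Proof. by rewrite /wirtinger !mderivC scaler0 subr0. Qed.

Lemma mderivXU (i j : 'I_(d + d)) : mderiv i (X j) = (i == j)%:R.
Proof.
rewrite mderivX mnm1E eq_sym; case: eqVneq => [->|_]; last by rewrite scale0r.
by rewrite scale1r -mpolyX0; congr mpolyX; apply/mnmP => l; rewrite mnmBE subnn mnm0E.
Qed.

Let ii : 'i%C * 'i%C = -1 :> C.
Proof. by apply/eqP; rewrite eq_complex/=; apply/andP; split; apply/eqP; ring. Qed.

Let eqlr k j : (lshift d k == rshift d j) = false.
Proof. by rewrite eq_lrshift. Qed.
Let eqrl k j : (rshift d k == lshift d j) = false.
Proof. by rewrite eq_rlshift. Qed.

Lemma wirtinger_z k j : wirtinger k (zvar j) = (k == j)%:R *+ 2.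
Proof.
rewrite /wirtinger /zvar !mderivD !mderivZ !mderivXU eqlr eqrl.
rewrite eq_lshift eq_rshift scaler0 addr0 add0r scalerA ii scaleN1r opprK.
by rewrite -mulr2n.
Qed.

Lemma wirtinger_zbar k j : wirtinger k (zbar j) = 0.
Proof.
rewrite /wirtinger /zbar !mderivB !mderivZ !mderivXU eqlr eqrl.
rewrite eq_lshift eq_rshift scaler0 subr0 sub0r scalerN scalerA ii.
by rewrite scaleN1r opprK subrr.
Qed.

Lemma gauss_int_wirtinger k p : gauss_int (zbar k * p *+ 2) = gauss_int (wirtinger k p).
Proof.
have -> : zbar k * p = X (lshift d k) * p + X (rshift d k) * (- ('i%C *: p)).
  by rewrite mulrBl mulrN -scalerAr scalerAl.
rewrite mulrnDl gauss_intD !gauss_int_stein -gauss_intD; congr gauss_int.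
by rewrite mderivN mderivZ.
Qed.

Definition znorm : P := \sum_k zbar k * zvar k.

Lemma wirtinger_znorm k n :
  wirtinger k (znorm ^+ n) = zbar k * znorm ^+ n.-1 *+ (2 * n).
Proof.
have w1 : wirtinger k znorm = zbar k *+ 2.
  rewrite /znorm wirtinger_sum (bigD1 k)//= big1 => [|j jk].
    by rewrite wirtingerM wirtinger_zbar mul0r add0r wirtinger_z eqxx addr0 mulrnAr mulr1.
  rewrite wirtingerM wirtinger_zbar mul0r add0r wirtinger_z eq_sym (negPf jk).
  by rewrite mul0rn mulr0.
elim: n => [|n IH]; first by rewrite expr0 muln0 mulr0n -mpolyC1 wirtinger_const.
rewrite exprS wirtingerM w1 IH mulrnAl/=.
case: n IH => [|n] _; first by rewrite muln0 mulr0n mulr0 addr0 !muln1.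
rewrite mulrnAr mulrCA -exprS -mulrnDr; congr (_ *+ _); lia.
Qed.

Lemma gauss_int_znorm n :
  gauss_int (znorm ^+ n) = (\prod_(j < n) (d + j)%:R) * (@gauss_moment R 0) ^+ (d + d).
Proof.
elim: n => [|n IH]; first by rewrite big_ord0 mul1r expr0 -mpolyC1 gauss_int_const mul1r.
rewrite big_ord_recr/= mulrAC -IH.
apply: (mulfI (_ : (2 : R) != 0)); first by rewrite pnatr_eq0.
rewrite -gauss_intMn exprS {1}/znorm mulr_suml -sumrMnl gauss_int_sum.
rewrite (eq_bigr (fun k => 2 * gauss_int (znorm ^+ n) +
    (2 * n)%:R * gauss_int (zbar k * zvar k * znorm ^+ n.-1))); last first.
  move=> k _; rewrite -mulrA gauss_int_wirtinger wirtingerM wirtinger_z eqxx.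
  rewrite mulrnAl mul1r wirtinger_znorm mulrnAr gauss_intD !gauss_intMn.
  by rewrite mulrA (mulrC (zvar k)).
have zz : \sum_k gauss_int (zbar k * zvar k * znorm ^+ n.-1) =
    gauss_int (znorm * znorm ^+ n.-1).
  by rewrite -gauss_int_sum [in RHS]/znorm mulr_suml.
have lin (F : 'I_d -> R) (G c : R) :
    \sum_k (2 * G + c * F k) = 2 * G * d%:R + c * \sum_k F k.
  by rewrite big_split/= sumr_const card_ord -mulr_sumr mulr_natr.
rewrite (lin (fun k => gauss_int (zbar k * zvar k * znorm ^+ n.-1))) zz {zz lin}.
have -> : (2 * n)%:R * gauss_int (znorm * znorm ^+ n.-1) =
    (2 * n)%:R * gauss_int (znorm ^+ n) by case: n {IH} => [|n]; [exact: etrans (mul0r _) (esym (mul0r _))|exact: (congr1 (fun p => _ * gauss_int p) (esym (exprS znorm n)))].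
move: (gauss_int _) => G; rewrite natrD natrM; ring.
Qed.

Variable x : (d + d).-tuple (measurableTypeR R).

Lemma eval_zvar k : tuple_eval (zvar k) x = complex_coords x k.
Proof.
rewrite /tuple_eval mevalD mevalZ !mevalXU /complex_coords.
by apply/eqP; rewrite eq_complex/=; apply/andP; split; apply/eqP; ring.
Qed.

Lemma eval_zbar k : tuple_eval (zbar k) x = Num.conj (complex_coords x k).
Proof.
rewrite /tuple_eval mevalB mevalZ !mevalXU /complex_coords.
by apply/eqP; rewrite eq_complex/=; apply/andP; split; apply/eqP; ring.
Qed.

Lemma eval_znorm : tuple_eval znorm x = (enorm x ^+ 2)%:C.
Proof.
rewrite /tuple_eval /znorm raddf_sum/= sqr_enorm big_split_ord/= -big_split/=.
rewrite rmorph_sum; apply: eq_bigr => k _.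
rewrite mevalM -!/(tuple_eval _ x) eval_zvar eval_zbar /complex_coords.
by apply/eqP; rewrite eq_complex/=; apply/andP; split; apply/eqP; ring.
Qed.

End complex_coordinates.

Section sphere_mean.
Context {R : realType} {H : completeNormedModType R[i]} {d : nat}.
Variable dot : {dot H for @Num.conj R[i]}.
Variable T : 'I_d -> {linear H -> H}.
Hypothesis Hn : inner_product_norm dot.
Hypothesis TC : forall j k x, T j (T k x) = T k (T j x).
Local Notation Rn := ((d + d).-tuple (measurableTypeR R)).

(** [power_poly n m x y] is [<T(z)^n x, T(z)^m y>] as a polynomial in [z]. *)
Fixpoint power_poly0 m (x y : H) : mpoly (d + d) R[i] :=
  if m is m'.+1 then \sum_k @zvar R d k * power_poly0 m' x (T k y)
  else mpolyC _ (dot x y).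

Fixpoint power_poly n m (x y : H) : mpoly (d + d) R[i] :=
  if n is n'.+1 then \sum_k @zbar R d k * power_poly n' m (T k x) y
  else power_poly0 m x y.

Lemma T_at_linear z : linear (T_at T z).
Proof.
move=> c x y; rewrite /T_at scaler_sumr -big_split/=; apply: eq_bigr => k _.
by rewrite linearP scalerDr !scalerA mulrC.
Qed.

Lemma iter_T_atE z n y : iter n.+1 (T_at T z) y =
  \sum_k Num.conj (z k) *: iter n (T_at T z) (T k y).
Proof.
have L : linear (iter n (T_at T z)).
  by elim: n => [//|n IH] c u v /=; rewrite IH T_at_linear.
rewrite iterSr {1}/T_at (linear_apply_sum _ _ _ L); apply: eq_bigr => k _.
by rewrite (linear_applyZ _ _ L).
Qed.

Lemma eval_power_poly n m (x y : H) (t : Rn) (z := complex_coords t) :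
  tuple_eval (power_poly n m x y) t =
  dot (iter n (T_at T z) x) (iter m (T_at T z) y).
Proof.
elim: n x => [|n IH] x.
  rewrite /=; elim: m y => [|m IH] y; first by rewrite /tuple_eval mevalC.
  rewrite iter_T_atE [power_poly0 _ _ _]/= dot_sumr /tuple_eval raddf_sum/=.
  apply: eq_bigr => k _; rewrite mevalM -!/(tuple_eval _ t) eval_zvar IH.
  by rewrite dotZr cjK.
rewrite iter_T_atE dot_suml /tuple_eval /= raddf_sum/=; apply: eq_bigr => k _.
by rewrite mevalM -!/(tuple_eval _ t) eval_zbar IH dotZl.
Qed.

Lemma wirtinger_power_poly k n m x y : wirtinger k (power_poly n m x y) =
  power_poly n m.-1 x (T k y) *+ (2 * m).
Proof.
elim: n x => [|n IH] x.
  rewrite /=; elim: m y => [|m IH] y.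
    by rewrite muln0 mulr0n; exact: wirtinger_const.
  rewrite /= wirtinger_sum.
  rewrite (eq_bigr (fun j => (if j == k then power_poly0 m x (T k y) *+ 2 else 0) +
     @zvar R d j * power_poly0 m.-1 x (T k (T j y)) *+ (2 * m))); last first.
    move=> j _; rewrite wirtingerM IH wirtinger_z mulrnAr; congr (_ + _).
    by rewrite eq_sym; case: eqVneq => [->|_]; rewrite mulrnAl ?mul1r// mul0r mul0rn.
  rewrite big_split/= -big_mkcond/= big_pred1_eq sumrMnl.
  case: m IH => [|m] _; first by rewrite muln0 mulr0n addr0.
  rewrite (eq_bigr (fun j => @zvar R d j * power_poly0 m x (T j (T k y)))).
    by rewrite -/(power_poly0 m.+1 x (T k y)) -mulrnDr; congr (_ *+ _); lia.
  by move=> j _; rewrite TC.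
rewrite /= wirtinger_sum -sumrMnl; apply: eq_bigr => j _.
by rewrite wirtingerM wirtinger_zbar mul0r add0r IH mulrnAr.
Qed.

Lemma gauss_int_power_poly n x : gauss_int (power_poly n n x x) =
  n`!%:R * word_energy T n x * (@gauss_moment R 0) ^+ (d + d).
Proof.
elim: n x => [|n IH] x.
  by rewrite gauss_int_const (dot_rnorm Hn) mul1r.
apply: (mulfI (_ : (2 : R) != 0)); first by rewrite pnatr_eq0.
rewrite -gauss_intMn [power_poly _ _ _ _]/= -sumrMnl gauss_int_sum.
under eq_bigr do rewrite gauss_int_wirtinger wirtinger_power_poly gauss_intMn IH.
rewrite /= -mulr_sumr -mulr_suml -mulr_sumr factS !natrM; ring.
Qed.

End sphere_mean.

Section sphere_integral.
Context {R : realType} {H : completeNormedModType R[i]} {d : nat}.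
Variable dot : {dot H for @Num.conj R[i]}.
Variable T : 'I_d -> {linear H -> H}.
Hypothesis HM : contractive_hilbert_module dot T.
Hypothesis d0 : (0 < d)%N.
Local Notation Rn := ((d + d).-tuple (measurableTypeR R)).
Local Notation leb := (@lebesgue_tuple R (d + d)).
Local Notation sigma := (@surface_measure R (d + d)).
Local Notation sphere := (@esphere R (d + d)).
Implicit Types (x : Rn) (xi : H) (n : nat).

Definition power_sq n xi x : R := rnorm (iter n (T_at T (complex_coords x)) xi) ^+ 2.

Lemma power_sqE n xi x : power_sq n xi x =
  complex.Re (tuple_eval (power_poly dot T n n xi xi) x).
Proof. by rewrite eval_power_poly (dot_rnorm (module_norm HM)). Qed.

Lemma measurable_power_sq n xi : measurable_fun setT (power_sq n xi).
Proof.
have mF : measurable_fun setT (fun x : Rn => power_sq n xi x * gaussian x).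
  apply/measurable_EFinP; rewrite (_ : _ \o _ = EFin \o (fun x : Rn =>
    complex.Re (tuple_eval (power_poly dot T n n xi xi) x) * gaussian x)).
    exact: measurable_int (integrable_gauss_poly (power_poly dot T n n xi xi)).
  by apply/funext => x /=; rewrite power_sqE.
rewrite (_ : power_sq n xi = fun x => (power_sq n xi x * gaussian x) *
    expR (enorm x ^+ 2)).
  apply: measurable_funM => //; apply: measurableT_comp; first exact: measurable_expR.
  by apply: measurable_funX; exact: measurable_enorm.
by apply/funext => x; rewrite gaussianE -mulrA -expRD addNr expR0 mulr1.
Qed.

Lemma complex_coords_sqr x : enorm x ^+ 2 = \sum_k complex.Re `|complex_coords x k| ^+ 2.
Proof.
rewrite sqr_enorm big_split_ord/= -big_split/=; apply: eq_bigr => k _.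
by rewrite sqr_sqrtr// addr_ge0// sqr_ge0.
Qed.

Lemma T_at_contraction x xi : rnorm (T_at T (complex_coords x) xi) <= enorm x * rnorm xi.
Proof.
rewrite -(@ler_pXn2r _ 2)// ?nnegrE ?mulr_ge0 ?rnorm_ge0 ?enorm_ge0//.
rewrite exprMn complex_coords_sqr /T_at.
rewrite (eq_bigr (fun k => T k (Num.conj (complex_coords x k) *: xi))); last first.
  by move=> k _; rewrite linearZ.
apply: le_trans (module_row_contraction HM _) _.
rewrite mulr_suml ler_sum// => k _.
by rewrite rnormZ cj_norm exprMn.
Qed.

Lemma power_sq_bound n xi x : sphere x -> power_sq n xi x <= rnorm xi ^+ 2.
Proof.
move=> x1; rewrite /power_sq lerXn2r ?nnegrE ?rnorm_ge0//.
elim: n => //= n; apply: le_trans.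
by rewrite (le_trans (T_at_contraction _ _))// x1 mul1r.
Qed.

Lemma complex_coords_scale (s : R) x k :
  complex_coords (scale_tuple s x) k = s%:C * complex_coords x k.
Proof.
rewrite /complex_coords !tnth_mktuple.
by apply/eqP; rewrite eq_complex/=; apply/andP; split; apply/eqP; ring.
Qed.

Lemma power_sq_scale n xi (s : R) x :
  power_sq n xi (scale_tuple s x) = s ^+ (2 * n) * power_sq n xi x.
Proof.
rewrite /power_sq.
have -> : iter n (T_at T (complex_coords (scale_tuple s x))) xi =
    (s ^+ n)%:C *: iter n (T_at T (complex_coords x)) xi.
  elim: n => [|n IH]; first by rewrite expr0 scale1r.
  rewrite /= IH (linear_applyZ _ _ (T_at_linear _ _)) /T_at exprSr rmorphM/= -scalerA.
  congr (_ *: _); rewrite scaler_sumr; apply: eq_bigr => k _.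
  by rewrite complex_coords_scale cjM cj_real scalerA.
rewrite rnormZ exprMn; congr (_ * _).
by rewrite normc_def/= expr0n addr0 sqrtr_sqr real_normK ?num_real// -exprM mulnC.
Qed.

Lemma measurable_esphere : measurable sphere.
Proof.
have := measurable_fun_eqr (@measurable_enorm R (d + d)) (measurable_cst (1 : R)).
move=> /(_ measurableT [set true] I); rewrite setTI.
by congr measurable; apply/seteqP; split => x /= /eqP.
Qed.

Lemma integrable_power_sq n xi : sigma.-integrable sphere (EFin \o power_sq n xi).
Proof.
apply: (@measurable_bounded_integrable _ _ _ sigma).
- exact: measurable_esphere.
- by rewrite -ge0_fin_numE// fin_num_measure//; exact: measurable_esphere.
- exact: measurable_funTS (measurable_power_sq n xi).
- exists (rnorm xi ^+ 2); split; first exact: num_real.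
  move=> M MM x /= x1; rewrite ger0_norm ?sqr_ge0//.
  by rewrite (le_trans (power_sq_bound _ _ x1))// ltW.
Qed.

(** The Gaussian integrals of [|T(z)^n x|^2] and of [|z|^2n] differ by the factor
    that is to be computed, both functions being homogeneous of degree [2n]. *)
Theorem sphere_power_integral n xi :
  \int[sigma]_(x in sphere) power_sq n.+1 xi x =
  word_energy T n.+1 xi / 'C(d + n, n.+1)%:R.
Proof.
pose f x : R := (power_sq n.+1 xi \_ sphere) x.
pose h (s : R) := s ^+ (2 * n.+1) * expR (- s ^+ 2).
have hE x : h (enorm x) =
    complex.Re (tuple_eval (@znorm R d ^+ n.+1) x) * gaussian x.
  rewrite /h gaussianE /tuple_eval rmorphXn/= -/(tuple_eval _ x) eval_znorm.
  by rewrite -rmorphXn/= -exprM.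
have mh : measurable_fun setT h.
  apply: measurable_funM; first exact: measurable_funX.
  apply: measurableT_comp; first exact: measurable_expR.
  by apply: measurableT_comp => //; exact: measurable_funX.
have intf : sigma.-integrable setT (EFin \o f).
  rewrite (_ : EFin \o f = (EFin \o power_sq n.+1 xi) \_ sphere).
    by apply/integrable_restrict; rewrite ?setTI; [exact: measurable_esphere|exact: measurableT|exact: integrable_power_sq].
  by rewrite /f -restrict_EFin.
have inth : leb.-integrable setT (fun x => (h (enorm x))%:E).
  rewrite (_ : (fun _ => _) = EFin \o (fun x : Rn =>
    complex.Re (tuple_eval (@znorm R d ^+ n.+1) x) * gaussian x)).
    exact: integrable_gauss_poly.
  by apply/funext => x /=; rewrite hE.
have := polar_integral intf inth mh.
have -> : \int[leb]_x h (enorm x) = gauss_int (@znorm R d ^+ n.+1).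
  by apply: eq_Rintegral => x _; rewrite hE.
have -> : \int[leb]_x (f (normalize x) * h (enorm x)) =
    gauss_int (power_poly dot T n.+1 n.+1 xi xi).
  apply: eq_Rintegral => x _; rewrite -power_sqE /h gaussianE mulrA; congr (_ * _).
  have [x0|x0] := eqVneq (enorm x) 0.
    rewrite x0 exprM expr0n/= expr0n/= mulr0.
    have e : x = scale_tuple 0 x.
      by apply: eq_from_tnth => i; rewrite tnth_mktuple mul0r (enorm_eq0 x0).
    by rewrite e power_sq_scale exprM expr0n/= expr0n mul0r.
  rewrite /f patchE mem_set; last exact: enorm_normalize.
  have e : x = scale_tuple (enorm x) (normalize x).
    by apply: eq_from_tnth => i; rewrite !tnth_mktuple mulrC divfK.
  by rewrite mulrC -power_sq_scale -e.
have -> : \int[sigma]_x f x = \int[sigma]_(x in sphere) power_sq n.+1 xi x.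
  rewrite [in RHS]/Rintegral integral_mkcond /Rintegral; congr fine.
  by apply: eq_integral => x _; rewrite /f !patchE; case: ifP.
rewrite (gauss_int_power_poly (module_norm HM) (module_commute HM)) gauss_int_znorm.
have M0 : (@gauss_moment R 0) ^+ (d + d) != 0.
  by rewrite expf_neq0// gt_eqF// gauss_moment0_gt0.
rewrite [RHS]mulrA => /(mulIf M0).
have fE : n.+1`!%:R * 'C(d + n, n.+1)%:R = \prod_(j < n.+1) (d + j)%:R :> R.
  rewrite -natrM mulnC bin_ffact -natr_prod; congr (_%:R).
  elim: {+}n => [|m IH]; first by rewrite addn0 ffactn1 big_ord1 addn0.
  by rewrite addnS ffactSS IH [RHS]big_ord_recr/= mulnC addnS.
have C0 : 'C(d + n, n.+1)%:R != 0 :> R.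
  by rewrite pnatr_eq0 -lt0n bin_gt0; move: d0; clear; case: d => // k _; lia.
have F0 : n.+1`!%:R != 0 :> R by rewrite pnatr_eq0 -lt0n fact_gt0.
rewrite -fE => e; apply: (mulfI F0); rewrite mulrA.
by apply: (mulIf C0); rewrite divfK// e; ring.
Qed.

End sphere_integral.

(** * The curvature as a limit *)

Section resolvent.
Context {R : realType} {H : completeNormedModType R[i]}.
Variable dot : {dot H for @Num.conj R[i]}.
Hypothesis Hn : inner_product_norm dot.
Variables (S : H -> H) (q : R).
Hypotheses (Sl : linear S) (q01 : 0 <= q < 1).
Hypothesis Sq : forall x, rnorm (S x) <= q * rnorm x.

Local Notation X := (op_inv (fun y => y - S y)).

Let S1 x : rnorm (S x) <= rnorm x.
Proof. by rewrite (le_trans (Sq x))// ler_piMl ?rnorm_ge0//; case/andP: q01 => _ /ltW. Qed.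

Lemma resolventK x : X x - S (X x) = x.
Proof. by have [_ /(_ x)] := op_invP (neumann Sl q01 Sq). Qed.

Lemma resolvent_unique x y : y - S y = x -> y = X x.
Proof. by move=> <-; have [/(_ y)->] := op_invP (neumann Sl q01 Sq). Qed.

Lemma resolvent_linear : linear X.
Proof.
move=> c x y; apply/esym/resolvent_unique.
by rewrite Sl opprD addrACA -scalerBr !resolventK.
Qed.

Lemma resolvent_bound x : (1 - q) * rnorm (X x) <= rnorm x.
Proof.
rewrite mulrBl mul1r lerBlDr; apply: le_trans (lerD (lexx _) (Sq (X x))).
rewrite -{2}(resolventK x).
by rewrite (le_trans _ (rnormD _ _))// subrK.
Qed.

Lemma resolvent_partial n x :
  X x - \sum_(j < n) iter j S x = X (iter n S x).
Proof.
apply: resolvent_unique; elim: n => [|n IH].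
  by rewrite big_ord0 subr0 resolventK.
have e : X x - \sum_(j < n.+1) iter j S x = X x - \sum_(j < n) iter j S x - iter n S x.
  by rewrite big_ord_recr/= opprD addrA.
rewrite e (linear_applyB _ _ Sl) opprD opprK addrACA IH.
by rewrite addrA subrr add0r.
Qed.

Lemma iter_bound n x : rnorm (iter n S x) <= q ^+ n * rnorm x.
Proof.
elim: n => [|n IH]; first by rewrite expr0 mul1r.
rewrite exprS -mulrA (le_trans (Sq _))// ler_wpM2l//.
by case/andP: q01.
Qed.

Lemma resolvent_partial_cvg x :
  (rnorm (\sum_(j < n) iter j S x) ^+ 2) @[n --> \oo] --> rnorm (X x) ^+ 2.
Proof.
have [q0 q1] := andP q01; have q1' : 0 < 1 - q by rewrite subr_gt0.
suff c : (rnorm (\sum_(j < n) iter j S x)) @[n --> \oo] --> rnorm (X x).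
  by under eq_fun do rewrite expr2; rewrite expr2; exact: cvgM.
have qn0 : (GRing.exp q : R^nat) @ \oo --> (0:R).
  by apply: cvg_expr; rewrite ger0_norm.
have bn0 : (q ^+ n * (rnorm x / (1 - q))) @[n --> \oo] --> (0 : R).
  by rewrite -[X in _ --> X](mul0r (rnorm x / (1 - q))); apply: cvgM => //; exact: cvg_cst.
apply/cvgrPdist_le => e e0.
have /cvgrPdist_le /(_ _ e0) := bn0; apply: filterS => n /=.
rewrite sub0r normrN => /(le_trans (ler_norm _)); apply: le_trans.
have Xn : rnorm (X x - \sum_(j < n) iter j S x) <= q ^+ n * (rnorm x / (1 - q)).
  rewrite resolvent_partial mulrA ler_pdivlMr// mulrC.
  by rewrite (le_trans (resolvent_bound _))// iter_bound.
apply: le_trans Xn; rewrite ler_norml lerBlDr lerBrDr.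
apply/andP; split; last by rewrite (le_trans _ (rnormD _ _))// subrK.
rewrite addrC lerBlDr rnormB (le_trans _ (rnormD _ _))// addrC subrK.
by [].
Qed.

Lemma adjoint_of_contraction x y : dot (S x) y = dot x (adjoint dot S y).
Proof.
pose L : {linear H -> H} := HB.pack S (GRing.isLinear.Build _ _ _ _ S Sl).
exact: (@adjointP _ _ dot Hn L S1 x y).
Qed.

Lemma resolvent_adjoint x y :
  dot (op_inv (fun y => y - adjoint dot S y) x) y = dot x (X y).
Proof.
have S'l : linear (adjoint dot S) := linear_adjoint adjoint_of_contraction.
have S'q z : rnorm (adjoint dot S z) <= q * rnorm z.
  have [->|z0] := eqVneq (rnorm (adjoint dot S z)) 0.
    by rewrite mulr_ge0 ?rnorm_ge0//; case/andP: q01.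
  have zp : 0 < rnorm (adjoint dot S z) by rewrite lt_def z0 rnorm_ge0.
  rewrite -(ler_pM2l zp) -expr2 -lecR.
  have := cauchy_schwarz Hn (S (adjoint dot S z)) z.
  rewrite adjoint_of_contraction (dot_rnorm Hn) ger0_norm ?ler0c ?sqr_ge0//.
  move/le_trans; apply; rewrite lecR mulrCA mulrA ler_wpM2r ?rnorm_ge0//.
have [_ /(_ x) xE] := op_invP (neumann S'l q01 S'q).
rewrite -{1}(resolventK y) dotBr [dot _ (S _)]dotC adjoint_of_contraction -dotC.
by rewrite -dotBl xE.
Qed.

End resolvent.

Section abel.
Context {R : realType}.
Variables (a : R^nat) (L : R) (Phi : R -> R).
Hypotheses (a0 : forall n, 0 <= a n) (a_dec : forall n, a n.+1 <= a n).
Hypothesis aL : a @ \oo --> L.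
Hypothesis PhiE : forall r, 0 < r < 1 ->
  (\sum_(j < n) r ^+ (2 * j) * a j) @[n --> \oo] --> Phi r.

Let a_le n m : (n <= m)%N -> a m <= a n.
Proof. by move=> nm; have /nonincreasing_seqP := a_dec; apply. Qed.

Let L_le n : L <= a n.
Proof.
apply: (cvgr_to_le aL); exists n => // m /= nm; exact: a_le.
Qed.

Let geom (r : R) n : (1 - r ^+ 2) * \sum_(j < n) r ^+ (2 * j) = 1 - r ^+ (2 * n).
Proof.
elim: n => [|n IH]; first by rewrite big_ord0 mulr0 muln0 expr0 subrr.
rewrite big_ord_recr/= mulrDr IH mulnS exprD; ring.
Qed.

Let lower (r : R) : 0 < r < 1 -> L <= (1 - r ^+ 2) * Phi r.
Proof.
move=> r01; have [r0 r1] := andP r01.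
have r2 : 0 <= r ^+ 2 < 1 by rewrite sqr_ge0 expr_lt1// ltW.
have c1 : ((1 - r ^+ 2) * \sum_(j < n) r ^+ (2 * j) * a j) @[n --> \oo] -->
    (1 - r ^+ 2) * Phi r by apply: cvgM; [exact: cvg_cst|exact: PhiE].
have c2 : (L * (1 - (r ^+ 2) ^+ n)) @[n --> \oo] --> L * (1 - 0).
  apply: cvgM; first exact: cvg_cst.
  apply: cvgB; first exact: cvg_cst.
  by apply: cvg_expr; case/andP: r2 => p q; rewrite ger0_norm.
rewrite subr0 mulr1 in c2; apply: (ler_cvg_to c2 c1); apply: nearW => n.
rewrite -exprM -geom mulrCA ler_wpM2l//; first by rewrite subr_ge0 ltW//; case/andP: r2.
rewrite mulr_sumr ler_sum// => j _; rewrite mulrC ler_wpM2l// exprn_ge0//.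
exact: ltW.
Qed.

Let upper (r : R) n0 : 0 < r < 1 ->
  (1 - r ^+ 2) * Phi r <= (1 - r ^+ 2) * (n0%:R * a 0%N) + a n0.
Proof.
move=> r01; have [r0 r1] := andP r01.
have r2 : 0 <= 1 - r ^+ 2 by rewrite subr_ge0 expr_le1// ltW.
have part n : \sum_(j < n) r ^+ (2 * j) * (a j - a n0) <= (minn n n0)%:R * a 0%N.
  elim: n => [|n IH]; first by rewrite big_ord0 min0n mul0r.
  rewrite big_ord_recr/=.
  have rn1 : 0 <= r ^+ (2 * n) <= 1 by rewrite exprn_ge0 ?exprn_ile1// ltW.
  have [p q] := andP rn1.
  have [nn|nn] := ltnP n n0.
    have -> : minn n.+1 n0 = (minn n n0).+1 by lia.
    rewrite -natr1 mulrDl mul1r lerD//.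
    have h1 : a n - a n0 <= a 0%N by rewrite lerBlDr (le_trans (a_le (leq0n n)))// lerDl.
    have h2 : 0 <= a n - a n0 by rewrite subr_ge0 a_le// ltnW.
    by rewrite (le_trans _ h1)// ler_piMl.
  have -> : minn n.+1 n0 = minn n n0 by lia.
  rewrite (le_trans _ IH)// gerDl mulr_ge0_le0// subr_le0; exact: a_le.
have c1 : ((1 - r ^+ 2) * \sum_(j < n) r ^+ (2 * j) * a j) @[n --> \oo] -->
    (1 - r ^+ 2) * Phi r by apply: cvgM; [exact: cvg_cst|exact: PhiE].
apply: (cvgr_to_le c1); apply: nearW => n.
have -> : \sum_(j < n) r ^+ (2 * j) * a j =
    \sum_(j < n) r ^+ (2 * j) * (a j - a n0) + (\sum_(j < n) r ^+ (2 * j)) * a n0.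
  by rewrite mulr_suml -big_split/=; apply: eq_bigr => j _; ring.
rewrite mulrDr mulrA geom lerD//.
  rewrite ler_wpM2l// (le_trans (part n))// ler_wpM2r// ler_nat; lia.
by rewrite ler_piMl// lerBlDr lerDl exprn_ge0// ltW.
Qed.

(** Abel summation: [(1 - r^2) \sum_j r^2j a_j] tends to the limit of [a]. *)
Lemma abel_limit : ((1 - r ^+ 2) * Phi r) @[r --> (1 : R)^'-] --> L.
Proof.
apply/cvgrPdist_le => e e0.
have e2 : 0 < e / 2 by rewrite divr_gt0.
have /cvgrPdist_le /(_ _ e2) [n0 _ /(_ n0 (leqnn n0)) /= La] := aL.
have small : ((1 - r ^+ 2) * (n0%:R * a 0%N)) @[r --> (1 : R)^'-] --> (0 : R).
  have -> : (0 : R) = (1 - 1 ^+ 2) * (n0%:R * a 0%N) by rewrite expr1n subrr mul0r.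
  apply: cvg_at_left_filter; apply: cvgM; last exact: cvg_cst.
  by apply: cvgB; [exact: cvg_cst|exact: exprn_continuous].
have /cvgrPdist_le /(_ _ e2) sm := small.
near=> r.
have r01 : 0 < r < 1.
  apply/andP; split; last by near: r; exact: nbhs_left_lt.
  by near: r; apply: nbhs_left_gt.
rewrite ler0_norm ?subr_le0 ?lower// opprB lerBlDr.
apply: le_trans (upper n0 r01) _; rewrite [e]splitr -addrA; apply: lerD.
  have : `|0 - (1 - r ^+ 2) * (n0%:R * a 0%N)| <= e / 2 by near: r.
  by rewrite sub0r normrN => /(le_trans (ler_norm _)).
by rewrite -lerBlDr; apply: le_trans La; rewrite distrC ler_norm.
Unshelve. all: by end_near. Qed.

End abel.

Section curvature.
Context {R : realType} {H : completeNormedModType R[i]} {d : nat}.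
Variable dot : {dot H for @Num.conj R[i]}.
Variable T : 'I_d -> {linear H -> H}.
Context {n : nat}.
Variables (g : 'I_n -> H) (w : 'I_n -> nat).
Variable Gamma : R[i] -> H -> H.
Hypothesis HM : contractive_hilbert_module dot T.
Hypothesis HG : gauge_group dot T Gamma.
Variable N0 : int.
Hypothesis gw : forall i, weight_space Gamma N0 (w i) (g i).
Hypothesis gD : forall x,
  x - \sum_k T k (adjoint dot (T k) x) = \sum_i dot x (g i) *: g i.
Hypothesis gdefect : range (defect dot T) = lin_span (range g).
Hypothesis Hdefect : is_positive_sqrt dot
  (fun x => x - \sum_k T k (adjoint dot (T k) x)) (defect dot T).
Hypothesis d0 : (0 < d)%N.
Local Notation Rn := ((d + d).-tuple (measurableTypeR R)).
Local Notation sigma := (@surface_measure R (d + d)).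
Local Notation sphere := (@esphere R (d + d)).
Local Notation res z := (op_inv (fun y => y - T_at T z y)).
Implicit Types (x : Rn).

Let Hn : inner_product_norm dot := module_norm HM.

Lemma trace_F_at z (q : R) : 0 <= q < 1 ->
  (forall y, rnorm (T_at T z y) <= q * rnorm y) ->
  trace_on dot (range (defect dot T)) (F_at dot T z) =
  (\sum_i rnorm (res z (g i)) ^+ 2)%:C.
Proof.
move=> q01 Tq.
have sV : subspace (range (defect dot T)) by rewrite gdefect; exact: lin_span_subspace.
have [m [e eV]] : exists m (e : 'I_m -> H),
    orthonormal_basis dot (range (defect dot T)) e.
  by apply: (exists_orthonormal_basis Hn (v := g)) => //; rewrite gdefect.
rewrite /trace_on.
set P := (P in xget 0 P).
have : P (xget 0 P) by apply: xgetPex; exists (\sum_i dot (F_at dot T z (e i)) (e i)); exists m, e.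
move: (xget 0 P) => _ [m' [u [uV ->]]] {m e eV P}.
have Rl := resolvent_linear (T_at_linear T z) q01 Tq.
have saD := defect_selfadjoint Hdefect.
have Fu i : dot (F_at dot T z (u i)) (u i) =
    (rnorm (res z (defect dot T (u i))) ^+ 2)%:C.
  rewrite /F_at saD (resolvent_adjoint Hn (T_at_linear T z) q01 Tq).
  by rewrite (dot_rnorm Hn).
under eq_bigr do rewrite Fu.
rewrite -rmorph_sum; congr (_%:C).
apply: (frame_energy Hn uV _ _ _ Rl) => [i|i|y].
- by exists (u i).
- by rewrite gdefect; apply: lin_span_sub; exists i.
- rewrite -gD; have [Dl _ _ <-] := Hdefect.
  have Dy : range (defect dot T) (defect dot T y) by exists y.
  rewrite [in RHS](orthonormal_basis_expand uV Dy) (linear_apply_sum _ _ _ Dl).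
  by apply: eq_bigr => i _; rewrite (linear_applyZ _ _ Dl) saD.
Qed.

Lemma weight_T_at_iter z m j y : weight_space Gamma N0 m y ->
  weight_space Gamma N0 (m + j) (iter j (T_at T z) y).
Proof.
move=> ym; elim: j => [|j IH]; first by rewrite addn0.
rewrite addnS /=; apply: (subspace_sum _ (weight_subspace HG N0 _)).
move=> k _; apply: (subspaceZ _ (weight_subspace HG N0 _)).
exact: (weight_T HG).
Qed.

Lemma rnorm_partial_sum z m N y : weight_space Gamma N0 m y ->
  rnorm (\sum_(j < N) iter j (T_at T z) y) ^+ 2 =
  \sum_(j < N) rnorm (iter j (T_at T z) y) ^+ 2.
Proof.
move=> ym; apply: complexI; rewrite -(dot_rnorm Hn) rmorph_sum dot_suml.
apply: eq_bigr => i _; rewrite dot_sumr (bigD1 i)//= big1 ?addr0 ?(dot_rnorm Hn)//.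
move=> j ji; apply: (weight_orthogonal HG _ (weight_T_at_iter z i ym) (weight_T_at_iter z j ym)).
by rewrite eqn_add2l eq_sym.
Qed.

Definition frame_power_sq m x : R := \sum_i power_sq T m (g i) x.

Lemma K0_cvg x : sphere x -> frame_power_sq^~ x @ \oo --> K0 dot T x.
Proof.
move=> x1; pose a m := frame_power_sq m x.
have a0 m : 0 <= a m by apply: sumr_ge0 => i _; exact: sqr_ge0.
have a_dec m : a m.+1 <= a m.
  apply: ler_sum => i _; rewrite lerXn2r ?nnegrE ?rnorm_ge0//.
  by rewrite (le_trans (T_at_contraction HM _ _))// x1 mul1r.
have ca : cvgn a.
  apply: nonincreasing_is_cvgn; first exact/nonincreasing_seqP.
  by exists 0 => _ [m _ <-].
pose Phi (r : R) := \sum_i rnorm (res (fun k => r%:C * complex_coords x k) (g i)) ^+ 2.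
have zE (r : R) : (fun k => r%:C * complex_coords x k) = complex_coords (scale_tuple r x).
  by apply/funext => k; rewrite complex_coords_scale.
have Tq (r : R) : 0 < r < 1 -> forall y,
    rnorm (T_at T (fun k => r%:C * complex_coords x k) y) <= r * rnorm y.
  move=> /andP[r0 _] y; rewrite zE (le_trans (T_at_contraction HM _ _))//.
  by rewrite enorm_scale// x1 mulr1.
have PhiE r : 0 < r < 1 -> (\sum_(j < m) r ^+ (2 * j) * a j) @[m --> \oo] --> Phi r.
  move=> r01; have r01' : 0 <= r < 1 by case/andP: r01 => /ltW ->.
  have -> : (fun m => \sum_(j < m) r ^+ (2 * j) * a j) = fun m => \sum_i
     rnorm (\sum_(j < m) iter j (T_at T (fun k => r%:C * complex_coords x k)) (g i)) ^+ 2.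
    apply/funext => m; under [RHS]eq_bigr do rewrite (rnorm_partial_sum _ _ (gw _)).
    rewrite exchange_big/=; apply: eq_bigr => j _; rewrite mulr_sumr.
    by apply: eq_bigr => i _; rewrite zE -power_sq_scale.
  apply: cvg_big => [|i _]; first exact: add_continuous.
  exact: (resolvent_partial_cvg (T_at_linear T _) r01' (Tq _ r01)).
have Ab := abel_limit a0 a_dec ca PhiE.
suff -> : K0 dot T x = lim (a @ \oo) by exact: ca.
rewrite /K0; apply: cvg_lim => //; apply: cvg_trans Ab; apply: near_eq_cvg.
near=> r.
have r01 : 0 < r < 1.
  apply/andP; split; last by near: r; exact: nbhs_left_lt.
  by near: r; apply: nbhs_left_gt.
have r01' : 0 <= r < 1 by case/andP: r01 => /ltW ->.
by rewrite (trace_F_at r01' (Tq _ r01)).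
Unshelve. all: by end_near. Qed.

Theorem curvature_cvg :
  (\sum_i word_energy T m.+1 (g i) / 'C(d + m, m.+1)%:R) @[m --> \oo]
    --> curvature dot T.
Proof.
have mS := @measurable_esphere R d.
have iG m i := integrable_power_sq HM m (g i).
have mp m : measurable_fun sphere (frame_power_sq m).
  apply: measurable_sum => i; apply: measurable_funTS.
  exact: (measurable_power_sq HM).
have mK : measurable_fun sphere (K0 dot T).
  by apply: measurable_fun_cvg mp _ => x x1; exact: K0_cvg.
have intE m : (\int[sigma]_(x in sphere) (frame_power_sq m.+1 x)%:E =
    (\sum_i word_energy T m.+1 (g i) / 'C(d + m, m.+1)%:R)%:E)%E.
  under eq_integral do rewrite -sumEFin.
  rewrite (integral_sum mS); last by move=> i; exact: iG.
  rewrite -sumEFin; apply: eq_bigr => i _.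
  rewrite -(sphere_power_integral HM d0) /Rintegral fineK//.
  exact: (integrable_fin_num mS (iG _ _)).
pose M := \sum_i rnorm (g i) ^+ 2.
have [iK _] : [/\ sigma.-integrable sphere (EFin \o K0 dot T),
  [sequence (\int[sigma]_(x in sphere) (`|(EFin \o frame_power_sq m.+1) x - (EFin \o K0 dot T) x|)%E)%E]_m @ \oo --> 0%E &
  [sequence (\int[sigma]_(x in sphere) (EFin \o frame_power_sq m.+1) x)%E]_m @ \oo
    --> (\int[sigma]_(x in sphere) (EFin \o K0 dot T) x)%E].
  apply: (@dominated_convergence _ _ R sigma sphere mS _ _ (cst M%:E)) => //.
  - by move=> m; apply/measurable_EFinP; exact: mp.
  - exact/measurable_EFinP.
  - apply: aeW => x x1; apply: cvg_EFin; first by apply: nearW.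
    have := K0_cvg x1; rewrite -(cvg_shiftS (frame_power_sq^~ x)); exact.
  - exact: finite_measure_integrable_cst.
  - apply: aeW => x m x1 /=; rewrite lee_fin ger0_norm.
      by apply: ler_sum => i _; exact: (power_sq_bound HM).
    by apply: sumr_ge0 => i _; exact: sqr_ge0.
move=> cv; rewrite /curvature.
have -> : (fun m => \sum_i word_energy T m.+1 (g i) / 'C(d + m, m.+1)%:R) =
    fine \o (fun m => \int[sigma]_(x in sphere) (frame_power_sq m.+1 x)%:E)%E.
  by apply/funext => m /=; rewrite intE.
apply: fine_cvg; rewrite /Rintegral fineK//.
exact: (integrable_fin_num mS).
Qed.

End curvature.

(** * Growth of the Hilbert function *)

Section growth.
Context {R : realType}.

Lemma stolz_cesaro (S P : R^nat) (l : R) :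
  (forall n, 0 < P n) -> (forall n, P n < P n.+1) ->
  (forall A, \forall n \near \oo, A <= P n) ->
  ((S n.+1 - S n) / (P n.+1 - P n)) @[n --> \oo] --> l ->
  (S n / P n) @[n --> \oo] --> l.
Proof.
move=> P0 Plt Poo cv; apply/cvgrPdist_le => e e0.
have e2 : 0 < e / 2 by rewrite divr_gt0.
have /cvgrPdist_le /(_ _ e2) [N _ NP] := cv.
have step n : (N <= n)%N ->
    `|S n.+1 - S n - l * (P n.+1 - P n)| <= e / 2 * (P n.+1 - P n).
  move=> Nn; have Dp : 0 < P n.+1 - P n by rewrite subr_gt0.
  have -> : S n.+1 - S n - l * (P n.+1 - P n) =
      - (l - (S n.+1 - S n) / (P n.+1 - P n)) * (P n.+1 - P n).
    by rewrite opprB mulrBl divfK// gt_eqF.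
  rewrite normrM normrN (gtr0_norm Dp) ler_wpM2r ?(ltW Dp)//; exact: NP.
have tail k : `|S (N + k)%N - S N - l * (P (N + k)%N - P N)| <=
    e / 2 * (P (N + k)%N - P N).
  elim: k => [|k IH]; first by rewrite addn0 !subrr !mulr0 subrr normr0.
  rewrite addnS.
  have -> : S (N + k).+1 - S N - l * (P (N + k).+1 - P N) =
     (S (N + k).+1 - S (N + k)%N - l * (P (N + k).+1 - P (N + k)%N)) +
     (S (N + k)%N - S N - l * (P (N + k)%N - P N)) by ring.
  rewrite (le_trans (ler_normD _ _))// (le_trans (lerD (step _ (leq_addr _ _)) IH))//.
  by rewrite -mulrDr addrA subrK.
near=> n.
have Nn : (N <= n)%N by near: n; exact: nbhs_infty_ge.
rewrite -[l](mulfK (lt0r_neq0 (P0 n))) -mulrBl normrM normfV.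
rewrite [`|P n|]gtr0_norm// ler_pdivrMr//.
have -> : l * P n - S n = - (S n - S N - l * (P n - P N)) - (S N - l * P N) by ring.
rewrite (le_trans (ler_normB _ _))// normrN.
have := tail (n - N)%N; rewrite subnKC// => t1.
have t2 : `|S N - l * P N| <= e / 2 * P n.
  by rewrite -ler_pdivrMl//; near: n; exact: Poo.
apply: le_trans (lerD t1 t2) _.
rewrite -mulrDr; apply: (@le_trans _ _ (e / 2 * (P n + P n))).
  by rewrite (ler_wpM2l (ltW e2))// lerD2r gerBl ltW.
by rewrite -mulr2n -[P n *+ 2]mulr_natl mulrA divfK.
Unshelve. all: by end_near. Qed.

Variable d : nat.
Hypothesis d0 : (0 < d)%N.

Definition binom m : R := 'C(d + m, d)%:R.

Lemma binom_gt0 m : 0 < binom m.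
Proof. by rewrite ltr0n bin_gt0 leq_addr. Qed.

Lemma binomS m : binom m.+1 - binom m = 'C(d + m, m.+1)%:R.
Proof.
rewrite /binom -(bin_sub (leq_addr m d)) -(bin_sub (leq_addr m.+1 d)).
by rewrite !addKn addnS binS natrD addrK.
Qed.

Lemma binom_lt m : binom m < binom m.+1.
Proof. by rewrite -subr_gt0 binomS ltr0n bin_gt0; lia. Qed.

Lemma binom_infty (A : R) : \forall m \near \oo, A <= binom m.
Proof.
have ge m : m%:R <= binom m.
  elim: m => [|m IH]; first exact: ltW (binom_gt0 0).
  rewrite -natr1 -[binom _](subrK (binom m)) addrC lerD// binomS ler1n bin_gt0; lia.
exists (Num.Def.archi_bound `|A|) => // m /= Am.
rewrite (le_trans (ler_norm A))// (le_trans (ltW (archi_boundP (normr_ge0 A))))//.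
by rewrite (le_trans _ (ge m))// ler_nat.
Qed.

Lemma binom_ratio k : (binom (m + k) / binom m) @[m --> \oo] --> (1 : R).
Proof.
have rS m : binom m.+1 / binom m = 1 + d%:R * harmonic m.
  apply: (mulIf (lt0r_neq0 (binom_gt0 m))); rewrite divfK ?gt_eqF ?binom_gt0//.
  have m0 : m.+1%:R != 0 :> R by rewrite pnatr_eq0.
  apply: (mulfI m0); rewrite /harmonic/=.
  have -> : m.+1%:R * ((1 + d%:R * m.+1%:R^-1) * binom m) = (m.+1 + d)%:R * binom m.
    by rewrite natrD; field; rewrite addrC natr1.
  rewrite /binom -!natrM; congr (_%:R).
  rewrite -(bin_sub (leq_addr m d)) -(bin_sub (leq_addr m.+1 d)) !addKn.
  by rewrite addnS -mul_bin_diag /= addSn (addnC m).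
elim: k => [|k IH].
  under eq_fun do rewrite addn0 divff ?gt_eqF ?binom_gt0//.
  exact: cvg_cst.
have -> : (fun m => binom (m + k.+1) / binom m) =
    (fun m => (1 + d%:R * harmonic (m + k)%N) * (binom (m + k) / binom m)).
  apply/funext => m; rewrite -rS addnS mulrA divfK// gt_eqF// binom_gt0//.
rewrite -[X in _ --> X]mulr1; apply: cvgM IH.
rewrite -[X in _ --> X]addr0; apply: cvgD; first exact: cvg_cst.
rewrite -(mulr0 d%:R); apply: cvgM; first exact: cvg_cst.
by rewrite (cvg_shiftn k (@harmonic R)); exact: cvg_harmonic.
Qed.

(** Partial sums may be shifted, the growth being polynomial. *)
Lemma shifted_sum_cvg (e : R^nat) (w : nat) (l : R) :
  (e m.+1 / 'C(d + m, m.+1)%:R) @[m --> \oo] --> l ->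
  ((\sum_(k < m.+1 | (w <= k)%N) e (k - w)%N) / binom m) @[m --> \oo] --> l.
Proof.
move=> el; pose S m := \sum_(j < m.+1) e j.
have Sl : (S m / binom m) @[m --> \oo] --> l.
  apply: stolz_cesaro; [exact: binom_gt0|exact: binom_lt|exact: binom_infty|].
  have -> : (fun m => (S m.+1 - S m) / (binom m.+1 - binom m)) =
    (fun m => e m.+1 / 'C(d + m, m.+1)%:R); last by [].
  by apply/funext => m; rewrite binomS /S big_ord_recr/= addrAC subrr add0r.
rewrite -(cvg_shiftn w).
have -> : (fun m => (\sum_(k < (m + w).+1 | (w <= k)%N) e (k - w)%N) / binom (m + w)) =
    (fun m => S m / binom m * (binom (m + w) / binom m)^-1).
  apply/funext => m; rewrite invf_div mulrA divfK ?gt_eqF ?binom_gt0//; congr (_ / _).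
  rewrite -(big_mkord (fun k => (w <= k)%N) (fun k => e (k - w)%N)).
  rewrite (big_cat_nat (n := w))/=; [|by []|lia].
  rewrite big_nat_cond big_pred0 ?add0r; last by move=> k; lia.
  rewrite -{1}[w]add0n big_addn /S -(big_mkord xpredT e).
  have -> : ((m + w).+1 - w = m.+1)%N by lia.
  by apply: eq_big => [k|k _]; rewrite ?leq_addl// addnK.
rewrite -(divr1 l); apply: cvgM => //; apply: cvgV; first exact: oner_neq0.
exact: binom_ratio.
Qed.

End growth.

(** * The curvature is the Euler characteristic *)

Section framed_module.
Context {R : realType} {H : completeNormedModType R[i]} {d : nat}.
Variable dot : {dot H for @Num.conj R[i]}.
Variable T : 'I_d -> {linear H -> H}.
Context {n : nat}.
Variables (g : 'I_n -> H) (w : 'I_n -> nat).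
Variable Gamma : R[i] -> H -> H.
Hypothesis HM : contractive_hilbert_module dot T.
Hypothesis HG : gauge_group dot T Gamma.
Variable N0 : int.
Hypothesis HN0 : forall k, gauge_spectrum Gamma k -> N0 <= k.
Hypothesis gw : forall i, weight_space Gamma N0 (w i) (g i).
Hypothesis gD : forall x,
  x - \sum_k T k (adjoint dot (T k) x) = \sum_i dot x (g i) *: g i.
Hypothesis gdefect : range (defect dot T) = lin_span (range g).
Hypothesis Hdefect : is_positive_sqrt dot
  (fun x => x - \sum_k T k (adjoint dot (T k) x)) (defect dot T).
Hypothesis d0 : (0 < d)%N.

(** The mean of [|T(z)^n x|^2] over the sphere decreases in [n]. *)
Lemma word_energy_cvg x : exists l : R,
  (word_energy T m.+1 x / 'C(d + m, m.+1)%:R) @[m --> \oo] --> l.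
Proof.
apply/cvg_ex; apply: nonincreasing_is_cvgn.
  apply/nonincreasing_seqP => m; rewrite -!(sphere_power_integral HM d0).
  have mS := @measurable_esphere R d.
  apply: (le_Rintegral mS); try exact: (integrable_power_sq HM).
  move=> t t1; rewrite lerXn2r ?nnegrE ?rnorm_ge0//.
  by rewrite (le_trans (T_at_contraction HM _ _))// t1 mul1r.
by exists 0 => _ [m _ <-]; rewrite divr_ge0// word_energy_ge0.
Qed.

Definition frame_energy_sum m : R :=
  \sum_(k < m.+1) \sum_(i | (w i <= k)%N) word_energy T (k - w i) (g i).

Lemma frame_energy_sum_cvg :
  (frame_energy_sum m / @binom R d m) @[m --> \oo] --> curvature dot T.
Proof.
have [l lP] := choice (fun i => word_energy_cvg (g i)).
have lK : \sum_i l i = curvature dot T.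
  apply: (cvg_unique _ _ (curvature_cvg HM HG gw gD gdefect Hdefect d0)) => //.
  by apply: cvg_big => [|i _]; [exact: add_continuous|exact: lP].
rewrite -lK.
have -> : (fun m => frame_energy_sum m / @binom R d m) = fun m => \sum_i
    ((\sum_(k < m.+1 | (w i <= k)%N) word_energy T (k - w i) (g i)) / @binom R d m).
  apply/funext => m; rewrite /frame_energy_sum -mulr_suml; congr (_ / _).
  by rewrite (exchange_big_dep xpredT).
apply: cvg_big => [|i _]; first exact: add_continuous.
exact: (shifted_sum_cvg d0 (e := fun j => word_energy T j (g i))).
Qed.

Lemma curvature_resolution N (b : nat -> nat) eps phi :
  @free_resolution _ _ _ T (M_module dot T) N b eps phi ->
  curvature dot T = (\sum_(k < N) (-1) ^+ k * (b k)%:Z)%:~R.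
Proof.
move=> res; rewrite (euler_sum res).
have [c lower] := hilbert_lower w HM gdefect res.
have [c1 [c2 upper]] := hilbert_upper w HM gdefect res.
set rho := \rank _ in lower upper *.
have rb : (rho <= b 0%N)%N by exact: rank_leq_col.
have basis := word_span_basis HM HG HN0 gw gD.
have E := frame_energy_sum_cvg.
rewrite -pmulrn; apply/eqP; rewrite eq_le; apply/andP; split.
  have u : (frame_energy_sum (m + c2) / @binom R d (m + c2) * (@binom R d (m + c2) / @binom R d m)
      + rho%:R * (@binom R d (m + c1) / @binom R d m)) @[m --> \oo] -->
      curvature dot T * 1 + rho%:R * 1.
    apply: cvgD; apply: cvgM; try exact: binom_ratio; last exact: cvg_cst.
    by rewrite (cvg_shiftn c2 (fun m => frame_energy_sum m / @binom R d m)).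
  have v : ((b 0%N)%:R * (@binom R d (m + (c2 + c1)) / @binom R d m)) @[m --> \oo] -->
      ((b 0%N)%:R * 1 : R).
    by apply: cvgM; [exact: cvg_cst|exact: binom_ratio].
  rewrite natrB// lerBrDr -[curvature _ _]mulr1 -[rho%:R]mulr1 -[(b 0%N)%:R]mulr1.
  apply: (ler_cvg_to u v); apply: nearW => m.
  have [k [e [eW kE]]] := basis (m + c2)%N.
  have := upper (m + c2)%N (m + c1)%N k e eW ltac:(lia).
  rewrite -(ler_nat R) natrD !natrM kE -/(frame_energy_sum _) -/(@binom R d _) addnA => h.
  rewrite !mulrA divfK ?gt_eqF ?binom_gt0// -mulrDl ler_pM2r ?invr_gt0 ?binom_gt0//.
  by move: h; rewrite /binom !addnA.
have u : ((b 0%N - rho)%:R * (@binom R d m / @binom R d (m + c))) @[m --> \oo] -->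
    ((b 0%N - rho)%:R * 1^-1 : R).
  apply: cvgM; first exact: cvg_cst.
  under eq_fun do rewrite -invf_div.
  by apply: cvgV; [exact: oner_neq0|exact: binom_ratio].
have v : (frame_energy_sum (m + c) / @binom R d (m + c)) @[m --> \oo] --> curvature dot T.
  by rewrite (cvg_shiftn c (fun m => frame_energy_sum m / @binom R d m)).
rewrite -[(b 0%N - rho)%:R]mulr1 -[X in _ * X]invr1.
apply: (ler_cvg_to u v); apply: nearW => m.
have [k [e [eW kE]]] := basis (m + c)%N.
rewrite mulrA ler_pM2r ?invr_gt0 ?binom_gt0// /frame_energy_sum -kE /binom -natrM ler_nat.
exact: lower eW (leqnn _).
Qed.

End framed_module.

Section degenerate.
Context {R : realType} {H : completeNormedModType R[i]} {d : nat}.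
Variable dot : {dot H for @Num.conj R[i]}.
Variable T : 'I_d -> {linear H -> H}.
Hypothesis HM : contractive_hilbert_module dot T.
Hypothesis defect0 : defect dot T = fun=> 0.

Let g0 : 'I_0 -> H := fun=> 0.

Lemma range_defect0 : range (defect dot T) = lin_span (range g0).
Proof.
apply/seteqP; split => [_ [x _ <-]|x /lin_span_range [c ->]].
  by rewrite defect0; have [] := lin_span_subspace (range g0).
by exists 0 => //; rewrite defect0 big_ord0.
Qed.

Lemma curvature_defect0 : curvature dot T = 0.
Proof.
rewrite /curvature (_ : K0 dot T = cst 0); first by rewrite Rintegral_cst ?mul0r//; exact: measurable_esphere.
apply/funext => x; rewrite /K0; apply: cvg_lim => //.
rewrite (_ : (fun r : R => _) = cst 0); first exact: cvg_cst.
apply/funext => r /=; rewrite /trace_on; set P := (P in xget 0 P).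
have [_ _ [n [e [_ ->]]]|_] := xgetP 0 P; last by rewrite raddf0 mulr0.
rewrite big1 ?raddf0 ?mulr0// => i _.
by rewrite /F_at defect0 dot0l.
Qed.

Lemma euler_defect0 N (b : nat -> nat) eps phi :
  @free_resolution _ _ _ T (M_module dot T) N b eps phi ->
  \sum_(k < N) (-1) ^+ k * (b k)%:Z = 0.
Proof.
move=> res; rewrite (euler_sum res).
have [c lower] := hilbert_lower (fun=> 0%N) HM range_defect0 res.
have W0 : orthonormal_basis dot (word_span T g0 (fun=> 0%N) c) g0.
  split=> [[] //|]; apply/seteqP; split; last first.
    apply: lin_span_min; first exact: lin_span_subspace.
    by move=> v [[j jlt] _].
  apply: lin_span_min; first exact: lin_span_subspace.
  move=> v [k _]; have -> : word_frame T g0 (fun=> 0%N) k = [::].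
    elim: k => [|k /= ->]; rewrite /= enum_ord0//=.
    by elim: (enum _).
  by [].
have := lower c 0%N 0%N g0 W0 (leqnn _).
by rewrite addn0 binn muln1 leqn0 => /eqP ->.
Qed.

End degenerate.

Local Close Scope complex_scope.

Theorem theoremB (R : realType) (d : nat) (H : completeNormedModType R[i])
    (dot : {dot H for @Num.conj R[i]}) (T : 'I_d -> {linear H -> H})
    (Gamma : R[i] -> H -> H) :
  (0 < d)%N ->
  contractive_hilbert_module dot T ->
  finite_rank dot T ->
  separable_space H ->
  gauge_group dot T Gamma ->
  has_lbound (gauge_spectrum Gamma) ->
  curvature dot T = (euler_char dot T)%:~R /\ curvature dot T \is a Num.int.
Proof.
move=> d0 HM HF _ HG [N0 HN0].
pose P (x : H) := x - \sum_k T k (adjoint dot (T k) x).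
suff [[N [b [eps [phi res]]]] main] :
    (exists N b eps phi, @free_resolution _ _ _ T (M_module dot T) N b eps phi) /\
    (forall N b eps phi, @free_resolution _ _ _ T (M_module dot T) N b eps phi ->
      curvature dot T = (\sum_(k < N) (-1) ^+ k * (b k)%:Z)%:~R).
  have e : curvature dot T = (euler_char dot T)%:~R.
    rewrite /euler_char; set Q := (Q in xget 0 Q).
    have : Q (xget 0 Q) by apply: xgetPex; eexists; exists N, b, eps, phi; split; first exact: res.
    by move: (xget 0 Q) => _ [? [? [? [? [/main -> ->]]]]].
  by split=> //; rewrite e intr_int.
have [[S HS]|noS] := pselect (exists S, is_positive_sqrt dot P S).
  have Hdefect : is_positive_sqrt dot P (defect dot T).
    exact: (@xgetPex _ (fun=> 0) (is_positive_sqrt dot P) (ex_intro _ S HS)).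
  have [n [g [w [gw gD gdefect]]]] := weighted_frame HM HG HN0 HF Hdefect.
  split; first exact: (resolution_ex HM HG gw gdefect d0).
  move=> N b eps phi res.
  exact: (curvature_resolution HM HG HN0 gw gD gdefect Hdefect d0 res).
have D0 : defect dot T = fun=> 0.
  by apply: xgetPN => S HS; apply: noS; exists S.
split=> [|N b eps phi res].
  apply: (@resolution_ex _ _ _ dot T 0 _ (fun=> 0%N) Gamma HM HG N0 _ (range_defect0 D0) d0).
  by case.
by rewrite (curvature_defect0 D0) (euler_defect0 HM D0 res).
Qed.
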